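(* Let $0<\alpha<2$. If $(\mathbf X,\mathbf Y)$ is a pair of random vectors in separable Hilbert spaces $\mathcal H$ and $\mathcal H'$ respectively, and $\mathbb E\|\mathbf X\|^\alpha<\infty$ and $\mathbb E\|\mathbf Y\|^\alpha<\infty$, then $$\mathrm{dcov}^{\mathsf H}_\alpha(\mathbf X,\mathbf Y)=\widehat{\mathrm{dcov}}_\alpha(\mathbf X,\mathbf Y)=\widetilde{\mathrm{dcov}}_\alpha(\mathbf X,\mathbf Y),$$ and this value is finite.
   Context: Hilbert spaces have real scalars; $\|\cdot\|$ is the Hilbert norm. Let $(\mathbf X_i,\mathbf Y_i)$, $i\ge1$, be independent copies of $(\mathbf X,\mathbf Y)$. $\widehat{\mathrm{dcov}}_\alpha(\mathbf X,\mathbf Y):=\frac14\mathbb E[\widehat X_\alpha\widehat Y_\alpha]$, where $\widehat X_\alpha:=\|\mathbf X_1-\mathbf X_2\|^\alpha-\|\mathbf X_2-\mathbf X_3\|^\alpha+\|\mathbf X_3-\mathbf X_4\|^\alpha-\|\mathbf X_4-\mathbf X_1\|^\alpha$ and $\widehat Y_\alpha$ is defined in the same way with $\mathbf Y_i$. $\widetilde{\mathrm{dcov}}_\alpha(\mathbf X,\mathbf Y):=\mathbb E[\widetilde X_\alpha\widetilde Y_\alpha]$, where $\widetilde X_\alpha:=\mathbb E(\widehat X_\alpha\mid\mathbf X_1,\mathbf X_2)$ and $\widetilde Y_\alpha:=\mathbb E(\widehat Y_\alpha\mid\mathbf Y_1,\mathbf Y_2)$. $\mathrm{dcov}^{\mathsf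 H}_\alpha$: fix orthonormal bases $(\mathbf e_i)_i$ of $\mathcal H$ and $(\mathbf e'_j)_j$ of $\mathcal H'$, and i.i.d. $N(0,1)$ random variables $\xi_i$, $1\le i\le\dim\mathcal H$, and $\eta_j$, $1\le j\le\dim\mathcal H'$ (finitely or countably infinitely many), all independent of each other and of $(\mathbf X,\mathbf Y)$; write $\boldsymbol\xi=(\xi_i)_i$, $\boldsymbol\eta=(\eta_j)_j$, $\boldsymbol\xi\cdot\mathbf x:=\sum_i\langle\mathbf x,\mathbf e_i\rangle\xi_i$ and $\boldsymbol\eta\cdot\mathbf y:=\sum_j\langle\mathbf y,\mathbf e'_j\rangle\eta_j$ (a.s. convergent sums). With $c_\alpha:=\alpha2^{\alpha/2}/\Gamma(1-\alpha/2)$, $$\mathrm{dcov}^{\mathsf H}_\alpha(\mathbf X,\mathbf Y):=c_\alpha^2\int_0^\infty\!\!\int_0^\infty\mathbb E\Bigl|\mathbb E\bigl(e^{\mathrm ir\boldsymbol\xi\cdot\mathbf X+\mathrm is\boldsymbol\eta\cdot\mathbf Y}\mid\boldsymbol\xi,\boldsymbol\eta\bigr)-\mathbb E\bigl(e^{\mathrm ir\boldsymbol\xi\cdot\mathbf X}\mid\boldsymbol\xi\bigr)\mathbb E\bigl(e^{\mathrm is\boldsymbol\eta\cdot\mathbf Y}\mid\boldsymbol\eta\bigr)\Bigr|^2\frac{dr\,ds}{r^{\alpha+1}s^{\alpha+1}}\in[0,\infty].$$ *)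

(* Defs.v *)
From HB Require Import structures.
From mathcomp Require Import all_boot all_order all_algebra finmap.
From mathcomp Require Import all_classical all_reals all_analysis.
From mathcomp Require Import sesquilinear.
From mathcomp Require Import complex.

Set Implicit Arguments.
Unset Strict Implicit.
Unset Printing Implicit Defensive.

Import Order.TTheory GRing.Theory Num.Theory.
Import numFieldNormedType.Exports.

Local Open Scope classical_set_scope.
Local Open Scope ring_scope.

Notation borel H := (g_sigma_algebraType (@open H)).

Definition separable (T : topologicalType) :=
  exists2 D : set T, countable D & dense D.

(** A real Hilbert space is a complete normed module [H] with a dot product
    [ip] that induces the norm of [H]. *)
Definition induces_norm (R : realType) (H : normedModType R)
    (ip : {dot H for @idfun R}) :=
  forall x : H, ip x x = `|x| ^+ 2.

(** Index set of an orthonormal basis: {0, ..., n-1} for [Some n],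
    the whole of nat for [None]. *)
Definition in_dim (dim : option nat) (i : nat) : bool :=
  if dim is Some n then (i < n)%N else true.

Section orthonormal_basis.
Context (R : realType) (H : completeNormedModType R).
Variable ip : {dot H for @idfun R}.

Definition orthonormal_basis (dim : option nat) (e : nat -> H) :=
  (forall i j, in_dim dim i -> in_dim dim j -> ip (e i) (e j) = (i == j)%:R) /\
  dense [set x : H | exists (n : nat) (a : nat -> R),
           x = \sum_(0 <= i < n | in_dim dim i) a i *: e i].

End orthonormal_basis.

Section probability_notions.
Context d (T : measurableType d) (R : realType) (P : probability T R).

(** [W] is a version of the conditional expectation of [Z] given the
    sigma-algebra [G]. *)
Definition is_cond_exp (G : set (set T)) (Z W : T -> R) :=
  [/\ g_sigma_algebra_preimage W `<=` G,
      P.-integrable setT (EFin \o W) &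
      forall A, G A ->
        (\int[P]_(w in A) (W w)%:E = \int[P]_(w in A) (Z w)%:E)%E].

(** A chosen version; the value is 0 when no version exists. *)
Definition cond_exp (G : set (set T)) (Z : T -> R) : T -> R :=
  xget (cst 0) [set W | is_cond_exp G Z W].

Definition ccond_exp (G : set (set T)) (Z : T -> R[i]) : T -> R[i] :=
  fun w => (cond_exp G (fun v => complex.Re (Z v)) w +i*
            cond_exp G (fun v => complex.Im (Z v)) w)%C.

(** Mutual independence of the set systems [F i], [i] ranging over [D]. *)
Definition mutually_independent (I : choiceType) (D : set I)
    (F : I -> set (set T)) :=
  forall (J : {fset I}) (A : I -> set T), [set` J] `<=` D ->
    (forall i, i \in J -> F i (A i)) ->
    (P (\bigcap_(i in [set` J]) A i) = \prod_(i <- J) P (A i))%E.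

End probability_notions.

(** The two laws are compared on measurable sets only: off them the values of
    a measure carry no meaning. *)
Definition same_law d1 (T1 : measurableType d1) d2 (T2 : measurableType d2)
    d (S : measurableType d) (R : realType)
    (P1 : probability T1 R) (P2 : probability T2 R)
    (f1 : T1 -> S) (f2 : T2 -> S) :=
  forall A, measurable A -> P1 (f1 @^-1` A) = P2 (f2 @^-1` A).

Definition standard_normal d (T : measurableType d) (R : realType)
    (P : probability T R) (f : T -> R) :=
  forall A : set R, measurable A -> P (f @^-1` A) = normal_prob 0 1 A.

Definition Gamma (R : realType) (x : R) : R :=
  \int[lebesgue_measure]_(t in `]0%R, +oo[) (t `^ (x - 1) * expR (- t)).

Definition c_const (R : realType) (alpha : R) : R :=
  alpha * 2 `^ (alpha / 2) / Gamma (1 - alpha / 2).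

Definition cexpi (R : realType) (t : R) : R[i] := (cos t +i* sin t)%C.

Section sigma_algebras.
Context d (T : measurableType d) (R : realType).
Context (H H' : completeNormedModType R).

Definition sigma_pair (X : T -> borel H) (Y : T -> borel H') : set (set T) :=
  <<s g_sigma_algebra_preimage X `|` g_sigma_algebra_preimage Y >>.

Definition sigma_seq (dim : option nat) (xi : nat -> T -> R) : set (set T) :=
  <<s \bigcup_(i in [set k | in_dim dim k]) g_sigma_algebra_preimage (xi i) >>.

End sigma_algebras.

Section copies.
Context d (T : measurableType d) d' (T' : measurableType d') (R : realType).
Context (P : probability T R) (P' : probability T' R).
Context (H H' : completeNormedModType R).

Definition independent_copies (X : T -> borel H) (Y : T -> borel H')
    (Xs : nat -> T' -> borel H) (Ys : nat -> T' -> borel H') :=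
  mutually_independent P' setT (fun i => sigma_pair (Xs i) (Ys i)) /\
  forall i, same_law P' P (fun w => (Xs i w, Ys i w)) (fun w => (X w, Y w)).

End copies.

(** The copies are numbered from 0. *)
Section dcov_hat_tilde.
Context d (T : measurableType d) (R : realType) (P : probability T R).
Variable alpha : R.

Definition hat (H : completeNormedModType R) (X : nat -> T -> H) : T -> R :=
  fun w => `|X 0%N w - X 1%N w| `^ alpha - `|X 1%N w - X 2%N w| `^ alpha
         + `|X 2%N w - X 3%N w| `^ alpha - `|X 3%N w - X 0%N w| `^ alpha.

Definition tilde (H : completeNormedModType R) (X : nat -> T -> H) : T -> R :=
  cond_exp P (sigma_pair (X 0%N : T -> borel H) (X 1%N : T -> borel H)) (hat X).

Context (H H' : completeNormedModType R).

Definition dcov_hat (X : nat -> T -> H) (Y : nat -> T -> H') : \bar R :=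
  ((1 / 4)%:E * 'E_P[fun w => (hat X w * hat Y w)%R])%E.

Definition dcov_tilde (X : nat -> T -> H) (Y : nat -> T -> H') : \bar R :=
  'E_P[fun w => (tilde X w * tilde Y w)%R]%E.

End dcov_hat_tilde.

Section dcovH.
Context d (T : measurableType d) (R : realType) (P : probability T R).
Context (H H' : completeNormedModType R).
Context (ip : {dot H for @idfun R}) (ip' : {dot H' for @idfun R}).

(** [xi . x]; on the null set where the series diverges the limit
    is an arbitrary constant. *)
Definition gauss_dot (K : completeNormedModType R) (q : {dot K for @idfun R})
    (dim : option nat) (e : nat -> K) (xi : nat -> T -> R) (x : K) (w : T) : R :=
  limn (fun n => \sum_(0 <= i < n | in_dim dim i) q x (e i) * xi i w).

(** All the [xi i], all the [eta j] and the pair [(X, Y)] (index [None]) are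
    mutually independent, the [xi i] and [eta j] being standard normal. *)
Definition gaussian_family (dim dim' : option nat) (xi eta : nat -> T -> R)
    (X : T -> borel H) (Y : T -> borel H') :=
  [/\ forall i, in_dim dim i -> standard_normal P (xi i),
      forall j, in_dim dim' j -> standard_normal P (eta j) &
      mutually_independent P
        [set k : option (nat + nat) | match k with
          | Some (inl i) => in_dim dim i
          | Some (inr j) => in_dim dim' j
          | None => true
          end]
        (fun k => match k with
          | Some (inl i) => g_sigma_algebra_preimage (xi i)
          | Some (inr j) => g_sigma_algebra_preimage (eta j)
          | None => sigma_pair X Y
          end)].

Variable alpha : R.
Variables (dim : option nat) (e : nat -> H) (xi : nat -> T -> R).
Variables (dim' : option nat) (e' : nat -> H') (eta : nat -> T -> R).
Variables (X : T -> H) (Y : T -> H').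

Let Gxi := sigma_seq dim xi.
Let Geta := sigma_seq dim' eta.
Let Gxieta := <<s Gxi `|` Geta >>.
Let A w := gauss_dot ip dim e xi (X w) w.
Let B w := gauss_dot ip' dim' e' eta (Y w) w.

Definition cf_diff (r s : R) : T -> R[i] := fun w =>
  ccond_exp P Gxieta (fun v => cexpi (r * A v + s * B v)) w
  - ccond_exp P Gxi (fun v => cexpi (r * A v)) w
    * ccond_exp P Geta (fun v => cexpi (s * B v)) w.

Definition dcovH : \bar R :=
  ((c_const alpha ^+ 2)%:E *
   \int[lebesgue_measure]_(r in `]0%R, +oo[)
     \int[lebesgue_measure]_(s in `]0%R, +oo[)
       ('E_P[fun w => (Normc.normc (cf_diff r s w) ^+ 2)%R] *
        ((r `^ (alpha + 1) * s `^ (alpha + 1))^-1)%R%:E))%E.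

End dcovH.

(* Main.v *)
(** Write [hat k] for [k x0 x1 - k x1 x2 + k x2 x3 - k x3 x0] and
    [K_r x y = exp (- r^2 |x - y|^2 / 2)], which is [E exp (i r xi.(x - y))].
    The conditional characteristic functions are integrals over the law of
    [(X, Y)] at frozen [xi] and [eta], so their difference is a covariance, and
    averaging its squared modulus over [xi] and [eta] gives
    [E (hat K_r (X) * hat K_s (Y)) / 4].
    As [1 - K_r] integrates against [r ^ (-alpha-1) dr] to
    [|x - y|^alpha / c_alpha], integrating [hat K_r] produces
    [- hat |.|^alpha / c_alpha], and the first equality is Fubini's theorem.
    It applies under the mere moments of order [alpha] thanks to
    [|hat K_r| <= l (1 - K_r x0 x2) + l^-1 (1 - K_r x1 x3)] for every [l > 0],
    which bounds the integral of [|hat K_r|] by a multiple of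
    [|x0 - x2|^(alpha/2) * |x1 - x3|^(alpha/2)].
    For the second equality, [hat = h01 - h21 + h23 - h03] where [h01] is the
    projection of [hat] on the first two copies; the four terms contribute
    equally by exchangeability. *)

Require Import Defs.
From HB Require Import structures.
From mathcomp Require Import all_boot all_order all_algebra finmap.
From mathcomp Require Import all_classical all_reals all_analysis.
From mathcomp Require Import sesquilinear.
From mathcomp Require Import complex.
From mathcomp Require Import measurable_realfun.
From mathcomp Require Import ring lra.

Set Implicit Arguments.
Unset Strict Implicit.
Unset Printing Implicit Defensive.

Import Order.TTheory GRing.Theory Num.Theory.
Import numFieldNormedType.Exports.

Local Open Scope classical_set_scope.
Local Open Scope ring_scope.

(** * Independence *)

(** The bound on [hat K_r] is a weighted arithmetic-geometric mean inequality. With [a] the Gaussian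
    functional, [hat K_r] is the mean of the real part of (exp(i a0) - exp(i a2)) (exp(-i a1) -
    exp(-i a3)), so an inequality between deterministic kernels is drawn from the random family that
    the theorem provides. The product form of the integrated bound is decisive. |x|^(alpha/2) is
    square integrable, and so is a product of such functions at independent points; hence the hats
    of X and of Y are both in L2 and their product is integrable, although X and Y may be dependent
    and E |X|^alpha |Y|^alpha may be infinite. The four points must stay together for this: a single
    term |x0 - x1|^alpha need not be square integrable, and a single K_r is not integrable against
    the weight at r = 0. Conditional expectations are chosen versions, known only almost everywhere.
    For fixed r and s each is therefore replaced by an explicit integral before anything is
    integrated in r and s. *)

Section independence.
Context d (T : measurableType d) (R : realType) (P : probability T R).

Definition indep (F G : set (set T)) :=
  forall A B, F A -> G B -> (P (A `&` B) = P A * P B)%E.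

Lemma indepC (F G : set (set T)) : indep F G -> indep G F.
Proof. by move=> h A B GA FB; rewrite setIC h// muleC. Qed.

Lemma indepS (F G F' G' : set (set T)) :
  F `<=` F' -> G `<=` G' -> indep F' G' -> indep F G.
Proof. by move=> FF GG h A B /FF FA /GG GB; exact: h. Qed.

(** For fixed [B] in [G], the finite measures [P (A & B)] and [P B * P A] of [A] agree on the
    pi-system [F], hence on the sigma-algebra it generates. *)
Lemma indep_sigmal (F G : set (set T)) :
  F `<=` measurable -> G `<=` measurable -> setI_closed F -> F setT ->
  indep F G -> indep <<s F >> G.
Proof.
move=> Fm Gm FI FT h A B sFA GB.
have mB := Gm _ GB.
have PB0 : 0 <= fine (P B) by exact: fine_ge0.
have cover : \bigcup_(k in @setT nat) (@setT T) = setT.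
  by rewrite bigcup_const//; exists 0%N.
rewrite -[LHS]/(mrestr P mB A).
rewrite (@g_sigma_algebra_measure_unique _ R T F Fm (fun=> setT) (fun=> FT)
  cover (mrestr P mB) (mscale (NngNum PB0) P) FI _ _ A sFA).
- by rewrite -[LHS]/((fine (P B))%:E * P A)%E fineK ?fin_num_measure// muleC.
- move=> C FC; rewrite -[LHS]/(P (C `&` B)) -[RHS]/((fine (P B))%:E * P C)%E.
  by rewrite fineK ?fin_num_measure// h// muleC.
- by move=> _; rewrite -[X in (X < _)%E]/(P (setT `&` B)) setTI ltey_eq fin_num_measure.
Qed.

Lemma sigma_sub_measurable (F : set (set T)) :
  F `<=` measurable -> <<s F >> `<=` measurable.
Proof. by move=> Fm; apply: smallest_sub => //; exact: sigma_algebra_measurable. Qed.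

Lemma indep_sigma (F G : set (set T)) :
  F `<=` measurable -> G `<=` measurable -> setI_closed F -> F setT ->
  setI_closed G -> G setT ->
  indep F G -> indep <<s F >> <<s G >>.
Proof.
move=> Fm Gm FI FT GI GT h.
apply: indep_sigmal => //; first exact: sigma_sub_measurable.
by apply: indepC; apply: indep_sigmal => //; exact: indepC.
Qed.

Section mutual.
Variables (I : choiceType) (D : set I) (F : I -> set (set T)).
Hypothesis hF : mutually_independent P D F.
Hypothesis Fm : forall i, D i -> F i `<=` measurable.
Hypothesis FT : forall i, D i -> F i setT.
Hypothesis FI : forall i, D i -> setI_closed (F i).

(** The union of the [F i] is not closed under intersection; its finite intersections are, and they
    generate the same sigma-algebra. *)
Let pis (D1 : set I) : set (set T) :=
  [set B | exists (J : {fset I}) (A : I -> set T), [/\ [set` J] `<=` D1,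
    (forall i, i \in J -> F i (A i)) & B = \bigcap_(i in [set` J]) A i]].

Let pisI D1 : D1 `<=` D -> setI_closed (pis D1).
Proof.
move=> D1D _ _ [J [A [JD AF ->]]] [J' [A' [JD' AF' ->]]].
(* Each family is padded with [setT] outside its own index set, so that both intersections run over
   the union of [J] and [J']. *)
exists (J `|` J')%fset, (fun i => (if i \in J then A i else setT) `&`
  (if i \in J' then A' i else setT)); split.
- by move=> i /=; rewrite inE => /orP[/JD|/JD'].
- move=> i; rewrite inE => iJ.
  have Di : D i by apply: D1D; case/orP : iJ => [/JD|/JD'].
  apply: FI => //; case: ifPn => h; [exact: AF|exact: FT|exact: AF'|exact: FT].
- rewrite bigcapI; congr (_ `&` _); apply/seteqP; split => x h i /= iJ.
  + by case: ifPn => // ?; exact: h.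
  + by have := h i; rewrite /= inE iJ => /(_ isT).
  + by case: ifPn => // ?; exact: h.
  + by have := h i; rewrite /= inE iJ orbT => /(_ isT).
Qed.

Let pisT D1 : pis D1 setT.
Proof.
exists fset0, (fun=> setT); split; [by move=> i|by move=> i|].
by apply/esym; exact: bigcapT.
Qed.

Let pism D1 : D1 `<=` D -> pis D1 `<=` measurable.
Proof.
move=> D1D _ [J [A [JD AF ->]]]; apply: fin_bigcap_measurable => //= i iJ.
by apply: (@Fm i); [exact/D1D/JD|exact: AF].
Qed.

(** Grouping by disjoint blocks: the product formula passes to finite intersections within each
    block, and from these pi-systems to the generated sigma-algebras. *)
Lemma mutually_independent_indep (D1 D2 : set I) : D1 `<=` D -> D2 `<=` D ->
  (forall i, D1 i -> ~ D2 i) ->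
  indep <<s \bigcup_(i in D1) F i >> <<s \bigcup_(i in D2) F i >>.
Proof.
move=> D1D D2D D12.
have sub D' : \bigcup_(i in D') F i `<=` pis D'.
  move=> B [i Di FB]; exists [fset i]%fset, (fun=> B); split => //.
  + by move=> j /=; rewrite inE => /eqP ->.
  + by move=> j; rewrite inE => /eqP ->.
  + by rewrite bigcap_const//; exists i; rewrite /= inE.
have : indep <<s pis D1 >> <<s pis D2 >>.
  apply: indep_sigma; [exact: pism|exact: pism|exact: pisI|exact: pisT|
    exact: pisI|exact: pisT|].
  move=> _ _ [J [A [JD AF ->]]] [J' [A' [JD' AF' ->]]].
  have dis i : i \in J' -> i \in J = false.
    by move=> /JD' D2i; apply/negP => /JD /D12.
  rewrite (hF (subset_trans JD D1D) AF) (hF (subset_trans JD' D2D) AF').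
  (* Since [J] and [J'] are disjoint, the two families glue into one, to which the product formula
     applies as a whole. *)
  rewrite -[X in P X](_ : \bigcap_(i in [set` (J `|` J')%fset])
    (if i \in J then A i else A' i) = _); last first.
    apply/seteqP; split=> [x h|x [h h'] i /=].
      split => i /= iJ; have := h i; rewrite /= inE iJ ?orbT => /(_ isT)//.
      by rewrite dis.
    by rewrite inE; case: ifPn => /= iJ; [move=> _; exact: h|move=> ?; exact: h'].
  rewrite hF; last 2 first.
  - by move=> i /=; rewrite inE => /orP[/JD/D1D|/JD'/D2D].
  - move=> i; rewrite inE; case: ifPn => /= iJ; first by move=> _; exact: AF.
    by move=> ?; exact: AF'.
  have peq : perm_eq (J `|` J')%fset (enum_fset J ++ enum_fset J').
    apply: uniq_perm; rewrite ?fset_uniq//.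
      rewrite cat_uniq !fset_uniq andbT/=.
      by apply/hasPn => i /dis /negbT.
    by move=> i; rewrite inE mem_cat.
  rewrite (perm_big _ peq) big_cat/=.
  congr (_ * _)%E; first by apply: eq_big_seq => i ->.
  by apply: eq_big_seq => i /dis ->.
by apply: indepS; apply: sub_sigma_algebra2; exact: sub.
Qed.

End mutual.
End independence.

Section preimages.
Context d (T : measurableType d).

Lemma preimage_systemP d' (S : measurableType d') (f : T -> S) B :
  measurable B -> g_sigma_algebra_preimage f (f @^-1` B).
Proof. by move=> mB; exists B => //; rewrite setTI. Qed.

Lemma preimage_system_measurable d' (S : measurableType d') (f : T -> S) :
  measurable_fun setT f -> g_sigma_algebra_preimage f `<=` measurable.
Proof. by move=> mf _ [B mB <-]; exact: mf. Qed.

Lemma preimage_systemT d' (S : measurableType d') (f : T -> S) :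
  g_sigma_algebra_preimage f setT.
Proof. by exists setT => //; rewrite preimage_setT setTI. Qed.

Lemma preimage_systemI d' (S : measurableType d') (f : T -> S) :
  setI_closed (g_sigma_algebra_preimage f).
Proof.
move=> _ _ [A mA <-] [B mB <-]; exists (A `&` B); first exact: measurableI.
by rewrite !setTI.
Qed.

Lemma sigmaI (G : set (set T)) : setI_closed <<s G >>.
Proof.
by move=> A B mA mB; exact: (@measurableI _ (g_sigma_algebraType G)).
Qed.

Lemma sigmaT (G : set (set T)) : <<s G >> setT.
Proof. exact: (@measurableT _ (g_sigma_algebraType G)). Qed.

Lemma preimage_sub_sigma d' (S : measurableType d') (G : set (set T)) (f : T -> S) :
  measurable_fun setT (f : g_sigma_algebraType G -> S) <->
  g_sigma_algebra_preimage f `<=` <<s G >>.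
Proof.
split=> [mf _ [B mB <-]|h _ B mB]; first exact: mf.
by apply: h; exists B.
Qed.

(** The law of this identity is the restriction of the measure to [<<s G>>]. *)
Lemma measurable_sigma_id (G : set (set T)) : G `<=` measurable ->
  measurable_fun setT (id : T -> g_sigma_algebraType G).
Proof.
by move=> Gm _ B mB; rewrite setTI; exact: (sigma_sub_measurable Gm).
Qed.

Lemma preimage_pair_sub d1 (S1 : measurableType d1) d2 (S2 : measurableType d2)
    (f : T -> S1) (g : T -> S2) :
  g_sigma_algebra_preimage (fun w => (f w, g w)) `<=`
  <<s g_sigma_algebra_preimage f `|` g_sigma_algebra_preimage g >>.
Proof.
apply/preimage_sub_sigma; apply/measurable_fun_pair; apply/preimage_sub_sigma.
- by apply: subset_trans; last exact: sub_sigma_algebra; exact: subsetUl.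
- by apply: subset_trans; last exact: sub_sigma_algebra; exact: subsetUr.
Qed.

End preimages.

(** * Laws and product measures *)

Section law.
Context d d' (T : measurableType d) (S : measurableType d') (R : realType).
Variables (P : probability T R) (f : T -> S) (mf : measurable_fun setT f).

(** The measurability proof is an argument, so that bare functions such as pairs of random
    variables, or the identity onto a coarser sigma-algebra, have a law too. *)
Definition law : probability S R :=
  distribution P (HB.pack_for {mfun T >-> S} f (isMeasurableFun.Build _ _ _ _ f mf)).

Lemma law_integrable (g : S -> R) : measurable_fun setT g ->
  P.-integrable setT (EFin \o (g \o f)) <-> law.-integrable setT (EFin \o g).
Proof.
move=> mg; have meg : measurable_fun setT (EFin \o g) by exact/measurable_EFinP.
split=> [ig|/integrableP[_ ig]].
  exact: integrable_pushforward.
apply/integrableP; split; first exact/measurable_EFinP/measurableT_comp.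
by move: ig; rewrite ge0_integral_pushforward//; exact: measurableT_comp.
Qed.

Lemma ge0_integral_law (g : S -> \bar R) : measurable_fun setT g ->
  (forall y, 0 <= g y)%E -> (\int[law]_y g y = \int[P]_x g (f x))%E.
Proof. by move=> mg g0; rewrite ge0_integral_pushforward. Qed.

Lemma integral_law (g : S -> \bar R) : measurable_fun setT g ->
  P.-integrable setT (g \o f) -> (\int[law]_y g y = \int[P]_x g (f x))%E.
Proof. by move=> mg g0; rewrite integral_pushforward. Qed.

Lemma Rintegral_law (g : S -> R) : measurable_fun setT g ->
  P.-integrable setT (EFin \o (g \o f)) ->
  \int[law]_y g y = \int[P]_x g (f x).
Proof.
by move=> mg ig; rewrite /Rintegral integral_law//; exact/measurable_EFinP.
Qed.

End law.

Section Rfubini.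
Context d1 d2 (T1 : measurableType d1) (T2 : measurableType d2) (R : realType).
Variable m1 : {sigma_finite_measure set T1 -> \bar R}.
Variable m2 : {sigma_finite_measure set T2 -> \bar R}.
Variable f : T1 * T2 -> R.
Hypothesis imf : (m1 \x m2)%E.-integrable setT (EFin \o f).

(** The real integral is the [fine] part of the extended one; the two agree at the points whose
    slice is integrable, that is almost everywhere. *)
Lemma ae_Rintegral1 : {ae m1, forall x, setT x ->
  (\int[m2]_y (f (x, y))%:E)%E = (\int[m2]_y f (x, y))%:E}.
Proof.
have := ae_integrable1 imf; apply: filterS => x /= ix _.
by rewrite /Rintegral fineK//; exact: integrable_fin_num.
Qed.

Lemma measurable_Rintegral1 : measurable_fun setT (fun x => \int[m2]_y f (x, y)).
Proof.
by apply: measurableT_comp => //; exact: (measurable_fubini_F imf).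
Qed.

Lemma ae_eq_Rintegral1 : ae_eq m1 setT (fun x => (\int[m2]_y (f (x, y))%:E)%E)
  (fun x => (\int[m2]_y f (x, y))%:E).
Proof. exact: ae_Rintegral1. Qed.

Lemma integrable_Rintegral1 :
  m1.-integrable setT (EFin \o (fun x => \int[m2]_y f (x, y))).
Proof.
apply: (le_integrable measurableT _ _ (integrable_fubini_F imf)).
- exact/measurable_EFinP/measurable_Rintegral1.
(* [fine] sends infinite values to 0, so it never increases the absolute value. *)
- move=> x _; rewrite /= /Rintegral /fubini_F.
  by case: (integral _ _ _) => //=; rewrite normr0 leey.
Qed.

Lemma integral12_Rintegral :
  (\int[m1]_x (\int[m2]_y f (x, y))%:E = \int[(m1 \x m2)%E]_z (f z)%:E)%E.
Proof.
rewrite -(integral12_prod_meas1 imf); apply/esym/ae_eq_integral => //.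
- exact: (measurable_fubini_F imf).
- exact/measurable_EFinP/measurable_Rintegral1.
- exact: ae_eq_Rintegral1.
Qed.

Lemma Rintegral12 :
  \int[m1]_x \int[m2]_y f (x, y) = \int[(m1 \x m2)%E]_z f z.
Proof. by rewrite [LHS]/Rintegral integral12_Rintegral. Qed.

End Rfubini.

Lemma integrable_prodM d1 d2 (T1 : measurableType d1) (T2 : measurableType d2)
    (R : realType) (m1 : {sigma_finite_measure set T1 -> \bar R})
    (m2 : {sigma_finite_measure set T2 -> \bar R}) (f : T1 -> R) (g : T2 -> R) :
  m1.-integrable setT (EFin \o f) -> m2.-integrable setT (EFin \o g) ->
  (m1 \x m2)%E.-integrable setT (EFin \o (fun z => f z.1 * g z.2)).
Proof.
move=> iF iG.
have mf : measurable_fun setT f by apply/measurable_EFinP; exact: measurable_int iF.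
have mg : measurable_fun setT g by apply/measurable_EFinP; exact: measurable_int iG.
apply/integrable12ltyP.
  by apply/measurable_EFinP/measurable_funM; exact: measurableT_comp.
have E x : (\int[m2]_y `|(f x * g y)%:E| = `|f x|%:E * \int[m2]_y `|g y|%:E)%E.
  rewrite -ge0_integralZl//; last by do 2 apply: measurableT_comp => //.
  by apply: eq_integral => y _; rewrite /= normrM EFinM.
under eq_integral do rewrite E.
move/integrableP : iF => [_ iF]; move/integrableP : iG => [_ iG].
rewrite ge0_integralZr//; last 2 first.
- by do 2 apply: measurableT_comp => //.
- exact: integral_ge0.
by apply: lte_mul_pinfty; [exact: integral_ge0|rewrite ge0_fin_numE//; exact: integral_ge0|].
Qed.

Section Rfubini_swap.
Context d1 d2 (T1 : measurableType d1) (T2 : measurableType d2) (R : realType).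
Variable m1 : {sigma_finite_measure set T1 -> \bar R}.
Variable m2 : {sigma_finite_measure set T2 -> \bar R}.
Variable f : T1 * T2 -> R.
Hypothesis mf : measurable_fun setT f.
Let fswap (z : T2 * T1) := f (z.2, z.1).

Lemma integrable_swap : (m1 \x m2)%E.-integrable setT (EFin \o f) <->
  (m2 \x m1)%E.-integrable setT (EFin \o fswap).
Proof.
have ms : measurable_fun setT fswap.
  by apply: measurableT_comp => //; exact: measurable_swap.
have mef : measurable_fun setT (EFin \o f) by exact/measurable_EFinP.
have mes : measurable_fun setT (EFin \o fswap) by exact/measurable_EFinP.
by rewrite integrable12ltyP// integrable21ltyP.
Qed.

Lemma RFubini : (m1 \x m2)%E.-integrable setT (EFin \o f) ->
  \int[m1]_x \int[m2]_y f (x, y) = \int[m2]_y \int[m1]_x f (x, y).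
Proof.
move=> imf; rewrite Rintegral12//.
rewrite -[RHS]/(\int[m2]_y \int[m1]_x fswap (y, x)) Rintegral12; last exact/integrable_swap.
rewrite /Rintegral -(integral12_prod_meas1 imf) Fubini//.
by rewrite -integral12_prod_meas1//; exact/integrable_swap.
Qed.

End Rfubini_swap.

(** * Bounded measurable functions *)

Section bounded_measurable.
Context d (T : measurableType d) (R : realType).

(** A class stable under the operations applied to sines and cosines and integrable under every
    probability, which settles the integrability conditions in the trigonometric computations. *)
Definition bmeas (f : T -> R) :=
  measurable_fun setT f /\ exists M, forall x, `|f x| <= M.

Lemma bmeas_cst c : bmeas (cst c).
Proof. by split => //; exists `|c|. Qed.

Lemma bmeasD f g : bmeas f -> bmeas g -> bmeas (fun x => f x + g x).
Proof.
move=> [mf [M fM]] [mg [N gN]]; split; first exact: measurable_funD.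
by exists (M + N) => x; rewrite (le_trans (ler_normD _ _))// lerD.
Qed.

Lemma bmeasB f g : bmeas f -> bmeas g -> bmeas (fun x => f x - g x).
Proof.
move=> [mf [M fM]] [mg [N gN]]; split; first exact: measurable_funB.
by exists (M + N) => x; rewrite (le_trans (ler_normB _ _))// lerD.
Qed.

Lemma bmeasM f g : bmeas f -> bmeas g -> bmeas (fun x => f x * g x).
Proof.
move=> [mf [M fM]] [mg [N gN]]; split; first exact: measurable_funM.
by exists (M * N) => x; rewrite normrM ler_pM.
Qed.

Lemma bmeas_cos f : measurable_fun setT f -> bmeas (fun x => cos (f x)).
Proof.
move=> mf; split;
  first exact: (measurableT_comp (continuous_measurable_fun (@continuous_cos R)) mf).
by exists 1 => x; rewrite ler_norml cos_geN1 cos_le1.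
Qed.

Lemma bmeas_sin f : measurable_fun setT f -> bmeas (fun x => sin (f x)).
Proof.
move=> mf; split;
  first exact: (measurableT_comp (continuous_measurable_fun (@continuous_sin R)) mf).
by exists 1 => x; rewrite ler_norml sin_geN1 sin_le1.
Qed.

Lemma bmeas_integrable (P : probability T R) f : bmeas f ->
  P.-integrable setT (EFin \o f).
Proof.
move=> [mf [M fM]]; apply: (@le_integrable _ _ _ _ _ measurableT _ (EFin \o cst M)).
- exact/measurable_EFinP.
- move=> x _ /=; rewrite lee_fin (le_trans (fM x))//; exact: ler_norm.
- exact: finite_measure_integrable_cst.
Qed.

End bounded_measurable.

Lemma bmeas_cosine (R : realType) : bmeas (@cos R).
Proof.
by have [? ?] := @bmeas_cos _ _ _ (id : R -> R) (@measurable_id _ _ _); split.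
Qed.

Lemma bmeas_sine (R : realType) : bmeas (@sin R).
Proof.
by have [? ?] := @bmeas_sin _ _ _ (id : R -> R) (@measurable_id _ _ _); split.
Qed.

Lemma bmeas_comp d d' (T : measurableType d) (S : measurableType d') (R : realType)
  (f : S -> R) (g : T -> S) : bmeas f -> measurable_fun setT g -> bmeas (fun x => f (g x)).
Proof.
move=> [mf [M fM]] mg; split; first exact: (measurableT_comp mf).
by exists M.
Qed.

Lemma bmeas_Rintegral d d' (T : measurableType d) (S : measurableType d')
  (R : realType) (Q : probability S R) (f : T * S -> R) :
  bmeas f -> bmeas (fun x => \int[Q]_y f (x, y)).
Proof.
move=> [mf [M fM]]; split.
  have bf : bmeas f by split => //; exists M.
  (* Measurability of a partial integral comes from Fubini's theorem, which asks for some measure on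
     the parameter space; a Dirac mass supplies one. *)
  exact: (measurable_Rintegral1 (bmeas_integrable (dirac (point : T) \x Q)%E bf)).
exists M => x.
have bx : bmeas (fun y => f (x, y)).
  by split; [exact: measurableT_comp|exists M].
apply: (le_trans (le_normr_Rintegral measurableT (bmeas_integrable Q bx))).
rewrite -[leRHS]mulr1 -[X in _ * X](_ : fine (Q setT) = 1); last by rewrite probability_setT.
rewrite -Rintegral_cst//; apply: le_Rintegral => //.
- apply: bmeas_integrable; case: bx => mx _; split; first exact: measurableT_comp.
  by exists M => y; rewrite normr_id.
- exact: (bmeas_integrable Q (bmeas_cst _ M)).
Qed.

Section joint_law.
Context d d1 d2 (T : measurableType d) (S1 : measurableType d1)
  (S2 : measurableType d2) (R : realType) (P : probability T R).
Variables (U : T -> S1) (V : T -> S2).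
Hypotheses (mU : measurable_fun setT U) (mV : measurable_fun setT V).
Hypothesis UV : indep P (g_sigma_algebra_preimage U) (g_sigma_algebra_preimage V).

Lemma joint_law A : measurable A ->
  (law P mU \x law P mV)%E A = P ((fun w => (U w, V w)) @^-1` A).
Proof.
have mUV : measurable_fun setT (fun w => (U w, V w)) by exact: measurable_fun_pair.
move=> mA; rewrite (@product_measure_unique _ _ _ _ _ _ _ (law P mUV))//.
move=> B C mB mC; transitivity (P (U @^-1` B) * P (V @^-1` C))%E; last by [].
rewrite -UV; [|exact: preimage_systemP..].
by congr (P _); apply/seteqP; split.
Qed.

Lemma ge0_integral_joint (f : S1 * S2 -> \bar R) : measurable_fun setT f ->
  (forall z, 0 <= f z)%E ->
  (\int[P]_w f (U w, V w) = \int[(law P mU \x law P mV)%E]_z f z)%E.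
Proof.
move=> mf f0.
have mUV : measurable_fun setT (fun w => (U w, V w)) by exact: measurable_fun_pair.
rewrite -(ge0_integral_law P mUV mf f0); apply: eq_measure_integral => A mA _.
exact/esym/joint_law.
Qed.

Lemma integrable_joint (f : S1 * S2 -> R) : measurable_fun setT f ->
  P.-integrable setT (EFin \o (fun w => f (U w, V w))) <->
  (law P mU \x law P mV)%E.-integrable setT (EFin \o f).
Proof.
move=> mf.
have mUV : measurable_fun setT (fun w => (U w, V w)) by exact: measurable_fun_pair.
have mef : measurable_fun setT (EFin \o f) by exact/measurable_EFinP.
have mn : measurable_fun setT (fun x => `|(f x)%:E|%E) by exact: measurableT_comp.
split=> /integrableP[_ h]; apply/integrableP; split => //=.
- by rewrite -(ge0_integral_joint mn).
- by apply: measurableT_comp => //; exact: measurableT_comp.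
- by rewrite (ge0_integral_joint mn).
Qed.

Lemma integral_joint (f : S1 * S2 -> R) : measurable_fun setT f ->
  (law P mU \x law P mV)%E.-integrable setT (EFin \o f) ->
  (\int[P]_w (f (U w, V w))%:E = \int[(law P mU \x law P mV)%E]_z (f z)%:E)%E.
Proof.
move=> mf imf.
have mUV : measurable_fun setT (fun w => (U w, V w)) by exact: measurable_fun_pair.
have mef : measurable_fun setT (EFin \o f) by exact/measurable_EFinP.
rewrite -(@integral_law _ _ _ _ _ P _ mUV (EFin \o f))//; last exact/(integrable_joint mf).
by apply: eq_measure_integral => A mA _; exact/esym/joint_law.
Qed.

Lemma Rintegral_joint (f : S1 * S2 -> R) : measurable_fun setT f ->
  (law P mU \x law P mV)%E.-integrable setT (EFin \o f) ->
  \int[P]_w f (U w, V w) = \int[(law P mU \x law P mV)%E]_z f z.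
Proof. by move=> mf imf; rewrite /Rintegral integral_joint. Qed.

End joint_law.

Section indep_product.
Context d (T : measurableType d) (R : realType) (P : probability T R).

Lemma indep_integrableM (U V : T -> R) :
  indep P (g_sigma_algebra_preimage U) (g_sigma_algebra_preimage V) ->
  P.-integrable setT (EFin \o U) -> P.-integrable setT (EFin \o V) ->
  P.-integrable setT (EFin \o (fun w => U w * V w)) /\
  \int[P]_w (U w * V w) = (\int[P]_w U w) * (\int[P]_w V w).
Proof.
move=> UV iU iV.
have mU : measurable_fun setT U by apply/measurable_EFinP; exact: measurable_int iU.
have mV : measurable_fun setT V by apply/measurable_EFinP; exact: measurable_int iV.
pose f (z : R * R) := z.1 * z.2.
have mf : measurable_fun setT f by exact: measurable_funM.
have lU : (law P mU).-integrable setT (EFin \o id) by exact/law_integrable.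
have lV : (law P mV).-integrable setT (EFin \o id) by exact/law_integrable.
have imf := integrable_prodM lU lV.
split; first exact/(@integrable_joint _ _ _ _ _ _ _ _ _ _ mU mV UV _ mf).
rewrite (@Rintegral_joint _ _ _ _ _ _ _ _ _ _ mU mV UV _ mf)// -Rintegral12//.
transitivity (\int[law P mU]_x (id x * \int[law P mV]_y id y)).
  by apply: eq_Rintegral => x _; rewrite RintegralZl.
rewrite RintegralZr//.
rewrite (@Rintegral_law _ _ _ _ _ P U mU id)//.
by rewrite (@Rintegral_law _ _ _ _ _ P V mV id).
Qed.

End indep_product.

(** * Conditional expectation *)

Lemma integral_EFin_indic d (T : measurableType d) (R : realType)
    (mu : {measure set T -> \bar R}) (D : set T) (f : T -> R) :
  (\int[mu]_(x in D) (f x)%:E = \int[mu]_x (f x * \1_D x)%:E)%E.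
Proof.
rewrite integral_mkcond; apply: eq_integral => x _.
by rewrite patchE indicE; case: ifPn; rewrite ?mulr1 ?mulr0.
Qed.

Section conditional_expectation.
Context d (T : measurableType d) (R : realType) (P : probability T R).
Variable G : set (set T).
Hypothesis Gm : G `<=` measurable.

Let mid := measurable_sigma_id Gm.

(** The comparison takes place under the restriction of [P] to [<<s G>>]: there both versions have
    equal integrals over every measurable set, which forces equality almost everywhere. *)
Lemma is_cond_exp_ae (Z W W' : T -> R) : is_cond_exp P <<s G>> Z W ->
  is_cond_exp P <<s G>> Z W' -> {ae P, forall w, W w = W' w}.
Proof.
move=> [/preimage_sub_sigma mW iW hW] [/preimage_sub_sigma mW' iW' hW'].
have iGW : (law P mid).-integrable setT (EFin \o W).
  exact/(law_integrable P mid mW).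
have iGW' : (law P mid).-integrable setT (EFin \o W').
  exact/(law_integrable P mid mW').
have : ae_eq (law P mid) setT (EFin \o W) (EFin \o W').
  apply: (integral_ae_eq measurableT iGW); first exact/measurable_EFinP.
  have tr (V : T -> R) (mV : measurable_fun setT (V : g_sigma_algebraType G -> R)) E :
      P.-integrable setT (EFin \o V) ->
      measurable (E : set (g_sigma_algebraType G)) ->
      (\int[law P mid]_(x in E) (V x)%:E = \int[P]_(x in E) (V x)%:E)%E.
    move=> iV mE; rewrite integral_pushforward//; first exact/measurable_EFinP.
    apply: integrableS iV => //.
    exact: (sigma_sub_measurable Gm).
  by move=> E _ mE; rewrite (tr _ mW _ iW mE) (tr _ mW' _ iW' mE) hW// hW'.
move=> [N [mN N0 sN]]; exists N; split => //.
  exact: (sigma_sub_measurable Gm).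
move=> w /= h; apply: sN => /= h'; apply: h.
by have [] := h' I.
Qed.

(** Exhibiting one version [W] shows that the choice in [cond_exp] is not the default 0, and
    uniqueness then identifies it with [W]. *)
Lemma cond_expP (Z W : T -> R) : is_cond_exp P <<s G>> Z W ->
  measurable_fun setT (cond_exp P <<s G>> Z) /\
  {ae P, forall w, cond_exp P <<s G>> Z w = W w}.
Proof.
move=> hW; have hc : is_cond_exp P <<s G>> Z (cond_exp P <<s G>> Z).
  by apply: (@xgetPex _ (cst 0) [set W | is_cond_exp P <<s G>> Z W]); exists W.
split; last exact: is_cond_exp_ae hc hW.
by case: hc => _ /(measurable_int P) /measurable_EFinP.
Qed.

(** [Z] is independent of [G] and is integrated out while the [G]-measurable
    argument is frozen. *)
Section freezing.
Context d' (S : measurableType d').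
Variables (Z : T -> S) (mZ : measurable_fun setT Z).
Hypothesis GZ : indep P <<s G>> (g_sigma_algebra_preimage Z).
Variable F : g_sigma_algebraType G * S -> R.
Hypothesis mF : measurable_fun setT F.
Hypothesis iF : P.-integrable setT (EFin \o (fun w => F (w, Z w))).

Let idZ : indep P (g_sigma_algebra_preimage (id : T -> g_sigma_algebraType G))
  (g_sigma_algebra_preimage Z).
Proof. by apply: indepS GZ => // _ [A mA <-]; rewrite setTI. Qed.

Lemma is_cond_exp_freezing :
  is_cond_exp P <<s G>> (fun w => F (w, Z w)) (fun w => \int[law P mZ]_z F (w, z)).
Proof.
have iF' : (law P mid \x law P mZ)%E.-integrable setT (EFin \o F).
  exact/(@integrable_joint _ _ _ _ _ _ _ _ _ _ mid mZ idZ _ mF).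
split.
- apply/preimage_sub_sigma; exact: measurable_Rintegral1 iF'.
- apply/(law_integrable P mid (measurable_Rintegral1 iF')).
  exact: integrable_Rintegral1 iF'.
- move=> A GA; have mA : measurable A by exact: (sigma_sub_measurable Gm).
  pose FA (z : g_sigma_algebraType G * S) := F z * \1_(A : set (g_sigma_algebraType G)) z.1.
  have mFA : measurable_fun setT FA.
    by apply: measurable_funM => //; apply: measurableT_comp.
  have iFA : (law P mid \x law P mZ)%E.-integrable setT (EFin \o FA).
    apply: (le_integrable measurableT _ _ iF'); first exact/measurable_EFinP.
    move=> z _; rewrite /= lee_fin /FA normrM ler_piMr// indicE.
    by case: (_ \in _); rewrite ?normr1 ?normr0.
  rewrite [LHS]integral_EFin_indic [RHS]integral_EFin_indic.
  transitivity (\int[P]_w (FA (w, Z w))%:E)%E; last by [].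
  rewrite (@integral_joint _ _ _ _ _ _ _ _ _ _ mid mZ idZ _ mFA)//.
  rewrite -integral12_Rintegral//.
  rewrite (integral_law (g := EFin \o _) mid); first last.
  - apply/(law_integrable P mid (measurable_Rintegral1 iFA)).
    exact: integrable_Rintegral1 iFA.
  - apply/measurable_EFinP; exact: (measurable_Rintegral1 iFA).
  apply: eq_integral => w _; rewrite /FA/= indicE.
  case: (_ \in _); rewrite ?mulr1 ?mulr0.
    by congr EFin; apply: eq_Rintegral => z _; rewrite mulr1.
  by congr EFin; under eq_Rintegral do rewrite mulr0; rewrite /Rintegral integral0.
Qed.

End freezing.
End conditional_expectation.

(** * The standard normal law *)

Section normal_integration.
Context (R : realType).
Local Notation mu := (@lebesgue_measure R).
Local Notation N := (@normal_prob R 0 1 : probability _ R).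
Local Notation p := (@normal_pdf R 0 1).

Lemma normal_pdf01 (x : R) : p x = normal_peak 1 * expR (- (x ^+ 2 / 2)).
Proof.
by rewrite normal_pdfE ?oner_neq0// /normal_fun subr0 expr1n mulNr.
Qed.

(** The Radon-Nikodym derivative and the explicit density have the same integral over every
    measurable set, hence coincide almost everywhere. *)
Lemma ge0_integral_normal (f : R -> \bar R) : measurable_fun setT f ->
  (forall x, 0 <= f x)%E ->
  (\int[N]_x f x = \int[mu]_x (f x * (p x)%:E))%E.
Proof.
move=> mf f0.
have dom := @normal_prob_dominates R 0 1.
rewrite -(Radon_Nikodym_SigmaFinite.change_of_variables dom)//.
pose q := Radon_Nikodym_SigmaFinite.f N mu.
have iq : mu.-integrable setT q by exact: Radon_Nikodym_SigmaFinite.f_integrable.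
have mp : measurable_fun setT (EFin \o p).
  by apply/measurable_EFinP; exact: measurable_normal_pdf.
have qp : ae_eq mu setT q (EFin \o p).
  apply: integral_ae_eq => // A _ mA.
  by rewrite -Radon_Nikodym_SigmaFinite.f_integral.
apply: ae_eq_integral => //.
- by apply: emeasurable_funM => //; exact: measurable_int iq.
- exact: emeasurable_funM.
- exact: ae_eqe_mul2l.
Qed.

Lemma integrable_normal (f : R -> R) : measurable_fun setT f ->
  N.-integrable setT (EFin \o f) <->
  mu.-integrable setT (EFin \o (fun x => f x * p x)).
Proof.
move=> mf; have mef : measurable_fun setT (EFin \o f) by exact/measurable_EFinP.
have mefp : measurable_fun setT (EFin \o (fun x => f x * p x)).
  by apply/measurable_EFinP/measurable_funM => //; exact: measurable_normal_pdf.
have E : (\int[N]_x `|(f x)%:E| = \int[mu]_x `|(f x * p x)%:E|)%E.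
  rewrite ge0_integral_normal//; last exact: measurableT_comp.
  apply: eq_integral => x _.
  by rewrite EFinM abseM (gee0_abs (_ : 0 <= (p x)%:E)%E)// lee_fin normal_pdf_ge0.
by split=> /integrableP[_ h]; apply/integrableP; split => //; rewrite /= ?E// -?E.
Qed.

Lemma Rintegral_normal (f : R -> R) : N.-integrable setT (EFin \o f) ->
  \int[N]_x f x = \int[mu]_x (f x * p x).
Proof.
move=> iN.
have mef : measurable_fun setT (EFin \o f) := measurable_int _ iN.
congr fine; rewrite [LHS]integralE [RHS]integralE.
rewrite !ge0_integral_normal//; [|exact: measurable_funeneg|exact: measurable_funepos].
have p0 x : (0 <= (p x)%:E)%E by rewrite lee_fin normal_pdf_ge0.
congr (_ - _)%E; apply: eq_integral => x _.
  rewrite !funeposE /= EFinM maxe_pMl// ?mul0e//.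
by rewrite !funenegE /= -mulNr EFinM maxe_pMl// mul0e.
Qed.

Lemma normal_mgf (t : R) : (\int[N]_x (expR (t * x))%:E = (expR (t ^+ 2 / 2))%:E)%E.
Proof.
rewrite ge0_integral_normal//; last first.
  apply/measurable_EFinP/measurableT_comp => //; exact: measurable_funM.
(* Completing the square turns [expR (t * x)] times the centred density into a constant times the
   density centred at [t]. *)
transitivity (\int[mu]_x ((expR (t ^+ 2 / 2))%:E * (normal_pdf t 1 x)%:E))%E; last first.
  rewrite ge0_integralZl//.
  - by rewrite integral_normal_pdf mule1.
  - by apply/measurable_EFinP; exact: measurable_normal_pdf.
  - by move=> x _; exact: normal_pdf_ge0.
apply: eq_integral => x _; rewrite -!EFinM; congr EFin.
rewrite normal_pdf01 normal_pdfE ?oner_neq0// /normal_fun.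
rewrite mulrCA [in RHS]mulrCA -!expRD; congr (_ * expR _).
by rewrite expr1n; field.
Qed.

Lemma integrable_normal_exp (t : R) :
  N.-integrable setT (EFin \o (fun x => expR (t * x))).
Proof.
apply/integrableP; split.
  by apply/measurable_EFinP/measurableT_comp => //; exact: measurable_funM.
under eq_integral do rewrite /= ger0_norm ?expR_ge0//.
by rewrite normal_mgf ltry.
Qed.

(** Dominates the second moment by two exponential moments; the factors 1 and -1 are the values of
    [t] in [integrable_normal_exp]. *)
Lemma expR_sqr_bound (x : R) : x ^+ 2 <= 2 * (expR (1 * x) + expR ((-1) * x)).
Proof.
have h (y : R) : 0 <= y -> y ^+ 2 <= 2 * expR y.
  move=> y0; have := expR_ge1Dxn 1 y0.
  rewrite (_ : 2`! = 2)%N//.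
  lra.
have e0 := expR_ge0 (1 * x); have e1 := expR_ge0 ((-1) * x).
have [x0|x0] := leP 0 x.
  by have := h _ x0; rewrite -[in expR x](mul1r x); lra.
have := h (- x); rewrite sqrrN oppr_ge0 => /(_ (ltW x0)).
by rewrite -[in expR (- x)](mulN1r x); lra.
Qed.

Lemma integrable_normal_sqr : N.-integrable setT (EFin \o (fun x => x ^+ 2)).
Proof.
have : N.-integrable setT (EFin \o
    (fun x => 2 * (expR (1 * x) + expR ((-1) * x)))).
  have := integrableZl measurableT 2 (integrableD measurableT
    (integrable_normal_exp 1) (integrable_normal_exp (-1))).
  by apply: eq_integrable => // x _; rewrite /= -EFinD -EFinM.
apply: le_integrable => //; first by apply/measurable_EFinP; exact: measurable_funX.
move=> x _; rewrite /= lee_fin.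
rewrite !ger0_norm ?sqr_ge0 ?mulr_ge0 ?addr_ge0 ?expR_ge0//.
exact: expR_sqr_bound.
Qed.

Lemma integrable_normal_id : N.-integrable setT (EFin \o (fun x => x)).
Proof.
have : N.-integrable setT (EFin \o (fun x => 1 + x ^+ 2)).
  have := integrableD measurableT
    (finite_measure_integrable_cst N 1 measurableT) integrable_normal_sqr.
  by apply: eq_integrable.
apply: le_integrable => //; first exact/measurable_EFinP.
move=> x _; rewrite /= lee_fin [leRHS]ger0_norm ?addr_ge0 ?sqr_ge0//.
rewrite ler_norml; apply/andP; split; nra.
Qed.

End normal_integration.

Section stein.
Context (R : realType).
Local Notation mu := (@lebesgue_measure R).
Local Notation N := (@normal_prob R 0 1 : probability _ R).
Local Notation p := (@normal_pdf R 0 1).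

(** Decay along the integers is what the boundary terms of an integration by parts over [-n, n]
    require; it comes from n - 1 <= n^2 / 2. *)
Lemma normal_pdf_decay (n : nat) : p n%:R <= normal_peak 1 * (expR 1 * expR (- n%:R)).
Proof.
rewrite normal_pdf01 ler_wpM2l ?normal_peak_ge0//.
have : - (n%:R ^+ 2 / 2) <= 1 + - n%:R :> R by nra.
rewrite -ler_expR => /le_trans; apply.
by rewrite expRD.
Qed.

Lemma normal_pdf_even (x : R) : p (- x) = p x.
Proof. by rewrite !normal_pdf01 sqrrN. Qed.

Lemma integral_ball_cvg (f : R -> R) : mu.-integrable setT (EFin \o f) ->
  (\int[mu]_(x in `[- n%:R, n%:R]) f x)%R @[n --> \oo] --> (\int[mu]_x f x).
Proof.
move=> ifT.
have mf : measurable_fun setT f by apply/measurable_EFinP; exact: measurable_int ifT.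
pose f_ n (x : R) := (f x * \1_(`[- n%:R, n%:R]%classic : set R) x)%:E.
have mf_ n : measurable_fun setT (f_ n).
  by apply/measurable_EFinP/measurable_funM.
have mef : measurable_fun setT (EFin \o f) by exact/measurable_EFinP.
have cvf : {ae mu, forall x, setT x -> f_ ^~ x @ \oo --> (EFin \o f) x}.
  apply: aeW => x _; apply: cvg_EFin; first exact: nearW.
  apply: (@cvg_near_cst _ _ (f x)).
  near=> n; rewrite /f_/= indicE mem_set ?mulr1//=.
  rewrite in_itv/= -ler_norml; near: n; exact: nbhs_infty_ger.
have bd : {ae mu, forall x n, setT x -> (`|f_ n x| <= (abse \o (EFin \o f)) x)%E}.
  apply: aeW => x n _; rewrite /f_ lee_fin normrM ler_piMr// indicE.
  by case: (_ \in _); rewrite ?normr1 ?normr0.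
have [_ _ H] := @dominated_convergence _ _ _ mu setT measurableT
  f_ _ _ mf_ mef cvf (integrable_abse ifT) bd.
have -> : (fun n => \int[mu]_(x in `[- n%:R, n%:R]) f x) =
    fine \o (fun n : nat => \int[mu]_(x in setT) f_ n x)%E.
  by apply/funext => n /=; rewrite -integral_EFin_indic.
apply: fine_cvg; rewrite fineK; last exact: integrable_fin_num.
exact: H.
Unshelve. all: by end_near. Qed.

(* Integration by parts: [(- g p)' x = (x g x - g' x) p x]. *)
Lemma stein (g g' : R -> R) : (forall x, is_derive x (1 : R) g (g' x)) ->
  continuous g' -> (exists M : R, forall x, `|g x| <= M) ->
  (exists M : R, forall x, `|g' x| <= M) ->
  \int[N]_x (x * g x) = \int[N]_x g' x.
Proof.
move=> dg cg' [M gM] [M' gM'].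
have cg : continuous g.
  move=> x; apply/differentiable_continuous/derivable1_diffP.
  by have [] := dg x.
have mg := continuous_measurable_fun cg.
have mg' := continuous_measurable_fun cg'.
have ig' : N.-integrable setT (EFin \o g').
  by apply: bmeas_integrable; split => //; exists M'.
have ig : N.-integrable setT (EFin \o (fun x => x * g x)).
  have := integrableZl measurableT M (integrable_normal_id R).
  apply: le_integrable => //; first exact/measurable_EFinP/measurable_funM.
  move=> x _; rewrite /= -?EFinM lee_fin !normrM mulrC ler_wpM2r//.
  by rewrite (le_trans (gM x))// ler_norm.
apply/eqP; rewrite -subr_eq0 -RintegralB//; apply/eqP.
pose h x := x * g x - g' x.
have ih : N.-integrable setT (EFin \o h).
  by have := integrableB measurableT ig ig'; apply: eq_integrable.
have mh : measurable_fun setT h by apply: measurable_funB => //; exact: measurable_funM.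
transitivity (\int[mu]_x (h x * p x)); first exact: Rintegral_normal ih.
have := integral_ball_cvg ((integrable_normal mh).1 ih).
suff: (\int[mu]_(x in `[- n%:R, n%:R]) (h x * p x))%R @[n --> \oo] --> (0:R).
  move=> h0 h1; exact: (cvg_unique _ h1 h0).
pose F x := - g x * p x.
have dp (x : R) : is_derive x (1 : R) p (- x * p x).
  rewrite (_ : p = fun x => normal_peak 1 * expR (- (x ^+ 2 / 2))); last first.
    by apply/funext => y; rewrite normal_pdf01.
  apply: is_derive_eq; rewrite /GRing.scale/=. by field.
have dF (x : R) : is_derive x (1 : R) F (h x * p x).
  rewrite /F; apply: is_derive_eq; rewrite /GRing.scale/= /h; ring.
have ch : continuous (fun x => h x * p x).
  move=> x; apply: cvgM; last exact: continuous_normal_pdf (oner_neq0 _) x.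
  by apply: cvgB; [apply: cvgM => //; exact: cg|exact: cg'].
have cF : continuous F.
  move=> x; apply/differentiable_continuous/derivable1_diffP.
  by have [] := dF x.
have ballE n : \int[mu]_(x in `[- n%:R, n%:R]) (h x * p x) = F n%:R - F (- n%:R).
  (* For [n = 0] the interval is a point, which the fundamental theorem of calculus excludes. *)
  have [->|n0] := eqVneq n 0%N.
    by rewrite oppr0 set_itv1 Rintegral_set1 subrr.
  rewrite /Rintegral (@continuous_FTC2 _ _ F)//.
  - by rewrite gtrN// ltr0n lt0n.
  - exact: continuous_subspaceT.
  - split; [by move=> x _; have [] := dF x| |].
      by apply: cvg_at_right_filter; exact: cF.
    by apply: cvg_at_left_filter; exact: cF.
  - by move=> x _; rewrite derive1E; exact: (@derive_val _ _ _ _ _ _ _ (dF x)).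
rewrite (funext ballE).
have bnd n : `|F n%:R - F (- n%:R)| <= (2 * expR 1 * `|M| * normal_peak 1) * expR (- n%:R).
  have b x : `|F x| <= `|M| * p x.
    rewrite normrM normrN (ger0_norm (normal_pdf_ge0 _ _ _)) ler_wpM2r ?normal_pdf_ge0//.
    by rewrite (le_trans (gM x))// ler_norm.
  rewrite (le_trans (ler_normB _ _))// (le_trans (lerD (b _) (b _)))//.
  rewrite normal_pdf_even.
  apply: (le_trans (y := 2 * `|M| * (normal_peak 1 * (expR 1 * expR (- n%:R))))).
    rewrite (_ : `|M| * p n%:R + `|M| * p n%:R = 2 * `|M| * p n%:R); last by ring.
    by apply: ler_wpM2l; [rewrite mulr_ge0|exact: normal_pdf_decay].
  by rewrite le_eqVlt; apply/orP; left; apply/eqP; ring.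
apply/norm_cvg0P; apply: (@squeeze_cvgr _ _ _ _ (fun=> 0) (fun n => (2 * expR 1 * `|M| * normal_peak 1) * expR (- n%:R))).
- by near=> n; rewrite normr_ge0 bnd.
- exact: cvg_cst.
- by rewrite -[X in _ --> X](mulr0 (2 * expR 1 * `|M| * normal_peak 1)); apply: cvgMr; exact: cvgn_expR.
Unshelve. all: by end_near. Qed.

End stein.

(** * Characteristic function of the standard normal law *)

Section normal_cf.
Context (R : realType).
Local Notation N := (@normal_prob R 0 1 : probability _ R).

(** The pair is (cos, -sin) or (sin, cos). Differentiation under the integral brings out x * v (t *
    x), and Stein's identity turns this into the equation phi' (t) = - t * phi (t). *)
Section ode.
Variables u v : R -> R.
Hypothesis du : forall x, is_derive x (1 : R) u (v x).
Hypothesis dv : forall x, is_derive x (1 : R) v (- u x).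
Hypothesis u1 : forall x, `|u x| <= 1.
Hypothesis v1 : forall x, `|v x| <= 1.

Let cu : continuous u.
Proof.
by move=> x; apply/differentiable_continuous/derivable1_diffP; have [] := du x.
Qed.

Let cv : continuous v.
Proof.
by move=> x; apply/differentiable_continuous/derivable1_diffP; have [] := dv x.
Qed.

Let dscale (w w' : R -> R) (t x : R) : (forall x, is_derive x (1 : R) w (w' x)) ->
  is_derive x (1 : R) (fun x => w (t * x)) (t * w' (t * x)).
Proof.
move=> dw.
have dl : is_derive x (1 : R) (fun x : R => t * x) t.
  by apply: is_derive_eq; rewrite /GRing.scale/=; ring.
have := @is_derive1_comp R w (fun x => t * x) x _ _ (dw _) dl.
by rewrite mulrC.
Qed.

Let cscale (w : R -> R) (t : R) : continuous w -> continuous (fun x => w (t * x)).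
Proof.
move=> cw x; apply: (continuous_comp (f := fun x => t * x)); last exact: cw.
exact: mulrl_continuous.
Qed.

Let phi (t : R) := \int[N]_x u (t * x).

Let iu t : N.-integrable setT (EFin \o (fun x => u (t * x))).
Proof.
apply: bmeas_integrable; split; last by exists 1.
exact: (continuous_measurable_fun (cscale (t := t) cu)).
Qed.

Let dphi (t : R) : is_derive t (1 : R) phi (- t * phi t).
Proof.
pose f (t x : R) := u (t * x).
have df (s x : R) : is_derive s (1 : R) (f ^~ x) (x * v (x * s)).
  have := @dscale u v x s du.
  by rewrite (_ : (fun s => u (x * s)) = f ^~ x)//; apply/funext => y; rewrite /f mulrC.
have d1f s x : partial1of2 f s x = x * v (x * s).
  by rewrite /partial1of2 derive1E; exact: (@derive_val _ _ _ _ _ _ _ (df s x)).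
(* Any neighbourhood of [t] will do, since [|x|] dominates the derivative uniformly in [s]. *)
have tI : `]t - 1, t + 1[%classic t by rewrite /= in_itv/=; apply/andP; split; lra.
have H1 : forall s, `]t - 1, t + 1[%classic s -> N.-integrable setT (EFin \o f s).
  by move=> s _; exact: iu.
have H2 : forall s x : R, `]t - 1, t + 1[%classic s -> setT x -> derivable (f ^~ x) s 1.
  by move=> s x _ _; have [] := df s x.
have H3 : N.-integrable setT (EFin \o (fun x : R => `|x|)).
  exact: (integrable_abse (integrable_normal_id R)).
have H4 : forall s x : R, `]t - 1, t + 1[%classic s -> setT x -> `|partial1of2 f s x| <= `|x|.
  by move=> s x _ _; rewrite d1f normrM ler_piMr.
have D := @derivable_under_integral R _ _ N f setT measurableT t (t - 1) (t + 1) tI H1 H2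
  (fun x => `|x|) (fun x => normr_ge0 x) H3 H4.
have E := @differentiation_under_integral R _ _ N f setT measurableT t (t - 1) (t + 1) tI H1 H2
  (fun x => `|x|) (fun x => normr_ge0 x) H3 H4.
apply: DeriveDef; first exact: D.
rewrite -derive1E (E : derive1 phi t = _).
transitivity (\int[N]_x (x * v (t * x))).
  by apply: eq_Rintegral => x _; rewrite d1f (mulrC x t).
transitivity (\int[N]_x (t * - u (t * x))).
  apply: (@stein R (fun x => v (t * x))).
  - by move=> x; exact: dscale dv.
  - move=> x; apply: cvgM; first exact: cvg_cst.
    by apply: cvgN; exact: cscale.
  - by exists 1.
  - by exists `|t| => x; rewrite normrM normrN ler_piMr.
rewrite RintegralZl//; last first.
  by have := integrableN (iu t); apply: eq_integrable.
rewrite mulNr -mulrN; congr (_ * _).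
rewrite -[RHS]mulN1r -RintegralZl//; last exact: iu.
by apply: eq_Rintegral => x _; rewrite mulN1r.
Qed.

Lemma normal_ode (t : R) : \int[N]_x u (t * x) = expR (- (t ^+ 2 / 2)) * u 0.
Proof.
(* With the integrating factor the solution of the equation becomes constant. *)
have dpsi (s : R) : is_derive s (1 : R) (fun t => expR (t ^+ 2 / 2) * phi t) 0.
  have de : is_derive s (1 : R) (fun t => expR (t ^+ 2 / 2)) (s * expR (s ^+ 2 / 2)).
    by apply: is_derive_eq; rewrite /GRing.scale/=; field.
  apply: (@is_derive_eq _ _ _ _ _ _ _ _ (is_deriveM de (dphi s))).
  by rewrite /GRing.scale/=; ring.
have := is_derive_0_is_cst t 0 dpsi.
rewrite expr0n mul0r expR0 mul1r => E.
have -> : u 0 = phi 0.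
  rewrite /phi; under eq_Rintegral do rewrite mul0r.
  by rewrite Rintegral_cst//= probability_setT mulr1.
by rewrite -E mulrA -expRD addNr expR0 mul1r.
Qed.

End ode.

Lemma normal_cos (t : R) : \int[N]_x cos (t * x) = expR (- (t ^+ 2 / 2)).
Proof.
have c1 (x : R) : `|cos x| <= 1 by rewrite ler_norml cos_geN1 cos_le1.
have s1 (x : R) : `|- sin x| <= 1 by rewrite normrN ler_norml sin_geN1 sin_le1.
have ds (x : R) : is_derive x (1 : R) (fun x => - sin x) (- cos x).
  by apply: is_derive_eq.
by rewrite (normal_ode (@is_derive_cos R) ds c1 s1) cos0 mulr1.
Qed.

Lemma normal_sin (t : R) : \int[N]_x sin (t * x) = 0.
Proof.
have c1 (x : R) : `|cos x| <= 1 by rewrite ler_norml cos_geN1 cos_le1.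
have s1 (x : R) : `|sin x| <= 1 by rewrite ler_norml sin_geN1 sin_le1.
by rewrite (normal_ode (@is_derive_sin R) (@is_derive_cos R) s1 c1) sin0 mulr0.
Qed.

Lemma normal_mean : \int[N]_x x = 0.
Proof.
transitivity (\int[N]_x (x * cst (1 : R) x)).
  by apply: eq_Rintegral => x _; rewrite mulr1.
transitivity (\int[N]_x (cst (0 : R) x)); last by rewrite Rintegral_cst// mul0r.
apply: (@stein R (cst 1) (cst 0)).
- by move=> x; exact: cvg_cst.
- by exists 1 => x; rewrite normr1.
- by exists 0 => x; rewrite normr0.
Qed.

End normal_cf.

(** * Series of independent random variables *)

(** Only countable quantifiers occur: the set of convergence becomes a countable combination of
    measurable sets, and its complement one of the events controlled by a maximal inequality. *)
Lemma cvgn_cauchy (R : realType) (u : nat -> R) :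
  cvgn u <-> forall j, exists m, forall n, `|u (m + n)%N - u m| < j.+1%:R^-1.
Proof.
split=> [cu j|h].
  have /cauchy_cvgP/cauchyP/(_ (j.+1%:R^-1 / 2)) := cu.
  have e0 : 0 < j.+1%:R^-1 / 2 :> R by rewrite divr_gt0// invr_gt0 ltr0n.
  move=> /(_ e0)[x /= [m _ hm]]; exists m => n.
  have /= h1 := hm m (leqnn m); have /= h2 := hm (m + n)%N (leq_addr _ _).
  rewrite (_ : u (m + n)%N - u m = (x - u m) - (x - u (m + n)%N)); last by ring.
  rewrite (le_lt_trans (ler_normB _ _))// [ltRHS]splitr.
  by apply: ltrD; [exact: h1|exact: h2].
apply/cauchy_cvgP/cauchyP => e e0.
have [j je] := ltr_add_invr e0; rewrite add0r in je.
have [m hm] := h j; exists (u m), m => // n /= mn.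
by rewrite /ball/= distrC -(subnKC mn) (lt_trans (hm _) je).
Qed.

(** Convergence is not assumed: where the sequence diverges, [limn] takes the default value [point],
    and the set of convergence is measurable. *)
Lemma measurable_limn d (T : measurableType d) (R : realType) (h : nat -> T -> R) :
  (forall n, measurable_fun setT (h n)) ->
  measurable_fun setT (fun w => limn (fun n => h n w)).
Proof.
move=> mh.
pose C := [set w | cvgn (fun n => h n w)].
have mC : measurable C.
  rewrite (_ : C = \bigcap_j \bigcup_m \bigcap_n
      [set w | `|h (m + n)%N w - h m w| < j.+1%:R^-1]).
    apply: bigcapT_measurable => j; apply: bigcupT_measurable => m.
    apply: bigcapT_measurable => n.
    rewrite -[X in measurable X]setTI.
    apply: measurable_fun_ltr => //.
    by apply: measurableT_comp => //; exact: measurable_funB.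
  apply/seteqP; split=> w.
    move=> /cvgn_cauchy hw j _; have [m hm] := hw j.
    by exists m => // n _; exact: hm.
  by move=> hw; apply/cvgn_cauchy => j; have [m _ hm] := hw j I; exists m => n; exact: hm.
have -> : (fun w => limn (fun n => h n w)) =
    (fun w => limn (fun n => h n w) * \1_C w + (point : R) * (1 - \1_C w)).
  apply/funext => w; rewrite indicE; case: (asboolP (C w)) => Cw.
    by rewrite mem_set// mulr1 subrr mulr0 addr0.
  by rewrite memNset// mulr0 add0r subr0 mulr1; exact: dvgP.
apply: measurable_funD; last first.
  by apply: measurable_funM => //; apply: measurable_funB.
apply: (@measurable_fun_cvg _ _ _ _ (fun n w => h n w * \1_C w)).
  by move=> m; apply: measurable_funM.
move=> w _; rewrite indicE; case: (asboolP (C w)) => Cw.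
  by rewrite mem_set//; apply: cvgM; [exact: Cw|exact: cvg_cst].
rewrite memNset// mulr0 (_ : (fun n => _) = fun=> 0); first exact: cvg_cst.
by apply/funext => n; rewrite mulr0.
Qed.

Section independent_series.
Context d (T : measurableType d) (R : realType) (P : probability T R).

Definition history (z : nat -> T -> R) (n : nat) : set (set T) :=
  \bigcup_(i in [set k | (k < n)%N]) g_sigma_algebra_preimage (z i).

Section sums.
Variable z : nat -> T -> R.
Hypothesis mz : forall n, measurable_fun setT (z n).

Let S n w := \sum_(0 <= i < n) z i w.

Lemma history_measurable n : history z n `<=` measurable.
Proof. by move=> A [i _]; exact: preimage_system_measurable. Qed.

Lemma measurable_history_sum m n : (m <= n)%N ->
  measurable_fun setT (S m : g_sigma_algebraType (history z n) -> R).
Proof.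
move=> mn.
(* [measurable_sum] wants every summand measurable, whatever its index, so the terms outside the
   history are replaced by 0. *)
rewrite (_ : S m = fun w => \sum_(0 <= i < m) (if (i < n)%N then z i w else 0)); last first.
  apply/funext => w; rewrite /S; apply: eq_big_nat => i im.
  move/andP : im => [_ im]; have -> // : (i < n)%N by exact: leq_trans im mn.
apply: measurable_sum => i; case: (ltnP i n) => iN; last exact: measurable_cst.
apply/preimage_sub_sigma; apply: subset_trans; last exact: sub_sigma_algebra.
by move=> A hA; exists i.
Qed.

Lemma measurable_partial_sum n : measurable_fun setT (S n).
Proof. exact: measurable_sum. Qed.

(** Independence of each term from its past is the form in which independence enters both the
    maximal inequality and the characteristic function of the sums. *)
Definition indep_history := forall n,
  indep P <<s history z n >> (g_sigma_algebra_preimage (z n)).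

Hypothesis indz : indep_history.

Lemma indep_history_fun n (f : T -> R) (g : R -> R) :
  measurable_fun setT (f : g_sigma_algebraType (history z n) -> R) ->
  measurable_fun setT g ->
  indep P (g_sigma_algebra_preimage f) (g_sigma_algebra_preimage (g \o z n)).
Proof.
move=> mf mg; apply: indepS (@indz n); first exact/preimage_sub_sigma.
by move=> _ [B mB <-]; exists (g @^-1` B) => //; rewrite -[X in measurable X]setTI; exact: mg.
Qed.

Section maximal.
Hypothesis iz2 : forall n, P.-integrable setT (EFin \o (fun w => z n w ^+ 2)).
Hypothesis z0 : forall n, \int[P]_w z n w = 0.
Variable (eps : R).
Hypothesis eps0 : 0 < eps.

(** The event that the maximum of |S k| over 1 <= k <= n reaches [eps]. The recursive form permits
    an induction on [n] instead of a decomposition according to the first passage. *)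
Fixpoint exceed (n : nat) : set T :=
  if n is m.+1 then exceed m `|` [set w | eps <= `|S m.+1 w|] else set0.

Lemma measurable_exceed n :
  measurable (exceed n : set (g_sigma_algebraType (history z n))).
Proof.
elim: n => [|n IH]; first exact: measurable0.
apply: (@measurableU _ (g_sigma_algebraType (history z n.+1))).
  have sub : history z n `<=` history z n.+1.
    by apply: bigcup_subset => i /= /ltnW; rewrite ltnS.
  exact: (sub_sigma_algebra2 sub IH).
rewrite -[X in measurable X]setTI.
apply: measurable_fun_ler => //; apply: measurableT_comp => //.
exact: measurable_history_sum.
Qed.

Let integrable_sqr_mul (f g : T -> R) : measurable_fun setT f -> measurable_fun setT g ->
  P.-integrable setT (EFin \o (fun w => f w ^+ 2)) ->
  P.-integrable setT (EFin \o (fun w => g w ^+ 2)) ->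
  P.-integrable setT (EFin \o (fun w => f w * g w)).
Proof.
move=> mf mg f2 g2.
have := integrableD measurableT f2 g2; apply: le_integrable => //.
  exact/measurable_EFinP/measurable_funM.
move=> w _; rewrite /= lee_fin [leRHS]ger0_norm ?addr_ge0 ?sqr_ge0// ler_norml.
by apply/andP; split; nra.
Qed.

Let integrable_of_sqr (f : T -> R) : measurable_fun setT f ->
  P.-integrable setT (EFin \o (fun w => f w ^+ 2)) ->
  P.-integrable setT (EFin \o f).
Proof.
move=> mf f2.
have := @integrable_sqr_mul f (cst 1) mf (measurable_cst _) f2.
rewrite (_ : (fun w => f w * cst 1 w) = f); last first.
  by apply/funext => w; rewrite mulr1.
apply; apply: bmeas_integrable; rewrite (_ : (fun w => _) = cst 1).
  exact: bmeas_cst.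
by apply/funext => w; rewrite expr1n.
Qed.

(** The cross term [S n * z n] has mean 0, because [z n] is centred and independent of the past. *)
Lemma partial_sum_sqr n : P.-integrable setT (EFin \o (fun w => S n w ^+ 2)) /\
  \int[P]_w (S n w ^+ 2) = \sum_(0 <= i < n) \int[P]_w (z i w ^+ 2).
Proof.
elim: n => [|n [IH IH']].
  rewrite big_geq// (_ : (fun w => S 0 w ^+ 2) = cst 0); last first.
    by apply/funext => w; rewrite /S big_geq// expr0n.
  split; first exact: bmeas_integrable (bmeas_cst _ 0).
  by rewrite Rintegral_cst// mul0r.
have iS : P.-integrable setT (EFin \o S n).
  by apply: integrable_of_sqr => //; exact: measurable_partial_sum.
have izn : P.-integrable setT (EFin \o z n) by exact: integrable_of_sqr.
have ind := @indep_history_fun n (S n) id (measurable_history_sum (leqnn n)) (@measurable_id _ _ _).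
have [iSz Sz] := indep_integrableM ind iS izn.
have E : (fun w => S n.+1 w ^+ 2) = (fun w => (S n w ^+ 2 + z n w ^+ 2) + 2 * (S n w * z n w)).
  by apply/funext => w; rewrite /S big_nat_recr//=; ring.
have i1 : P.-integrable setT (EFin \o (fun w => S n w ^+ 2 + z n w ^+ 2)).
  by have := integrableD measurableT IH (iz2 n); apply: eq_integrable.
have i2 : P.-integrable setT (EFin \o (fun w => 2 * (S n w * z n w))).
  by have := integrableZl measurableT 2 iSz; apply: eq_integrable.
rewrite E; split.
  by have := integrableD measurableT i1 i2; apply: eq_integrable.
rewrite RintegralD// RintegralD// RintegralZl// Sz z0 !mulr0 addr0.
by rewrite IH' big_nat_recr.
Qed.

Lemma exceed_mono : nondecreasing_seq exceed.
Proof.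
apply/nondecreasing_seqP => n; apply/subsetPset; exact: subsetUl.
Qed.

(* Kolmogorov's inequality by induction: the cross term
   [E (S n * 1_(exceed n) * z n)] vanishes by independence. *)
Lemma kolmogorov_induction n :
  eps ^+ 2 * \int[P]_w \1_(exceed n) w <= \int[P]_w (S n w ^+ 2 * \1_(exceed n) w).
Proof.
have mex k : measurable (exceed k).
  apply: (sigma_sub_measurable (@history_measurable k)); exact: measurable_exceed.
have i1 k : P.-integrable setT (EFin \o (\1_(exceed k) : T -> R)).
  apply: bmeas_integrable; split => //; exists 1 => w.
  by rewrite indicE; case: (_ \in _); rewrite ?normr1 ?normr0.
have iS2 k l : P.-integrable setT (EFin \o (fun w => S k w ^+ 2 * \1_(exceed l) w)).
  have [] := partial_sum_sqr k; move=> + _; apply: le_integrable => //.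
    apply/measurable_EFinP/measurable_funM => //; apply: measurable_funX.
    exact: measurable_partial_sum.
  move=> w _; rewrite /= lee_fin normrM ler_piMr// indicE.
  by case: (_ \in _); rewrite ?normr1 ?normr0.
elim: n => [|n IH].
  have E0 (f : T -> R) : \int[P]_w (f w * \1_(exceed 0) w) = 0.
    under eq_Rintegral do rewrite indicE in_set0 mulr0.
    by rewrite /Rintegral integral0.
  rewrite E0; under eq_Rintegral do rewrite -[\1__ _]mul1r.
  by rewrite (E0 (cst 1)) mulr0.
have mS := measurable_partial_sum n.
have [iSn _] := partial_sum_sqr n.
pose f w := S n w * \1_(exceed n) w.
have mf : measurable_fun setT (f : g_sigma_algebraType (history z n) -> R).
  apply: measurable_funM; first exact: measurable_history_sum.
  by apply: measurable_indic; exact: measurable_exceed.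
have if_ : P.-integrable setT (EFin \o f).
  have := integrable_of_sqr mS iSn; apply: le_integrable => //.
    by apply/measurable_EFinP/measurable_funM.
  move=> w _; rewrite /= lee_fin normrM ler_piMr// indicE.
  by case: (_ \in _); rewrite ?normr1 ?normr0.
have izn : P.-integrable setT (EFin \o z n) by exact: integrable_of_sqr.
have ind := @indep_history_fun n f id mf (@measurable_id _ _ _).
have [ifz fz] := indep_integrableM ind if_ izn.
have i2 : P.-integrable setT (EFin \o (fun w => 2 * (f w * z n w))).
  by have := integrableZl measurableT 2 ifz; apply: eq_integrable.
have i3 : P.-integrable setT (EFin \o (fun w => S n w ^+ 2 * \1_(exceed n) w + 2 * (f w * z n w))).
  by have := integrableD measurableT (iS2 n n) i2; apply: eq_integrable.
have i4 : P.-integrable setT (EFin \o (fun w => (\1_(exceed n.+1) w - \1_(exceed n) w : R))).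
  by have := integrableB measurableT (i1 n.+1) (i1 n); apply: eq_integrable.
have i5 : P.-integrable setT (EFin \o (fun w => eps ^+ 2 * (\1_(exceed n.+1) w - \1_(exceed n) w))).
  by have := integrableZl measurableT (eps ^+ 2) i4; apply: eq_integrable.
(* On [exceed n] the square of [S n.+1] is expanded and the term [z n ^+ 2] dropped; on the rest of
   [exceed n.+1] that square is at least [eps ^+ 2]. *)
apply: (@le_trans _ _ (\int[P]_w ((S n w ^+ 2 * \1_(exceed n) w + 2 * (f w * z n w)) +
    eps ^+ 2 * (\1_(exceed n.+1) w - \1_(exceed n) w)))); last first.
  apply: le_Rintegral => //.
    by have := integrableD measurableT i3 i5; apply: eq_integrable.
  move=> w _; rewrite /f !indicE.
  have SE : S n.+1 w = S n w + z n w by rewrite /S big_nat_recr.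
  case: (asboolP (exceed n w)) => ew.
    have ew' : exceed n.+1 w by left.
    by rewrite !mem_set// SE subrr !(mulr1, mulr0) addr0; have := sqr_ge0 (z n w); lra.
  rewrite (memNset ew); case: (asboolP (exceed n.+1 w)) => ew'.
    rewrite mem_set//; case: ew' => //= h.
    have : eps ^+ 2 <= S n.+1 w ^+ 2.
      by rewrite -[leRHS]real_normK ?num_real// lerXn2r ?nnegrE// ltW.
    lra.
  by rewrite memNset// subrr !(mulr0, mul0r) addr0.
rewrite RintegralD// RintegralD// RintegralZl// fz z0 !mulr0 addr0.
rewrite RintegralZl// RintegralB//; lra.
Qed.

Lemma kolmogorov_ineq n : 
  (P (exceed n) <= (\sum_(0 <= i < n) \int[P]_w (z i w ^+ 2) / eps ^+ 2)%:E)%E.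
Proof.
have mex : measurable (exceed n).
  apply: (sigma_sub_measurable (@history_measurable n)); exact: measurable_exceed.
have -> : P (exceed n) = (\int[P]_w \1_(exceed n) w)%:E.
  rewrite /Rintegral integral_indic// setIT fineK//; exact: fin_num_measure.
rewrite lee_fin -mulr_suml ler_pdivlMr ?exprn_gt0// mulrC.
apply: (le_trans (kolmogorov_induction n)).
have [iS <-] := partial_sum_sqr n.
apply: le_Rintegral => //.
  move: iS; apply: le_integrable => //.
    apply/measurable_EFinP/measurable_funM => //; apply: measurable_funX.
    exact: measurable_partial_sum.
  move=> w _; rewrite /= lee_fin normrM ler_piMr// indicE.
  by case: (_ \in _); rewrite ?normr1 ?normr0.
by move=> w _; rewrite ler_piMr ?sqr_ge0// indicE; case: (_ \in _).
Qed.

End maximal.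
End sums.
End independent_series.

Section series_convergence.
Context d (T : measurableType d) (R : realType) (P : probability T R).
Variables (z : nat -> T -> R) (v : nat -> R) (C V : R).
Hypothesis mz : forall n, measurable_fun setT (z n).
Hypothesis indz : indep_history P z.
Hypothesis v0 : forall n, 0 <= v n.
Hypothesis vV : (fun n => \sum_(0 <= i < n) v i) @ \oo --> V.

Let S n w := \sum_(0 <= i < n) z i w.
Let Vn n := \sum_(0 <= i < n) v i.

Let sum_shift (u : nat -> R) m n :
  \sum_(0 <= i < n) u (m + i)%N =
  \sum_(0 <= i < m + n) u i - \sum_(0 <= i < m) u i.
Proof.
elim: n => [|n IH]; first by rewrite big_geq// addn0 subrr.
by rewrite addnS big_nat_recr//= (big_nat_recr (m + n))//= IH; ring.
Qed.

Let Vn_le m : Vn m <= V.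
Proof.
rewrite -(cvg_lim (@Rhausdorff R) vV); apply: nondecreasing_cvgn_le.
  by apply/nondecreasing_seqP => n; rewrite /Vn big_nat_recr//= lerDl.
by apply/cvg_ex; exists V.
Qed.

Let indep_shift m : indep_history P (fun i => z (m + i)%N).
Proof.
move=> n; apply: indepS (@indz (m + n)%N); last by [].
apply: sub_sigma_algebra2 => A [i /= iN hA]; exists (m + i)%N => //=.
by rewrite ltn_add2l.
Qed.

Section ae_convergence.
Hypothesis C0 : 0 <= C.
Hypothesis iz2 : forall n, P.-integrable setT (EFin \o (fun w => z n w ^+ 2)).
Hypothesis z0 : forall n, \int[P]_w z n w = 0.
Hypothesis zv : forall n, \int[P]_w (z n w ^+ 2) <= C * v n.

Let E (m j : nat) := \bigcup_n exceed (fun i => z (m + i)%N) (j.+1%:R^-1 : R) n.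

Let mexceed m j n : measurable (exceed (fun i => z (m + i)%N) (j.+1%:R^-1 : R) n).
Proof.
apply: (sigma_sub_measurable (@history_measurable _ _ _ (fun i => z (m + i)%N) _ n)) => //.
exact: measurable_exceed.
Qed.

(** Kolmogorov's inequality for the series started at [m] has a bound uniform in [n], the tail of
    the variances, so it passes to the increasing union. *)
Let E_bound m j : (P (E m j) <= (C * (V - Vn m) * j.+1%:R ^+ 2)%:E)%E.
Proof.
have j0 : 0 < j.+1%:R^-1 :> R by rewrite invr_gt0.
have mono := exceed_mono (fun i => z (m + i)%N) (j.+1%:R^-1 : R).
have mE : measurable (E m j) by exact: bigcup_measurable.
have cv := nondecreasing_cvg_mu (mu := P) (mexceed m j) mE mono.
rewrite -(cvg_lim (@ereal_hausdorff R) cv); apply: lime_le.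
  by apply/cvg_ex; exists (P (E m j)).
apply: nearW => n /=.
apply: (le_trans (@kolmogorov_ineq _ _ _ P (fun i => z (m + i)%N) (fun i => mz (m + i))
  (indep_shift (m := m)) (fun i => iz2 (m + i)) (fun i => z0 (m + i)) _ j0 n)).
rewrite lee_fin -mulr_suml -exprVn invrK ler_wpM2r ?sqr_ge0//.
apply: (@le_trans _ _ (\sum_(0 <= i < n) C * v (m + i)%N)).
  by apply: ler_sum_nat => i _.
rewrite -mulr_sumr sum_shift ler_wpM2l// lerB//; exact: Vn_le.
Qed.

Lemma ae_cvg_series : {ae P, forall w, cvgn (fun n => S n w)}.
Proof.
(* If the series diverges at [w], then for some [j] it moves by at least 1/(j+1) after every index
   [m]; by [E_bound] such intersections are null. *)
have : P.-negligible (\bigcup_j \bigcap_m E m j).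
  apply: negligible_bigcup => j; exists (\bigcap_m E m j); split => //.
    by apply: bigcapT_measurable => m; exact: bigcup_measurable.
  have mI : measurable (\bigcap_m E m j).
    by apply: bigcapT_measurable => m; exact: bigcup_measurable.
  have Pm m : (P (\bigcap_m E m j) <= (C * (V - Vn m) * j.+1%:R ^+ 2)%:E)%E.
    apply: (le_trans _ (E_bound m j)); apply: le_measure; rewrite ?inE//.
      exact: bigcup_measurable.
    by apply: bigcap_inf.
  have cv : (fun m => C * (V - Vn m) * j.+1%:R ^+ 2) @ \oo --> (0 : R).
    rewrite -[X in _ --> X](_ : C * (V - V) * j.+1%:R ^+ 2 = 0); last by ring.
    apply: cvgM; last exact: cvg_cst.
    by apply: cvgM; [exact: cvg_cst|apply: cvgB; [exact: cvg_cst|exact: vV]].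
  apply/eqP; rewrite eq_le measure_ge0 andbT.
  rewrite -[X in (X <= _)%E]fineK ?fin_num_measure// lee_fin.
  rewrite -(cvg_lim (@Rhausdorff R) cv); apply: limr_ge.
    by apply/cvg_ex; exists 0.
  by apply: nearW => m; rewrite -lee_fin fineK ?fin_num_measure.
apply: negligibleS => w /= /cvgn_cauchy/existsNP[j hj]; exists j => // m _.
have := hj; apply: contra_notP => hE; exists m => k.
apply: contra_notT hE; rewrite -leNgt => hk; exists k => //.
(* An increment over no term is 0 and exceeds nothing, in accordance with [exceed] being empty at
   0. *)
case: k hk => [|k hk]; first by rewrite addn0 subrr normr0 leNgt invr_gt0 ltr0n.
right; rewrite /= (sum_shift (fun i => z i w)); exact: hk.
Qed.

End ae_convergence.

Section charfun.
Hypothesis zcos : forall n t, \int[P]_w cos (t * z n w) = expR (- (t ^+ 2 * v n / 2)).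
Hypothesis zsin : forall n t, \int[P]_w sin (t * z n w) = 0.

(** Cosine and sine go through the induction together, since the addition formulas mix them. *)
Lemma charfun_sum n (t : R) :
  \int[P]_w cos (t * S n w) = expR (- (t ^+ 2 * Vn n / 2)) /\
  \int[P]_w sin (t * S n w) = 0.
Proof.
elim: n => [|n [IHc IHs]].
  rewrite /Vn big_geq// mulr0 mul0r oppr0 expR0.
  split.
    under eq_Rintegral do rewrite /S big_geq// mulr0 cos0.
    by rewrite Rintegral_cst//= probability_setT mulr1.
  under eq_Rintegral do rewrite /S big_geq// mulr0 sin0.
  by rewrite /Rintegral integral0.
have mS := measurable_partial_sum mz n.
have mtS : measurable_fun setT (fun w => t * S n w) by exact: measurable_funM.
have mtz : measurable_fun setT (fun w => t * z n w) by exact: measurable_funM.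
have mtS' : measurable_fun setT ((fun w => t * S n w) : g_sigma_algebraType (history z n) -> R).
  by apply: measurable_funM => //; exact: measurable_history_sum.
have [mcos msin] : measurable_fun setT (@cos R) /\ measurable_fun setT (@sin R).
  by split; apply: continuous_measurable_fun; [exact: continuous_cos|exact: continuous_sin].
have mt : measurable_fun setT (fun x : R => t * x) by exact: measurable_funM.
have prod (f g : R -> R) : measurable_fun setT f -> measurable_fun setT g ->
    (forall x, `|f x| <= 1) -> (forall x, `|g x| <= 1) ->
    P.-integrable setT (EFin \o (fun w => f (t * S n w) * g (t * z n w))) /\
    \int[P]_w (f (t * S n w) * g (t * z n w)) =
    (\int[P]_w f (t * S n w)) * (\int[P]_w g (t * z n w)).
  move=> mf mg f1 g1.
  apply: indep_integrableM.
  - apply: (indep_history_fun indz (g := fun x => g (t * x))).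
      exact: measurableT_comp mtS'.
    exact: measurableT_comp mt.
  - apply: bmeas_integrable; split; last by exists 1.
    exact: measurableT_comp mtS.
  - apply: bmeas_integrable; split; last by exists 1.
    exact: measurableT_comp mtz.
have c1 (x : R) : `|cos x| <= 1 by rewrite ler_norml cos_geN1 cos_le1.
have s1 (x : R) : `|sin x| <= 1 by rewrite ler_norml sin_geN1 sin_le1.
have [icc cc] := prod _ _ mcos mcos c1 c1.
have [iss ss] := prod _ _ msin msin s1 s1.
have [ics cs] := prod _ _ mcos msin c1 s1.
have [isc sc] := prod _ _ msin mcos s1 c1.
have SE w : t * S n.+1 w = t * S n w + t * z n w.
  by rewrite /S big_nat_recr//= mulrDr.
split.
  under eq_Rintegral do rewrite SE cosD.
  rewrite RintegralB// cc ss IHc IHs zcos mul0r subr0 -expRD /Vn big_nat_recr//=.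
  by congr expR; ring.
under eq_Rintegral do rewrite SE sinD.
by rewrite RintegralD// sc cs IHs zsin mul0r mulr0 addr0.
Qed.

Hypothesis cvS : {ae P, forall w, cvgn (fun n => S n w)}.

Let L w := limn (fun n => S n w).

Lemma measurable_series_lim : measurable_fun setT L.
Proof. by apply: measurable_limn => n; exact: measurable_partial_sum. Qed.

Let lim_charfun (f : R -> R) (t : R) : continuous f -> (forall x, `|f x| <= 1) ->
  (fun n => \int[P]_w f (t * S n w)) @ \oo --> \int[P]_w f (t * L w).
Proof.
move=> cf f1.
have mf := continuous_measurable_fun cf.
have mn n : measurable_fun setT (fun w => (f (t * S n w))%:E).
  apply/measurable_EFinP; apply: measurableT_comp => //.
  by apply: measurable_funM => //; exact: measurable_partial_sum.
have mL : measurable_fun setT (fun w => (f (t * L w))%:E).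
  apply/measurable_EFinP; apply: measurableT_comp => //.
  by apply: measurable_funM => //; exact: measurable_series_lim.
have cv : {ae P, forall w, setT w -> (fun n => (f (t * S n w))%:E) @ \oo --> (f (t * L w))%:E}.
  move: cvS; apply: filterS => w cw _; apply: cvg_EFin; first exact: nearW.
  apply: continuous_cvg; first exact: cf.
  by apply: cvgM; [exact: cvg_cst|exact: cw].
have bd : {ae P, forall w n, setT w -> (`|(f (t * S n w))%:E| <= (cst 1 w)%:E)%E}.
  by apply: aeW => w n _; rewrite lee_fin.
have [iL _ H] := @dominated_convergence _ _ _ P setT measurableT _ _ _ mn mL cv
  (finite_measure_integrable_cst P 1 measurableT) bd.
apply: fine_cvg; rewrite fineK; first exact: H.
exact: (integrable_fin_num measurableT iL).
Qed.

Lemma charfun_series (t : R) :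
  \int[P]_w cos (t * L w) = expR (- (t ^+ 2 * V / 2)) /\
  \int[P]_w sin (t * L w) = 0.
Proof.
have c1 (x : R) : `|cos x| <= 1 by rewrite ler_norml cos_geN1 cos_le1.
have s1 (x : R) : `|sin x| <= 1 by rewrite ler_norml sin_geN1 sin_le1.
split.
  apply: (cvg_unique (@Rhausdorff R) (lim_charfun (t := t) (@continuous_cos R) c1)).
  rewrite (funext (fun n => (charfun_sum n t).1)).
  apply: continuous_cvg; first exact: continuous_expR.
  apply: cvgN; apply: cvgM; last exact: cvg_cst.
  by apply: cvgM; [exact: cvg_cst|exact: vV].
apply: (cvg_unique (@Rhausdorff R) (lim_charfun (t := t) (@continuous_sin R) s1)).
rewrite (funext (fun n => (charfun_sum n t).2)).
exact: cvg_cst.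
Qed.

End charfun.
End series_convergence.

(** * Gaussian functionals on a Hilbert space *)

Section hilbert.
Context (R : realType) (H : completeNormedModType R) (ip : {dot H for @idfun R}).
Hypothesis hip : induces_norm ip.

Lemma ipDl x y u : ip (x + y) u = ip x u + ip y u.
Proof. exact: linearDl. Qed.
Lemma ipBl x y u : ip (x - y) u = ip x u - ip y u.
Proof. exact: linearBl. Qed.
Lemma ipZl a x u : ip (a *: x) u = a * ip x u.
Proof. exact: linearZl_LR. Qed.
Lemma ipC x y : ip x y = ip y x.
Proof. by rewrite hermC expr0 mul1r. Qed.
Lemma ip0l u : ip 0 u = 0.
Proof. exact: linear0l. Qed.
Lemma ipBr x y u : ip u (x - y) = ip u x - ip u y.
Proof. by rewrite !(ipC u) ipBl. Qed.
Lemma ipZr a x u : ip u (a *: x) = a * ip u x.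
Proof. by rewrite !(ipC u) ipZl. Qed.
Lemma ip_suml (I : Type) (r : seq I) (Q : pred I) (f : I -> H) u :
  ip (\sum_(i <- r | Q i) f i) u = \sum_(i <- r | Q i) ip (f i) u.
Proof. by apply: (big_morph (fun x => ip x u)) => [x y|]; [exact: ipDl|exact: ip0l]. Qed.

Lemma normB_sqr x y : `|x - y| ^+ 2 = `|x| ^+ 2 - 2 * ip x y + `|y| ^+ 2.
Proof. by rewrite -!hip ipBl !ipBr (ipC y x); ring. Qed.

(** Cauchy-Schwarz against a unit vector, by expanding the squared norm of [x - ip x u *: u]; it
    makes the coordinates continuous, hence Borel. *)
Lemma ip_unit_bound x u : ip u u = 1 -> `|ip x u| <= `|x|.
Proof.
move=> u1; rewrite -[leLHS]ger0_norm// -[leRHS]ger0_norm// -ler_sqr ?nnegrE// -!normrX.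
rewrite !ger0_norm ?sqr_ge0//.
have := sqr_ge0 `|x - ip x u *: u|.
rewrite normB_sqr ipZr -[X in _ + X]hip ipZl ipZr u1; lra.
Qed.

Lemma measurable_ip u : ip u u = 1 -> measurable_fun setT (fun x : borel H => ip x u).
Proof.
move=> u1; apply: (measurability _ (RGenOpens.measurableE R)) => _ [_ [a [b ->]] <-].
rewrite setTI; apply: sub_sigma_algebra.
have cip : continuous (fun x : H => ip x u).
  move=> x; apply/cvgrPdist_lt => e e0.
  have : \forall y \near x, `|x - y| < e by exact: cvgr_dist_lt.
  by apply: filterS => y xy; rewrite -ipBl (le_lt_trans (ip_unit_bound _ u1)).
by apply: open_comp => [x _|]; [exact: cip|exact: interval_open].
Qed.

Variables (dim : option nat) (e : nat -> H).
Hypothesis he : orthonormal_basis ip dim e.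

Let orthonormal i j : in_dim dim i -> in_dim dim j -> ip (e i) (e j) = (i == j)%:R.
Proof. by move=> di dj; have [h _] := he; exact: h. Qed.

(** The value 0 outside the basis lets all sums run over plain initial segments of nat, in finite
    and infinite dimension alike. *)
Definition coord (x : H) (i : nat) : R := if in_dim dim i then ip x (e i) else 0.

Lemma coordB x y i : coord (x - y) i = coord x i - coord y i.
Proof. by rewrite /coord; case: ifP => _; rewrite ?subr0// ipBl. Qed.

Lemma measurable_coord i : measurable_fun setT (fun x : borel H => coord x i).
Proof.
rewrite /coord; case: (boolP (in_dim dim i)) => di; last exact: measurable_cst.
by apply: measurable_ip; rewrite (@orthonormal i i di di) eqxx.
Qed.

(** One expansion with two uses: [a] equal to the coordinates gives Bessel's inequality, and an
    arbitrary [a] shows that the orthogonal projection is the best approximation. *)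
Lemma norm_basis_approx x n (a : nat -> R) :
  `|x - \sum_(0 <= i < n | in_dim dim i) a i *: e i| ^+ 2 =
  `|x| ^+ 2 - \sum_(0 <= i < n) coord x i ^+ 2 +
  \sum_(0 <= i < n | in_dim dim i) (coord x i - a i) ^+ 2.
Proof.
have E1 : ip x (\sum_(0 <= i < n | in_dim dim i) a i *: e i) =
    \sum_(0 <= i < n | in_dim dim i) a i * coord x i.
  rewrite ipC ip_suml; apply: eq_bigr => i di.
  by rewrite ipZl ipC /coord di.
have E2 : `|\sum_(0 <= i < n | in_dim dim i) a i *: e i| ^+ 2 =
    \sum_(0 <= i < n | in_dim dim i) a i ^+ 2.
  rewrite -hip ip_suml big_seq_cond [RHS]big_seq_cond; apply: eq_bigr => i /andP[iN di].
  rewrite ipZl ipC ip_suml big_mkcond (bigD1_seq i) ?iota_uniq//= di.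
  rewrite big1 => [|j ji].
    by rewrite addr0 ipZl (@orthonormal i i di di) eqxx mulr1 expr2.
  case: (boolP (in_dim dim j)) => // dj.
  by rewrite ipZl (@orthonormal j i dj di) (negbTE ji) mulr0.
have E3 : \sum_(0 <= i < n) coord x i ^+ 2 = \sum_(0 <= i < n | in_dim dim i) coord x i ^+ 2.
  rewrite [RHS]big_mkcond; apply: eq_bigr => i _.
  by rewrite /coord; case: ifP => //; rewrite expr0n.
rewrite normB_sqr E1 E2 E3.
have -> : \sum_(0 <= i < n | in_dim dim i) (coord x i - a i) ^+ 2 =
    \sum_(0 <= i < n | in_dim dim i) coord x i ^+ 2 -
    2 * (\sum_(0 <= i < n | in_dim dim i) a i * coord x i) +
    \sum_(0 <= i < n | in_dim dim i) a i ^+ 2.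
  rewrite mulr_sumr -sumrB -big_split/=; apply: eq_bigr => i _; ring.
ring.
Qed.

Lemma bessel x n : \sum_(0 <= i < n) coord x i ^+ 2 <= `|x| ^+ 2.
Proof.
have := norm_basis_approx x n (coord x).
rewrite [X in _ = _ + X]big1 => [|i _]; last by rewrite subrr expr0n.
by have := sqr_ge0 `|x - \sum_(0 <= i < n | in_dim dim i) coord x i *: e i|; lra.
Qed.

Lemma parseval x : (fun n => \sum_(0 <= i < n) coord x i ^+ 2) @ \oo --> `|x| ^+ 2.
Proof.
have nd : nondecreasing_seq (fun n => \sum_(0 <= i < n) coord x i ^+ 2).
  by apply/nondecreasing_seqP => n; rewrite big_nat_recr//= lerDl sqr_ge0.
apply/cvgrPdist_le => eps eps0.
(* A distance below both 1 and [eps] has its square below [eps]. *)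
have [y [xy [n [a ya]]]] : exists y, `|x - y| < Num.min 1 eps /\
    exists n (a : nat -> R), y = \sum_(0 <= i < n | in_dim dim i) a i *: e i.
  have m0 : 0 < Num.min 1 eps by rewrite lt_min ltr01.
  have bo : open (ball x (Num.min 1 eps)) by exact: ball_open.
  have [_ /(_ _ _ bo)] := he; case; first by exists x; exact: ballxx.
  by move=> y []; rewrite -ball_normE/= => ? [n [a ya]]; exists y; split => //; exists n, a.
near=> m.
have nm : (n <= m)%N by near: m; exact: nbhs_infty_ge.
rewrite ger0_norm; last by rewrite subr_ge0 bessel.
(* The projection does at least as well as [y], and further basis vectors only improve it. *)
apply: (@le_trans _ _ (`|x - y| ^+ 2)).
  rewrite ya norm_basis_approx.
  have : 0 <= \sum_(0 <= i < n | in_dim dim i) (coord x i - a i) ^+ 2.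
    by apply: sumr_ge0 => i _; exact: sqr_ge0.
  have := nd _ _ nm; rewrite /=; lra.
move: xy; rewrite lt_min => /andP[x1 x2].
have := normr_ge0 (x - y); nra.
Unshelve. all: by end_near. Qed.

(** The squared norm is the series of squared coordinates: this avoids comparing
    the Borel sets of [H * H] with the product sigma-algebra. *)
Lemma measurable_dist : measurable_fun setT (fun z : borel H * borel H => `|(z.1 : H) - z.2|).
Proof.
have -> : (fun z : borel H * borel H => `|(z.1 : H) - z.2|) =
    (fun z => Num.sqrt (`|(z.1 : H) - z.2| ^+ 2)).
  by apply/funext => z; rewrite sqrtr_sqr normr_id.
apply: measurableT_comp => //; first exact: continuous_measurable_fun (@sqrt_continuous R).
apply: (@measurable_fun_cvg _ _ _ _ (fun n (z : borel H * borel H) =>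
    \sum_(0 <= i < n) coord ((z.1 : H) - z.2) i ^+ 2)); last first.
  by move=> z _; exact: parseval.
move=> n; apply: measurable_sum => i; apply: measurable_funX.
rewrite (_ : (fun _ => _) = fun z => coord z.1 i - coord z.2 i); last first.
  by apply/funext => z; rewrite coordB.
apply: measurable_funB.
  exact: (measurableT_comp (measurable_coord i) measurable_fst).
exact: (measurableT_comp (measurable_coord i) measurable_snd).
Qed.

Lemma measurable_norm : measurable_fun setT (fun x : borel H => `|(x : H)|).
Proof.
rewrite (_ : (fun x : borel H => _) = (fun z : borel H * borel H => `|(z.1 : H) - z.2|) \o
  (fun x => (x, 0))); last by apply/funext => x /=; rewrite subr0.
apply: measurableT_comp; first exact: measurable_dist.
by apply: measurable_fun_pair => //; exact: measurable_cst.
Qed.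

Lemma gauss_dotE d (T : measurableType d) (xi : nat -> T -> R) x w :
  gauss_dot ip dim e xi x w = limn (fun n => \sum_(0 <= i < n) coord x i * xi i w).
Proof.
rewrite /gauss_dot; congr (limn _); apply/funext => n.
by rewrite big_mkcond; apply: eq_bigr => i _; rewrite /coord; case: ifP; rewrite ?mul0r.
Qed.

(** Joint measurability in the sample point and the vector is what freezing [xi] and Fubini's
    theorem call for. *)
Lemma measurable_gauss_dot d (T : measurableType d) (xi : nat -> T -> R) :
  (forall i, in_dim dim i -> measurable_fun setT (xi i)) ->
  measurable_fun setT (fun z : T * borel H => gauss_dot ip dim e xi z.2 z.1).
Proof.
move=> mxi.
rewrite (_ : (fun _ => _) = fun z : T * borel H =>
  limn (fun n => \sum_(0 <= i < n) coord z.2 i * xi i z.1)); last first.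
  by apply/funext => z; rewrite gauss_dotE.
apply: measurable_limn => n; apply: measurable_sum => i.
have [di|di] := boolP (in_dim dim i).
  apply: measurable_funM.
    exact: (measurableT_comp (measurable_coord i) measurable_snd).
  exact: (measurableT_comp (mxi i di) measurable_fst).
rewrite (_ : (fun z : T * borel H => _) = cst 0); first exact: measurable_cst.
by apply/funext => z; rewrite /coord (negbTE di) mul0r.
Qed.

End hilbert.

Section standard_normal.
Context d (T : measurableType d) (R : realType) (P : probability T R).
Local Notation N := (@normal_prob R 0 1 : probability _ R).
Variables (f : T -> R) (mf : measurable_fun setT f).
Hypothesis nf : standard_normal P f.

Let mf' : measurable_fun setT (f : T -> measurableTypeR R) := mf.

Let lawN A : measurable A -> A `<=` setT -> law P mf' A = N A.
Proof. by move=> mA _; exact: nf. Qed.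

Lemma integrable_standard_normal (g : R -> R) : measurable_fun setT g ->
  N.-integrable setT (EFin \o g) -> P.-integrable setT (EFin \o (fun w => g (f w))).
Proof.
move=> mg /integrableP[_ ig].
have mg' : measurable_fun setT (g : measurableTypeR R -> R) := mg.
have mn : measurable_fun setT (fun x : measurableTypeR R => `|(g x)%:E|%E).
  by apply: measurableT_comp => //; exact/measurable_EFinP.
apply/integrableP; split; first by apply/measurable_EFinP; exact: (measurableT_comp mg mf).
rewrite /= -(ge0_integral_law P mf' mn)//.
by rewrite (eq_measure_integral N).
Qed.

Lemma Rintegral_standard_normal (g : R -> R) : measurable_fun setT g ->
  N.-integrable setT (EFin \o g) -> \int[P]_w g (f w) = \int[N]_x g x.
Proof.
move=> mg ig.
have mg' : measurable_fun setT (g : measurableTypeR R -> R) := mg.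
rewrite -(Rintegral_law mf' mg'); last exact: integrable_standard_normal.
by congr fine; exact: eq_measure_integral.
Qed.

End standard_normal.

(** * Law of the Gaussian series at a fixed vector *)

Section gaussian_functional.
Context (R : realType) (H : completeNormedModType R) (ip : {dot H for @idfun R}).
Hypothesis hip : induces_norm ip.
Variables (dim : option nat) (e : nat -> H).
Hypothesis he : orthonormal_basis ip dim e.
Context d (T : measurableType d) (P : probability T R).
Variable xi : nat -> T -> R.
Hypothesis mxi : forall i, measurable_fun setT (xi i).
Hypothesis nxi : forall i, in_dim dim i -> standard_normal P (xi i).
Hypothesis indxi : forall n, in_dim dim n ->
  indep P <<s \bigcup_(i in [set k | (k < n)%N && in_dim dim k]) g_sigma_algebra_preimage (xi i)>>
    (g_sigma_algebra_preimage (xi n)).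
Local Notation N := (@normal_prob R 0 1 : probability _ R).
Local Notation gd := (gauss_dot ip dim e xi).
Local Notation crd := (coord ip dim e).

Section fixed_vector.
Variable x : H.
Let z i w := crd x i * xi i w.

Let mz i : measurable_fun setT (z i).
Proof. by apply: measurable_funM. Qed.

Let c_out i : in_dim dim i = false -> crd x i = 0.
Proof. by rewrite /coord => ->. Qed.

Let z_out i : in_dim dim i = false -> z i = cst 0.
Proof. by move=> di; apply/funext => w; rewrite /z c_out// mul0r. Qed.

(** Nothing is known of [xi n] outside the basis, but there [z n] is the constant 0, whose preimages
    have probability 0 or 1. Inside, the history of [z] is generated by the [xi i] whose index
    belongs to the basis. *)
Let indz : indep_history P z.
Proof.
move=> n; have [dn|dn] := boolP (in_dim dim n); last first.
  move=> A B hA; rewrite (z_out (negbTE dn)) => -[C mC <-].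
  rewrite setTI preimage_cst; case: ifP => _.
    by rewrite setIT probability_setT mule1.
  by rewrite setI0 measure0 mule0.
apply: indepS (indxi dn).
- apply: smallest_sub; first exact: smallest_sigma_algebra.
  move=> A [i /= iN]; move: A; apply/preimage_sub_sigma.
  have [di|di] := boolP (in_dim dim i); last first.
    by rewrite (z_out (negbTE di)); exact: measurable_cst.
  apply: measurable_funM => //; apply/preimage_sub_sigma.
  apply: subset_trans; last exact: sub_sigma_algebra.
  by move=> A hA; exists i => //=; rewrite iN.
- move=> _ [B mB <-]; exists ((fun y => crd x n * y) @^-1` B) => //.
  rewrite -[X in measurable X]setTI.
  have m : measurable_fun setT (fun y : R => crd x n * y) by exact: measurable_funM.
  exact: m.
Qed.

Let vV : (fun n => \sum_(0 <= i < n) crd x i ^+ 2) @ \oo --> `|x| ^+ 2.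
Proof. exact: parseval. Qed.

Let trig (f : R -> R) (c : R) i : continuous f -> (forall y, `|f y| <= 1) ->
  in_dim dim i -> \int[P]_w f (c * xi i w) = \int[N]_y f (c * y).
Proof.
move=> cf f1 di.
have m : measurable_fun setT (fun y : R => f (c * y)).
  apply: (measurableT_comp (continuous_measurable_fun cf)).
  exact: measurable_funM.
apply: (Rintegral_standard_normal (mxi i) (nxi di) m).
by apply: bmeas_integrable; split => //; exists 1.
Qed.

Let zcos n t : \int[P]_w cos (t * z n w) = expR (- (t ^+ 2 * crd x n ^+ 2 / 2)).
Proof.
have [dn|dn] := boolP (in_dim dim n); last first.
  transitivity (1 : R); last first.
    by rewrite (c_out (negbTE dn)) expr0n mulr0 mul0r oppr0 expR0.
  rewrite (z_out (negbTE dn)); under eq_Rintegral do rewrite /= mulr0 cos0.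
  by rewrite Rintegral_cst//= probability_setT mulr1.
under eq_Rintegral do rewrite /z mulrA.
rewrite trig//; [|exact: continuous_cos|by move=> y; rewrite ler_norml cos_geN1 cos_le1].
by rewrite normal_cos exprMn.
Qed.

Let zsin n t : \int[P]_w sin (t * z n w) = 0.
Proof.
have [dn|dn] := boolP (in_dim dim n); last first.
  rewrite (z_out (negbTE dn)).
  by under eq_Rintegral do rewrite /= mulr0 sin0; rewrite /Rintegral integral0.
under eq_Rintegral do rewrite /z mulrA.
rewrite trig//; [|exact: continuous_sin|by move=> y; rewrite ler_norml sin_geN1 sin_le1].
by rewrite normal_sin.
Qed.

Lemma ae_cvg_gauss_dot : {ae P, forall w, cvgn (fun n => \sum_(0 <= i < n) crd x i * xi i w)}.
Proof.
have msq : measurable_fun setT (fun y : R => y ^+ 2) by exact: measurable_funX.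
have isq i : in_dim dim i -> P.-integrable setT (EFin \o (fun w => xi i w ^+ 2)).
  move=> di; apply: (integrable_standard_normal (mxi i) (nxi di) msq).
  exact: integrable_normal_sqr.
have iid i : in_dim dim i -> P.-integrable setT (EFin \o xi i).
  move=> di; apply: (integrable_standard_normal (mxi i) (nxi di) (@measurable_id _ _ _)).
  exact: integrable_normal_id.
have iz0 i : in_dim dim i = false -> P.-integrable setT (EFin \o (fun w => z i w ^+ 2)).
  move=> di; rewrite (z_out di) (_ : (fun w => _) = cst (0 ^+ 2))//.
  exact: bmeas_integrable (bmeas_cst _ _).
(* The constant [C] is the second moment of the normal law, left unevaluated; Parseval's identity
   gives the sum of the variances. *)
apply: (@ae_cvg_series _ _ _ P z (fun i => crd x i ^+ 2) (\int[N]_y y ^+ 2) (`|x| ^+ 2)) => //.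
- by move=> n; exact: sqr_ge0.
- by apply: Rintegral_ge0 => y _; exact: sqr_ge0.
- move=> n; have [dn|dn] := boolP (in_dim dim n); last exact/iz0/negbTE.
  have := integrableZl measurableT (crd x n ^+ 2) (isq _ dn).
  by apply: eq_integrable => // w _; rewrite /= /z exprMn.
- move=> n; have [dn|dn] := boolP (in_dim dim n); last first.
    by rewrite (z_out (negbTE dn)) Rintegral_cst// mul0r.
  rewrite /z RintegralZl//; last exact: iid.
  have := Rintegral_standard_normal (mxi n) (nxi dn) (@measurable_id _ _ _) (integrable_normal_id R).
  by move=> /= ->; rewrite normal_mean mulr0.
- move=> n; have [dn|dn] := boolP (in_dim dim n); last first.
    rewrite (z_out (negbTE dn)) (_ : (fun w => _) = cst (0 ^+ 2))//.
    by rewrite Rintegral_cst// expr0n mul0r (c_out (negbTE dn)) expr0n mulr0.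
  under eq_Rintegral do rewrite /z exprMn.
  rewrite RintegralZl//; last exact: isq.
  rewrite (Rintegral_standard_normal (mxi n) (nxi dn) msq (integrable_normal_sqr R)).
  by rewrite mulrC.
Qed.

Lemma gauss_dot_charfun t : \int[P]_w cos (t * gd x w) = expR (- (t ^+ 2 * `|x| ^+ 2 / 2)) /\
  \int[P]_w sin (t * gd x w) = 0.
Proof.
have -> : gd x = fun w => limn (fun n => \sum_(0 <= i < n) crd x i * xi i w).
  by apply/funext => w; rewrite gauss_dotE.
exact: (charfun_series mz indz vV zcos zsin ae_cvg_gauss_dot).
Qed.

End fixed_vector.

(** Limits subtract only where both series converge. The exceptional null set depends on [x] and
    [y], which is harmless under an integral in [w] at fixed vectors. *)
Lemma gauss_dotB x y : {ae P, forall w, gd (x - y) w = gd x w - gd y w}.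
Proof.
have := ae_cvg_gauss_dot y; have := ae_cvg_gauss_dot x; apply: filterS2 => w cx cy.
rewrite !gauss_dotE.
rewrite (_ : (fun n => \sum_(0 <= i < n) crd (x - y) i * xi i w) =
  fun n => \sum_(0 <= i < n) crd x i * xi i w - \sum_(0 <= i < n) crd y i * xi i w).
  by rewrite (limB cx cy).
apply/funext => n; rewrite -sumrB; apply: eq_bigr => i _.
by rewrite coordB mulrBl.
Qed.

Lemma measurable_gd x : measurable_fun setT (gd x).
Proof.
have := @measurable_gauss_dot R H ip hip dim e he _ T xi (fun i _ => mxi i).
exact: measurable_fun_pair1.
Qed.

Lemma gauss_dotB_charfun x y t :
  \int[P]_w cos (t * gd x w - t * gd y w) = expR (- (t ^+ 2 * `|x - y| ^+ 2 / 2)) /\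
  \int[P]_w sin (t * gd x w - t * gd y w) = 0.
Proof.
have tr (f : R -> R) : continuous f ->
    \int[P]_w f (t * gd x w - t * gd y w) = \int[P]_w f (t * gd (x - y) w).
  move=> cf; congr fine; apply: ae_eq_integral => //.
  - apply/measurable_EFinP; apply: (measurableT_comp (continuous_measurable_fun cf)).
    by apply: measurable_funB; apply: measurable_funM => //; exact: measurable_gd.
  - apply/measurable_EFinP; apply: (measurableT_comp (continuous_measurable_fun cf)).
    by apply: measurable_funM => //; exact: measurable_gd.
  - by move: (gauss_dotB x y); apply: filterS => w E _; rewrite E mulrBr.
have [h1 h2] := gauss_dot_charfun (x - y) t.
by rewrite !tr//; [exact: continuous_sin|exact: continuous_cos].
Qed.

End gaussian_functional.

(** * Mean squared covariance of characteristic functions *)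

(** Declaring the product a probability allows products to be nested, as is done for four copies. *)
Definition prodP d1 d2 (T1 : measurableType d1) (T2 : measurableType d2)
  (R : realType) (P1 : probability T1 R) (P2 : probability T2 R) :
  probability (T1 * T2)%type R := (P1 \x P2)%E.

Lemma bmeas_pair2 d1 d2 (T1 : measurableType d1) (T2 : measurableType d2)
  (R : realType) (f : T1 * T2 -> R) (x : T1) : bmeas f -> bmeas (fun y => f (x, y)).
Proof. by move=> bf; apply: (bmeas_comp bf); exact: measurable_fun_pair. Qed.

Section Rintegral_products.
Context d1 d2 (T1 : measurableType d1) (T2 : measurableType d2) (R : realType).
Variables (P1 : probability T1 R) (P2 : probability T2 R).

Lemma Rintegral_prodM (f : T1 -> R) (g : T2 -> R) : bmeas f -> bmeas g ->
  \int[prodP P1 P2]_z (f z.1 * g z.2) = \int[P1]_x f x * \int[P2]_y g y.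
Proof.
move=> bf bg.
have bfg : bmeas (fun z : T1 * T2 => f z.1 * g z.2).
  apply: bmeasM; first exact: (bmeas_comp bf measurable_fst).
  exact: (bmeas_comp bg measurable_snd).
rewrite -Rintegral12; last exact: bmeas_integrable.
transitivity (\int[P1]_x (f x * \int[P2]_y g y)).
  by apply: eq_Rintegral => x _; rewrite /= RintegralZl//; exact: bmeas_integrable.
by rewrite RintegralZr//; exact: bmeas_integrable.
Qed.

Lemma Rintegral_fst (f : T1 -> R) : bmeas f ->
  \int[prodP P1 P2]_z f z.1 = \int[P1]_x f x.
Proof.
move=> bf; have := Rintegral_prodM bf (bmeas_cst _ 1).
rewrite (Rintegral_cst P2)//= probability_setT /= !mulr1 => <-.
by apply: eq_Rintegral => z _; rewrite mulr1.
Qed.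

Lemma Rintegral_snd (f : T2 -> R) : bmeas f ->
  \int[prodP P1 P2]_z f z.2 = \int[P2]_y f y.
Proof.
move=> bf; have := Rintegral_prodM (bmeas_cst _ 1) bf.
rewrite (Rintegral_cst P1)//= probability_setT /= !mul1r => <-.
by apply: eq_Rintegral => z _; rewrite mul1r.
Qed.

End Rintegral_products.

Section covariance_double.
Context d (S : measurableType d) (R : realType) (mu : probability S R).

(** An independent copy replaces the product of two means by a single integral, so that a product of
    covariances becomes one integral over more copies. *)
Lemma Rintegral_double_cov (f g : S -> R) : bmeas f -> bmeas g ->
  \int[prodP mu mu]_z ((f z.1 - f z.2) * (g z.1 - g z.2)) =
  2 * (\int[mu]_x (f x * g x) - \int[mu]_x f x * \int[mu]_x g x).
Proof.
move=> bf bg; have bfg := bmeasM bf bg.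
have b1 (h : S -> R) (bh : bmeas h) : bmeas (fun z : S * S => h z.1).
  exact: (bmeas_comp bh measurable_fst).
have b2 (h : S -> R) (bh : bmeas h) : bmeas (fun z : S * S => h z.2).
  exact: (bmeas_comp bh measurable_snd).
have bI (h : S * S -> R) : bmeas h -> (prodP mu mu).-integrable setT (EFin \o h).
  exact: bmeas_integrable.
under eq_Rintegral => z _.
  rewrite (_ : _ * _ = (f z.1 * g z.1 + f z.2 * g z.2) - (f z.1 * g z.2 + g z.1 * f z.2)); last by ring.
  over.
have i12 := bmeasM (b1 _ bf) (b2 _ bg).
have i21 := bmeasM (b1 _ bg) (b2 _ bf).
have i11 := b1 _ bfg.
have i22 := b2 _ bfg.
rewrite RintegralB//; [|exact/bI/bmeasD|exact/bI/bmeasD].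
rewrite !RintegralD//; [|exact: bI..].
by rewrite (Rintegral_fst mu mu bfg) (Rintegral_snd mu mu bfg) !Rintegral_prodM//; ring.
Qed.

End covariance_double.

(** The alternating sum around a 4-cycle. It kills constant kernels, so that passing from [k] to
    [1 - k] only changes its sign. *)
Definition hatk (R : realType) (E : Type) (k : E -> E -> R) (x0 x1 x2 x3 : E) :=
  k x0 x1 - k x1 x2 + k x2 x3 - k x3 x0.

Lemma measurable_hatk d d' (E : measurableType d) (Q : measurableType d') (R : realType)
    (k : E -> E -> R) (p0 p1 p2 p3 : Q -> E) :
  measurable_fun setT (fun z : E * E => k z.1 z.2) ->
  measurable_fun setT p0 -> measurable_fun setT p1 ->
  measurable_fun setT p2 -> measurable_fun setT p3 ->
  measurable_fun setT (fun q => hatk k (p0 q) (p1 q) (p2 q) (p3 q)).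
Proof.
move=> mk0 m0 m1 m2 m3.
have mk (p p' : Q -> E) : measurable_fun setT p -> measurable_fun setT p' ->
    measurable_fun setT (fun q => k (p q) (p' q)).
  by move=> mp mp'; exact: (measurableT_comp mk0 (measurable_fun_pair mp mp')).
apply: measurable_funB; last exact: mk.
apply: measurable_funD; last exact: mk.
by apply: measurable_funB; exact: mk.
Qed.

Section phase_differences.
Context d (T : measurableType d) (R : realType) (P : probability T R).
Context d1 (E : measurableType d1) (a : T * E -> R).
Hypothesis ma : measurable_fun setT a.

(** [phase_sum a f x0 x2 x1 x3] is, for [f = cos] and [f = sin], the real and
    imaginary part of [(exp(i a0) - exp(i a2)) * (exp(-i a1) - exp(-i a3))]. *)
Definition phase_sum (f : R -> R) (x0 x2 x1 x3 : E) w :=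
  f (a (w, x0) - a (w, x1)) - f (a (w, x0) - a (w, x3))
  - f (a (w, x2) - a (w, x1)) + f (a (w, x2) - a (w, x3)).

Lemma bmeas_phase (f : R -> R) x x' : bmeas f -> bmeas (fun w => f (a (w, x) - a (w, x'))).
Proof.
move=> bf; apply: (bmeas_comp bf).
by apply: measurable_funB; exact: measurable_fun_pair1.
Qed.

Lemma bmeas_phase_sum f x0 x2 x1 x3 : bmeas f -> bmeas (phase_sum f x0 x2 x1 x3).
Proof.
by move=> bf; apply: bmeasD; [apply: bmeasB; [apply: bmeasB|]|]; exact: bmeas_phase.
Qed.

Lemma Rintegral_phase_sum f x0 x2 x1 x3 : bmeas f ->
  \int[P]_w phase_sum f x0 x2 x1 x3 w =
  \int[P]_w f (a (w, x0) - a (w, x1)) - \int[P]_w f (a (w, x0) - a (w, x3))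
  - \int[P]_w f (a (w, x2) - a (w, x1)) + \int[P]_w f (a (w, x2) - a (w, x3)).
Proof.
move=> bf; have b x x' := bmeas_phase x x' bf.
have b2 := bmeasB (b x0 x1) (b x0 x3); have b3 := bmeasB b2 (b x2 x1).
have bI := bmeas_integrable P.
by rewrite /phase_sum RintegralD ?RintegralB//; exact: bI.
Qed.

Lemma phase_sum_sigma (G : set (set T)) (f : R -> R) x0 x2 x1 x3 : measurable_fun setT f ->
  (forall x, measurable_fun setT ((fun w => a (w, x)) : g_sigma_algebraType G -> R)) ->
  measurable_fun setT (phase_sum f x0 x2 x1 x3 : g_sigma_algebraType G -> R).
Proof.
move=> mf mG; have m x x' : measurable_fun setT
    ((fun w => f (a (w, x) - a (w, x'))) : g_sigma_algebraType G -> R).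
  by apply: (measurableT_comp mf); exact: measurable_funB.
by apply: measurable_funD => //; apply: measurable_funB => //; exact: measurable_funB.
Qed.

Variable k : E -> E -> R.
Hypothesis kE : forall x x', \int[P]_w cos (a (w, x) - a (w, x')) = k x x'.

Lemma Rintegral_phase_cos x0 x2 x1 x3 :
  \int[P]_w phase_sum cos x0 x2 x1 x3 w = hatk k x0 x1 x2 x3.
Proof.
have ksym x x' : k x x' = k x' x.
  by rewrite -!kE; apply: eq_Rintegral => w _; rewrite -cosN opprB.
rewrite Rintegral_phase_sum; last exact: bmeas_cosine.
by rewrite !kE /hatk (ksym x2 x1) (ksym x0 x3); ring.
Qed.

(** With u = exp(i a0) - exp(i a2) and v = exp(i a1) - exp(i a3), the phase sum is at most |u| |v|
    <= l |u|^2 / 2 + |v|^2 / (2 l), and |u|^2 / 2 = 1 - cos (a0 - a2) has mean 1 - k x0 x2; likewise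
    for v. *)
Lemma hatk_bound x0 x1 x2 x3 (l : R) : 0 < l ->
  `|hatk k x0 x1 x2 x3| <= l * (1 - k x0 x2) + l^-1 * (1 - k x1 x3).
Proof.
move=> l0; have br := bmeas_phase_sum x0 x2 x1 x3 (bmeas_cosine R).
rewrite -Rintegral_phase_cos.
have bc x x' : bmeas (fun w => 1 - cos (a (w, x) - a (w, x'))).
  by apply: bmeasB; [exact: bmeas_cst|exact: (bmeas_phase _ _ (bmeas_cosine R))].
have kE1 x x' : 1 - k x x' = \int[P]_w (1 - cos (a (w, x) - a (w, x'))).
  rewrite RintegralB//; first by rewrite Rintegral_cst//= probability_setT mulr1 kE.
    exact: (bmeas_integrable P (bmeas_cst _ 1)).
  exact: (bmeas_integrable P (bmeas_phase _ _ (bmeas_cosine R))).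
have i02 := bmeas_integrable P (bc x0 x2).
have i13 := bmeas_integrable P (bc x1 x3).
have bl c x x' : bmeas (fun w => c * (1 - cos (a (w, x) - a (w, x')))).
  by apply: bmeasM => //; exact: bmeas_cst.
rewrite !kE1 -!RintegralZl// -RintegralD//; [|exact: bmeas_integrable..].
apply: (le_trans (le_normr_Rintegral _ (bmeas_integrable P br))) => //.
apply: le_Rintegral => //.
- apply: bmeas_integrable; case: br => mr [M rM]; split; first exact: measurableT_comp.
  by exists M => w; rewrite normr_id.
- by apply: bmeas_integrable; exact: bmeasD.
- move=> w _; rewrite /phase_sum !cosB.
  have := cos2Dsin2 (a (w, x0)); have := cos2Dsin2 (a (w, x1)).
  have := cos2Dsin2 (a (w, x2)); have := cos2Dsin2 (a (w, x3)).
  move: (cos (a (w, x0))) (cos (a (w, x1))) (cos (a (w, x2))) (cos (a (w, x3)))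
    (sin (a (w, x0))) (sin (a (w, x1))) (sin (a (w, x2))) (sin (a (w, x3))).
  move=> c0 c1 c2 c3 s0 s1 s2 s3 h3 h2 h1 h0.
  set A := (X in `|X|).
  have AE : A = (c0 - c2) * (c1 - c3) + (s0 - s2) * (s1 - s3) by rewrite /A; ring.
  have li : l * l^-1 = 1 by rewrite divff// gt_eqF.
  have li0 : 0 < l^-1 by rewrite invr_gt0.
  have pos p q : l * p ^+ 2 + 2 * (p * q) + l^-1 * q ^+ 2 >= 0.
    rewrite (_ : _ + _ = l^-1 * (l * p + q) ^+ 2); last by field; rewrite gt_eqF.
    by rewrite mulr_ge0 ?sqr_ge0 ?ltW.
  have e02 : 1 - (c0 * c2 + s0 * s2) = ((c0 - c2) ^+ 2 + (s0 - s2) ^+ 2) / 2.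
    lra.
  have e13 : 1 - (c1 * c3 + s1 * s3) = ((c1 - c3) ^+ 2 + (s1 - s3) ^+ 2) / 2.
    lra.
  rewrite e02 e13 AE ler_norml.
  have := pos (c0 - c2) (c1 - c3); have := pos (s0 - s2) (s1 - s3).
  have := pos (c0 - c2) (- (c1 - c3)); have := pos (s0 - s2) (- (s1 - s3)).
  rewrite !sqrrN => q1 q2 q3 q4.
  by apply/andP; split; lra.
Qed.

End phase_differences.

(** [cov_re] and [cov_im] are the real and imaginary parts of the covariance of
    [exp(i a)] and [exp(i b)] under [mu]. It is half of a double integral of
    products of differences, so its squared modulus is an integral over four
    copies, in which the randomness of [a] and [b] is averaged out first. *)
Section cov_identity.
Context d (T : measurableType d) (R : realType) (P : probability T R).
Context d1 d2 (E1 : measurableType d1) (E2 : measurableType d2).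
Variable mu : probability (E1 * E2)%type R.
Variables (a : T * E1 -> R) (b : T * E2 -> R).
Hypotheses (ma : measurable_fun setT a) (mb : measurable_fun setT b).
Variables G1 G2 : set (set T).
Hypothesis ind : indep P <<s G1 >> <<s G2 >>.
Hypothesis ma1 : forall x, measurable_fun setT ((fun w => a (w, x)) : g_sigma_algebraType G1 -> R).
Hypothesis mb1 : forall y, measurable_fun setT ((fun w => b (w, y)) : g_sigma_algebraType G2 -> R).
Variables (k1 : E1 -> E1 -> R) (k2 : E2 -> E2 -> R).
Hypothesis k1E : forall x x', \int[P]_w cos (a (w, x) - a (w, x')) = k1 x x'.
Hypothesis k2E : forall y y', \int[P]_w cos (b (w, y) - b (w, y')) = k2 y y'.
Hypothesis s1E : forall x x', \int[P]_w sin (a (w, x) - a (w, x')) = 0.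
Local Notation S := (E1 * E2)%type.

Let ca (w : T) (z : S) := cos (a (w, z.1)).
Let sa (w : T) (z : S) := sin (a (w, z.1)).
Let cb (w : T) (z : S) := cos (b (w, z.2)).
Let sb (w : T) (z : S) := sin (b (w, z.2)).

Definition cov_re (w : T) :=
  \int[mu]_z cos (a (w, z.1) + b (w, z.2)) -
  (\int[mu]_z cos (a (w, z.1)) * \int[mu]_z cos (b (w, z.2)) -
   \int[mu]_z sin (a (w, z.1)) * \int[mu]_z sin (b (w, z.2))).
Definition cov_im (w : T) :=
  \int[mu]_z sin (a (w, z.1) + b (w, z.2)) -
  (\int[mu]_z cos (a (w, z.1)) * \int[mu]_z sin (b (w, z.2)) +
   \int[mu]_z sin (a (w, z.1)) * \int[mu]_z cos (b (w, z.2))).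

Let U w (z : S * S) := (ca w z.1 - ca w z.2) * (cb w z.1 - cb w z.2) -
  (sa w z.1 - sa w z.2) * (sb w z.1 - sb w z.2).
Let V w (z : S * S) := (ca w z.1 - ca w z.2) * (sb w z.1 - sb w z.2) +
  (sa w z.1 - sa w z.2) * (cb w z.1 - cb w z.2).

Let mga : measurable_fun setT (fun u : T * S => a (u.1, u.2.1)).
Proof.
apply: (measurableT_comp ma); apply: measurable_fun_pair => //.
exact: (measurableT_comp measurable_fst measurable_snd).
Qed.

Let mgb : measurable_fun setT (fun u : T * S => b (u.1, u.2.2)).
Proof.
apply: (measurableT_comp mb); apply: measurable_fun_pair => //.
exact: (measurableT_comp measurable_snd measurable_snd).
Qed.

Let bj : [/\ bmeas (fun u : T * S => ca u.1 u.2), bmeas (fun u : T * S => sa u.1 u.2),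
  bmeas (fun u : T * S => cb u.1 u.2) & bmeas (fun u : T * S => sb u.1 u.2)].
Proof. by split; [exact: bmeas_cos|exact: bmeas_sin|exact: bmeas_cos|exact: bmeas_sin]. Qed.

Let slice (h : T -> S -> R) w : bmeas (fun u : T * S => h u.1 u.2) -> bmeas (h w).
Proof.
by move=> bh; exact: (bmeas_pair2 w bh).
Qed.

Let bs w : [/\ bmeas (ca w), bmeas (sa w), bmeas (cb w) & bmeas (sb w)].
Proof. by case: bj => *; split; exact: slice. Qed.

Let cov_reE w : cov_re w = \int[prodP mu mu]_z U w z / 2.
Proof.
have [b1 b2 b3 b4] := bs w.
have bd (f : S -> R) : bmeas f -> bmeas (fun z : S * S => f z.1 - f z.2).
  move=> bf; apply: bmeasB; first exact: (bmeas_comp bf measurable_fst).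
  exact: (bmeas_comp bf measurable_snd).
rewrite /U RintegralB//; [|by apply: bmeas_integrable; apply: bmeasM; exact: bd..].
rewrite !Rintegral_double_cov// /cov_re.
under eq_Rintegral do rewrite cosD.
rewrite RintegralB//; [|by apply: bmeas_integrable; exact: bmeasM..].
by rewrite /ca/cb/sa/sb; field.
Qed.

Let cov_imE w : cov_im w = \int[prodP mu mu]_z V w z / 2.
Proof.
have [b1 b2 b3 b4] := bs w.
have bd (f : S -> R) : bmeas f -> bmeas (fun z : S * S => f z.1 - f z.2).
  move=> bf; apply: bmeasB; first exact: (bmeas_comp bf measurable_fst).
  exact: (bmeas_comp bf measurable_snd).
rewrite /V RintegralD//; [|by apply: bmeas_integrable; apply: bmeasM; exact: bd..].
rewrite !Rintegral_double_cov// /cov_im.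
under eq_Rintegral do rewrite sinD.
rewrite RintegralD//; [|by apply: bmeas_integrable; exact: bmeasM..].
by rewrite /ca/cb/sa/sb; field.
Qed.

Let bU : bmeas (fun u : T * (S * S) => U u.1 u.2) /\ bmeas (fun u : T * (S * S) => V u.1 u.2).
Proof.
case: bj => b1 b2 b3 b4.
have p1 : measurable_fun setT (fun u : T * (S * S) => (u.1, u.2.1)).
  by apply: measurable_fun_pair => //; exact: (measurableT_comp measurable_fst measurable_snd).
have p2 : measurable_fun setT (fun u : T * (S * S) => (u.1, u.2.2)).
  by apply: measurable_fun_pair => //; exact: (measurableT_comp measurable_snd measurable_snd).
have q (h : T -> S -> R) : bmeas (fun u : T * S => h u.1 u.2) ->
    bmeas (fun u : T * (S * S) => h u.1 u.2.1 - h u.1 u.2.2).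
  by move=> bh; apply: bmeasB; [exact: (bmeas_comp bh p1)|exact: (bmeas_comp bh p2)].
by split; [apply: bmeasB|apply: bmeasD]; apply: bmeasM; exact: q.
Qed.

Let bUs w : bmeas (U w) /\ bmeas (V w).
Proof.
by case: bU => b1 b2; split; [exact: (bmeas_pair2 w b1)|exact: (bmeas_pair2 w b2)].
Qed.

Let cov_sqr w : cov_re w ^+ 2 + cov_im w ^+ 2 =
  \int[prodP (prodP mu mu) (prodP mu mu)]_q (U w q.1 * U w q.2 + V w q.1 * V w q.2) / 4.
Proof.
have [b1 b2] := bUs w.
have bp (f : S * S -> R) : bmeas f -> bmeas (fun q : (S * S) * (S * S) => f q.1 * f q.2).
  move=> bf; apply: bmeasM; first exact: (bmeas_comp bf measurable_fst).
  exact: (bmeas_comp bf measurable_snd).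
rewrite RintegralD//; [|by apply: bmeas_integrable; exact: bp..].
by rewrite !Rintegral_prodM// cov_reE cov_imE; field.
Qed.

(** U + i V is the product D of the differences of exp(i a) and of exp(i b). The left side is the
    real part of D at [q.1] times the conjugate of D at [q.2], which splits into a factor in [a] and
    a factor in [b]. *)
Let UV_re (q : (S * S) * (S * S)) w : U w q.1 * U w q.2 + V w q.1 * V w q.2 =
  phase_sum a cos q.1.1.1 q.1.2.1 q.2.1.1 q.2.2.1 w *
  phase_sum b cos q.1.1.2 q.1.2.2 q.2.1.2 q.2.2.2 w -
  phase_sum a sin q.1.1.1 q.1.2.1 q.2.1.1 q.2.2.1 w *
  phase_sum b sin q.1.1.2 q.1.2.2 q.2.1.2 q.2.2.2 w.
Proof. by rewrite /phase_sum !cosB !sinB /U /V /ca/sa/cb/sb; ring. Qed.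

Let indEF (f g : T -> R) :
  measurable_fun setT (f : g_sigma_algebraType G1 -> R) ->
  measurable_fun setT (g : g_sigma_algebraType G2 -> R) ->
  bmeas f -> bmeas g ->
  P.-integrable setT (EFin \o (fun w => f w * g w)) /\
  \int[P]_w (f w * g w) = \int[P]_w f w * \int[P]_w g w.
Proof.
move=> mf mg bf bg; apply: indep_integrableM; try exact: bmeas_integrable.
by apply: indepS ind; exact/preimage_sub_sigma.
Qed.

Let int_UV q : \int[P]_w (U w q.1 * U w q.2 + V w q.1 * V w q.2) =
  hatk k1 q.1.1.1 q.2.1.1 q.1.2.1 q.2.2.1 * hatk k2 q.1.1.2 q.2.1.2 q.1.2.2 q.2.2.2.
Proof.
under eq_Rintegral do rewrite UV_re.
have [bc bs'] := (bmeas_cosine R, bmeas_sine R).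
have iE f (bf : bmeas f) := indEF
  (phase_sum_sigma q.1.1.1 q.1.2.1 q.2.1.1 q.2.2.1 (proj1 bf) ma1)
  (phase_sum_sigma q.1.1.2 q.1.2.2 q.2.1.2 q.2.2.2 (proj1 bf) mb1)
  (bmeas_phase_sum ma _ _ _ _ bf) (bmeas_phase_sum mb _ _ _ _ bf).
have [ic Ec] := iE _ bc; have [is_ Es] := iE _ bs'.
rewrite RintegralB// Ec Es (Rintegral_phase_cos ma k1E) (Rintegral_phase_cos mb k2E).
(* The factor in [a] has an imaginary part of mean 0, so the product of the two imaginary parts
   disappears. *)
by rewrite (Rintegral_phase_sum P ma _ _ _ _ bs') !s1E !subr0 addr0 mul0r subr0.
Qed.

Lemma Rintegral_cov_sqr : \int[P]_w (cov_re w ^+ 2 + cov_im w ^+ 2) =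
  \int[prodP (prodP mu mu) (prodP mu mu)]_q
    (hatk k1 q.1.1.1 q.2.1.1 q.1.2.1 q.2.2.1 * hatk k2 q.1.1.2 q.2.1.2 q.1.2.2 q.2.2.2) / 4.
Proof.
pose F (u : T * ((S * S) * (S * S))) := U u.1 u.2.1 * U u.1 u.2.2 + V u.1 u.2.1 * V u.1 u.2.2.
have [bu bv] := bU.
have p1 : measurable_fun setT (fun u : T * ((S * S) * (S * S)) => (u.1, u.2.1)).
  by apply: measurable_fun_pair => //; exact: (measurableT_comp measurable_fst measurable_snd).
have p2 : measurable_fun setT (fun u : T * ((S * S) * (S * S)) => (u.1, u.2.2)).
  by apply: measurable_fun_pair => //; exact: (measurableT_comp measurable_snd measurable_snd).
have bF : bmeas F.
  apply: bmeasD; apply: bmeasM; [exact: (bmeas_comp bu p1)|exact: (bmeas_comp bu p2)|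
    exact: (bmeas_comp bv p1)|exact: (bmeas_comp bv p2)].
have iF : (prodP P (prodP (prodP mu mu) (prodP mu mu))).-integrable setT (EFin \o F).
  exact: bmeas_integrable.
under eq_Rintegral do rewrite cov_sqr.
rewrite RintegralZr//; last first.
  by have := integrable_Rintegral1 iF.
congr (_ / _).
rewrite -[LHS]/(\int[P]_w \int[prodP (prodP mu mu) (prodP mu mu)]_q F (w, q)).
rewrite (RFubini _ iF); last by case: bF.
by apply: eq_Rintegral => q _; exact: int_UV.
Qed.

End cov_identity.

(** * The Gamma integral *)

Section weights.
Context (R : realType).
Local Notation mu := (@lebesgue_measure R).

Lemma integral_expRN (u : R) : 0 <= u ->
  (\int[mu]_(v in `]0%R, u[) (expR (- v))%:E = (1 - expR (- u))%:E)%E.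
Proof.
rewrite le_eqVlt => /predU1P[<-|u0].
  by rewrite set_itvoo0 integral_set0 oppr0 expR0 subrr.
rewrite integral_itv_bndo_bndc; last first.
  by apply/measurable_EFinP/measurable_funTS/measurableT_comp.
rewrite integral_itv_obnd_cbnd; last first.
  by apply/measurable_EFinP/measurable_funTS/measurableT_comp.
have d (x : R) : is_derive x (1 : R) (fun v => - expR (- v)) (expR (- x)).
  by apply: is_derive_eq; rewrite /GRing.scale/=; ring.
have cF : continuous (fun v : R => - expR (- v)).
  by move=> x; apply/differentiable_continuous/derivable1_diffP; have [] := d x.
have cf : continuous (fun v : R => expR (- v)).
  move=> x; apply: (continuous_comp (f := -%R)); first exact: opp_continuous.
  exact: continuous_expR.
rewrite (@continuous_FTC2 _ _ (fun v => - expR (- v)))//.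
- by rewrite oppr0 expR0 -EFinB; congr EFin; ring.
- exact: continuous_subspaceT.
- split; [by move=> x _; have [] := d x| |].
    by apply: cvg_at_right_filter; exact: cF.
  by apply: cvg_at_left_filter; exact: cF.
- by move=> x _; rewrite derive1E; exact: (@derive_val _ _ _ _ _ _ _ (d x)).
Qed.

Lemma powRN_cvgy (b : R) : 0 < b -> (x `^ (- b) @[x --> +oo%R] --> (0 : R)).
Proof.
move=> b0; apply: (@cvg_trans _ ((expR (- (b * ln x))) @[x --> +oo%R])).
  apply: near_eq_cvg; near=> x; rewrite /powR gt_eqF ?mulNr//.
apply: (@cvg_comp _ _ _ (fun x => b * ln x) (fun y => expR (- y)) _ (+oo%R)); last exact: cvgr_expR.
apply: gt0_cvgMry => //; apply/cvgryPge => A; near=> x.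
have Ax : expR A <= x by near: x; apply: nbhs_pinfty_ge; rewrite num_real.
by rewrite -[leLHS]expRK ler_ln ?posrE ?expR_gt0// (lt_le_trans (expR_gt0 A)).
Unshelve. all: by end_near. Qed.

Lemma integral_powRN (a b : R) : 0 < a -> 0 < b ->
  (\int[mu]_(r in `]a, +oo[) (r `^ (- (b + 1)))%:E = (a `^ (- b) / b)%:E)%E.
Proof.
move=> a0 b0.
rewrite integral_itv_obnd_cbnd; last first.
  by apply/measurable_EFinP/measurable_funTS; exact: measurable_powR.
have d (x : R) : 0 < x -> is_derive x (1 : R) (fun r => - b^-1 * r `^ (- b)) (x `^ (- (b + 1))).
  move=> x0; have dp := is_derive1_powR (- b) x0.
  apply: is_derive_eq; rewrite /GRing.scale/=.
  rewrite (_ : - b - 1 = - (b + 1)); last by ring.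
  by field; rewrite gt_eqF.
have d' (x : R) : 0 < x -> is_derive x (1 : R) (fun r : R => r `^ (- (b + 1))) (- (b + 1) * x `^ (- (b + 1) - 1)).
  by move=> x0; exact: is_derive1_powR.
have cF (x : R) : 0 < x -> {for x, continuous (fun r => - b^-1 * r `^ (- b))}.
  by move=> x0; apply/differentiable_continuous/derivable1_diffP; have [] := d x x0.
have cf (x : R) : 0 < x -> {for x, continuous (fun r : R => r `^ (- (b + 1)))}.
  by move=> x0; apply/differentiable_continuous/derivable1_diffP; have [] := d' x x0.
rewrite (@ge0_continuous_FTC2y _ _ (fun r => - b^-1 * r `^ (- b)) a 0).
- by rewrite -EFinB; congr EFin; rewrite sub0r mulNr opprK mulrC.
- by move=> x _; exact: powR_ge0.
- apply: continuous_in_subspaceT => x; rewrite inE/= in_itv/= andbT => ax.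
  by apply: cf; exact: lt_le_trans ax.
- rewrite -[X in _ --> X](mulr0 (- b^-1)); apply: cvgM; first exact: cvg_cst.
  exact: powRN_cvgy.
- by move=> x ax; have [] := d x (lt_trans a0 ax).
- by apply: cvg_at_right_filter; exact: cF.
- move=> x; rewrite in_itv/= andbT => ax.
  by rewrite derive1E; exact: (@derive_val _ _ _ _ _ _ _ (d x (lt_trans a0 ax))).
Qed.

Lemma integral_powR01 (b : R) : 0 < b < 1 ->
  (\int[mu]_(v in `]0%R, 1%R]) (v `^ (- b))%:E < +oo)%E.
Proof.
move=> /andP[b0 b1]; have b1' : 0 < 1 - b by rewrite subr_gt0.
(* The integrand is singular at 0, so the fundamental theorem is applied on [1/(n+1), 1], with a
   bound uniform in n. *)
pose F (n : nat) := [set` `[(n.+1%:R^-1 : R), 1%R]].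
have FU : \bigcup_n F n = [set` `]0%R, 1%R]] :> set R.
  apply/seteqP; split=> x.
    move=> [n _]; rewrite /F/= !in_itv/= => /andP[h ->]; rewrite andbT.
    by apply: lt_le_trans h; rewrite invr_gt0.
  rewrite /= in_itv/= => /andP[x0 x1].
  have [n nx] := ltr_add_invr x0; exists n => //; rewrite /F/= in_itv/= x1 andbT ltW//.
  by rewrite add0r in nx.
have Fpos n x : F n x -> 0 < x.
  by rewrite /F/= in_itv/= => /andP[+ _]; apply: lt_le_trans; rewrite invr_gt0.
have H := @ge0_nondecreasing_set_cvg_integral _ (measurableTypeR R) R F
  (fun v : R => (v `^ (- b))%:E) mu.
rewrite -FU.
apply: (@le_lt_trans _ _ ((1 - b)^-1%:E)%E); last by rewrite ltry.
have cv : (\int[mu]_(x in F i) (x `^ (- b))%:E @[i --> \oo] -->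
    \int[mu]_(x in \bigcup_i F i) (x `^ (- b))%:E)%E.
  apply: H.
  - apply/nondecreasing_seqP => n; apply/subsetPset => x; rewrite /F/= !in_itv/=.
    move=> /andP[h ->]; rewrite andbT (le_trans _ h)// lef_pV2 ?posrE ?ltr0n//.
    by rewrite ler_nat.
  - by move=> n; exact: measurable_itv.
  - by move=> n; apply/measurable_EFinP/measurable_funTS; exact: measurable_powR.
  - by move=> n x _; rewrite lee_fin powR_ge0.
rewrite -(cvg_lim (@ereal_hausdorff R) cv); apply: lime_le.
  by apply/cvg_ex; eexists; exact: cv.
apply: nearW => n.
have [->|n0] := eqVneq n 0%N.
  by rewrite /F invr1 set_itv1 integral_set1 lee_fin invr_ge0 ltW.
have d (x : R) : 0 < x -> is_derive x (1 : R) (fun r => (1 - b)^-1 * r `^ (1 - b)) (x `^ (- b)).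
  move=> x0; have dp := is_derive1_powR (1 - b) x0.
  apply: is_derive_eq; rewrite /GRing.scale/=.
  rewrite (_ : 1 - b - 1 = - b); last by ring.
  by field; rewrite gt_eqF.
have d' (x : R) : 0 < x -> is_derive x (1 : R) (fun r : R => r `^ (- b)) (- b * x `^ (- b - 1)).
  by move=> x0; exact: is_derive1_powR.
have cF (x : R) : 0 < x -> {for x, continuous (fun r => (1 - b)^-1 * r `^ (1 - b))}.
  by move=> x0; apply/differentiable_continuous/derivable1_diffP; have [] := d x x0.
have cf (x : R) : 0 < x -> {for x, continuous (fun r : R => r `^ (- b))}.
  by move=> x0; apply/differentiable_continuous/derivable1_diffP; have [] := d' x x0.
have n1 : n.+1%:R^-1 < 1 :> R by rewrite invf_lt1 ?ltr0n// ltr1n ltnS lt0n.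
rewrite (@continuous_FTC2 _ _ (fun r => (1 - b)^-1 * r `^ (1 - b)))//.
- rewrite -EFinB lee_fin powR1 mulr1 gerBl mulr_ge0 ?powR_ge0// invr_ge0 ltW//.
- apply: continuous_in_subspaceT => x; rewrite inE => xF; apply: cf; exact: Fpos xF.
- split.
  + move=> x; rewrite in_itv/= => /andP[nx _]; have [] // := d x.
    by apply: lt_trans nx; rewrite invr_gt0.
  + by apply: cvg_at_right_filter; apply: cF; rewrite invr_gt0.
  + by apply: cvg_at_left_filter; exact: cF.
- move=> x; rewrite in_itv/= => /andP[nx _].
  have x0 : 0 < x by apply: lt_trans nx; rewrite invr_gt0.
  by rewrite derive1E; exact: (@derive_val _ _ _ _ _ _ _ (d x x0)).
Qed.

Definition gamma_integrand (b v : R) : R := v `^ (- b) * expR (- v).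

Lemma measurable_gamma_integrand b : measurable_fun setT (gamma_integrand b).
Proof.
apply: measurable_funM; first exact: measurable_powR.
by apply: measurableT_comp.
Qed.

Lemma gamma_integral_fin (b : R) : 0 < b < 1 ->
  (\int[mu]_(v in `]0%R, +oo[) (gamma_integrand b v)%:E < +oo)%E.
Proof.
move=> hb; have /andP[b0 b1] := hb.
have g0 v : 0 <= gamma_integrand b v by rewrite mulr_ge0 ?powR_ge0 ?expR_ge0.
have splitE : [set` `]0%R, +oo[] = [set` `]0%R, 1%R]] `|` [set` `]1%R, +oo[] :> set R.
  apply/seteqP; split=> x; rewrite /= !in_itv/= !andbT.
    by move=> x0; case: (leP x 1) => h; [left; rewrite x0|right].
  by move=> [/andP[]//|]; apply: lt_trans.
rewrite splitE.
rewrite ge0_integral_setU//=; last 3 first.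
- by apply/measurable_EFinP/measurable_funTS; exact: measurable_gamma_integrand.
- by move=> x _; rewrite lee_fin g0.
- apply/disj_setPS => x []/=; rewrite !in_itv/= andbT => /andP[_ x1].
  by rewrite ltNge x1.
rewrite lte_add_pinfty//.
  apply: le_lt_trans (integral_powR01 hb); apply: ge0_le_integral => //.
  - by move=> x _; rewrite lee_fin g0.
  - by apply/measurable_EFinP/measurable_funTS; exact: measurable_gamma_integrand.
  - by apply/measurable_EFinP/measurable_funTS; exact: measurable_powR.
  - move=> x; rewrite /= in_itv/= => /andP[x0 _]; rewrite lee_fin ler_piMr ?powR_ge0//.
    by rewrite -expR0 ler_expR oppr_le0 ltW.
have I2 : (\int[mu]_(r in `]1%R, +oo[) (r `^ (- (1 + 1)))%:E < +oo)%E.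
  by rewrite integral_powRN// ltry.
(* From 1 + x^2 / 2 <= exp x follows exp (-x) <= 2 x^(-2), which is integrable at infinity; beyond 1
   the power in the integrand is at most 1. *)
have I3 : (\int[mu]_(r in `]1%R, +oo[) (2 * r `^ (- (1 + 1)))%:E < +oo)%E.
  under eq_integral do rewrite EFinM.
  rewrite ge0_integralZl//.
  - by rewrite integral_powRN// -EFinM ltry.
  - by apply/measurable_EFinP/measurable_funTS; exact: measurable_powR.
  - by move=> x _; rewrite lee_fin powR_ge0.
apply: le_lt_trans I3; apply: ge0_le_integral => //.
- by move=> x _; rewrite lee_fin g0.
- apply/measurable_EFinP/measurable_funTS; exact: measurable_gamma_integrand.
- by apply/measurable_EFinP/measurable_funTS/measurable_funM => //; exact: measurable_powR.
- move=> x; rewrite /= in_itv/= andbT => x1; rewrite lee_fin.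
  have x0 : 0 < x by exact: lt_trans x1.
  have e1 : x `^ (- b) <= 1.
    rewrite powRN invf_le1 ?powR_gt0// -[leLHS](powRr0 x) ler_powR// ltW//.
  apply: (@le_trans _ _ (expR (- x))); first by rewrite ler_piMl ?expR_ge0.
  rewrite powRN expRN (_ : 1 + 1 = 2%:R)// powR_mulrn; last exact: ltW.
  rewrite -[leLHS]mul1r ler_pdivrMr ?expR_gt0// mulrAC ler_pdivlMr ?exprn_gt0// mul1r.
  have := expR_ge1Dxn 1 (ltW x0); rewrite (_ : 2`! = 2)%N//; lra.
Qed.

End weights.

Section lebesgue_tools.
Context (R : realType).
Local Notation mu := (@lebesgue_measure R).
Local Notation RR := (measurableTypeR R).

(** Lebesgue measure lives on [measurableTypeR R], whose measurable structure
    is only convertible to the canonical one of [R]. *)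
Lemma ge0_integral_lebesgueM (k : R) (g : RR -> R) : 0 <= k -> measurable_fun setT g ->
  (forall x, 0 <= g x) ->
  (\int[mu]_x (k * g x)%:E = k%:E * \int[mu]_x (g x)%:E)%E.
Proof.
move=> k0 mg g0; under eq_integral do rewrite EFinM.
rewrite ge0_integralZl; [by []|exact: measurableT|exact/measurable_EFinP| |by rewrite lee_fin].
by move=> x _; rewrite lee_fin.
Qed.

Lemma measurable_indic_itv (i : interval R) :
  measurable_fun setT (\1_([set` i] : set R) : RR -> R).
Proof. by apply: measurable_indic; exact: measurable_itv. Qed.

Lemma indic_ge0 (i : set R) (x : R) : 0 <= \1_i x :> R.
Proof. by rewrite indicE. Qed.

Lemma indic_in (A : set R) (x : R) : A x -> \1_A x = 1 :> R.
Proof. by move=> h; rewrite indicE mem_set. Qed.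

Lemma indic_out (A : set R) (x : R) : ~ A x -> \1_A x = 0 :> R.
Proof. by move=> h; rewrite indicE memNset. Qed.

Lemma half_sqr_ge0 (r t : R) : 0 <= r ^+ 2 * t ^+ 2 / 2.
Proof. by have := sqr_ge0 (r * t); rewrite exprMn; lra. Qed.

Lemma sqrt_div_sqr (t v : R) : 0 < t -> 0 < v ->
  0 < Num.sqrt (2 * v) / t /\ (Num.sqrt (2 * v) / t) ^+ 2 * t ^+ 2 = 2 * v.
Proof.
move=> t0 v0; split; first by rewrite divr_gt0// sqrtr_gt0 mulr_gt0.
rewrite expr_div_n sqr_sqrtr; last by rewrite mulr_ge0// ltW.
by rewrite divfK// gt_eqF// exprn_gt0.
Qed.

(** Describes the region v < r^2 t^2 / 2 as a half-line in [r], for exchanging the order of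
    integration. *)
Lemma lt_sqrt_div (t v r : R) : 0 < t -> 0 < v ->
  (0 < r) && (v < r ^+ 2 * t ^+ 2 / 2) = (Num.sqrt (2 * v) / t < r).
Proof.
move=> t0 v0; have [] := sqrt_div_sqr t0 v0; set a := _ / t => apos aE.
apply/andP/idP => [[r0 vr]|ar].
  rewrite -(ltr_pXn2r (n := 2))// ?nnegrE ?ltW// -(ltr_pM2r (x := t ^+ 2)) ?exprn_gt0//.
  by rewrite aE; move: vr; rewrite ltr_pdivlMr// mulrC.
have r0 : 0 < r by exact: lt_trans ar.
split => //; rewrite ltr_pdivlMr// (mulrC v) -aE.
by rewrite ltr_pM2r ?exprn_gt0// ltr_pXn2r// ?nnegrE ltW.
Qed.

Lemma powRN_sqrt_div (t v b : R) : 0 < t -> 0 < v ->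
  (Num.sqrt (2 * v) / t) `^ (- b) = 2 `^ (- (b / 2)) * v `^ (- (b / 2)) * t `^ b.
Proof.
move=> t0 v0; have [t0' v0'] := (ltW t0, ltW v0).
rewrite powRM ?sqrtr_ge0 ?invr_ge0//.
rewrite -powR12_sqrt ?mulr_ge0// -powRrM.
rewrite -(powR_inv1 t0') -powRrM mulN1r opprK.
rewrite (_ : 2^-1 * - b = - (b / 2)); last by field.
by rewrite powRM.
Qed.

End lebesgue_tools.

Section weight_identity.
Context (R : realType) (alpha : R).
Hypothesis halpha : 0 < alpha < 2.
Local Notation mu := (@lebesgue_measure R).
Local Notation RR := (measurableTypeR R).

Let a0 : 0 < alpha. Proof. by case/andP: halpha. Qed.

Let h01 : 0 < alpha / 2 < 1.
Proof. by apply/andP; split; [rewrite divr_gt0|rewrite ltr_pdivrMr// mul1r; case/andP: halpha]. Qed.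

(** With the indicator inside, integrals over the half-line become integrals over R, to which
    Fubini's theorem applies directly. *)
Definition weight (r : R) : R := r `^ (- (alpha + 1)) * \1_([set` `]0, +oo[] : set R) r.

Lemma weight_ge0 r : 0 <= weight r.
Proof. by rewrite /weight indicE mulr_ge0// powR_ge0. Qed.

Lemma weightE (r : R) : 0 < r -> weight r = (r `^ (alpha + 1))^-1.
Proof. by move=> r0; rewrite /weight indicE mem_set ?mulr1 ?powRN//= in_itv/= r0. Qed.

Lemma measurable_weight : measurable_fun setT (weight : RR -> R).
Proof.
apply: measurable_funM; first exact: measurable_powR.
by apply: measurable_indic; exact: measurable_itv.
Qed.

Local Notation gamma_int := (\int[mu]_(v in `]0%R, +oo[) (gamma_integrand (alpha / 2) v)%:E)%E.

Lemma gamma_intE : gamma_int = (Gamma (1 - alpha / 2))%:E.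
Proof.
rewrite /Gamma /Rintegral -[LHS]fineK; last first.
  by rewrite ge0_fin_numE ?gamma_integral_fin//; apply: integral_ge0 => v _;
    rewrite lee_fin mulr_ge0 ?powR_ge0 ?expR_ge0.
congr (fine _)%:E; apply: eq_integral => v _.
by rewrite /gamma_integrand (_ : 1 - alpha / 2 - 1 = - (alpha / 2))//; ring.
Qed.

(** Write 1 - exp (-u) as the integral of exp (-v) over 0 < v < u and apply Tonelli's theorem: the
    integral in [r] is then that of a power over a half-line, and what remains in [v] is the Gamma
    integral. *)
Lemma weight_integral (t : R) : 0 < t ->
  (\int[mu]_r ((1 - expR (- (r ^+ 2 * t ^+ 2 / 2))) * weight r)%:E =
   (t `^ alpha * (2 `^ (- (alpha / 2)) / alpha) * Gamma (1 - alpha / 2))%:E)%E.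
Proof.
move=> t0.
pose A := [set z : RR * RR | (z.2 : R) < z.1 ^+ 2 * t ^+ 2 / 2].
have m1 : measurable_fun setT (fun z : RR * RR => (z.1 : R)) by exact: measurable_fst.
have m2 : measurable_fun setT (fun z : RR * RR => (z.2 : R)) by exact: measurable_snd.
have mA : measurable A.
  rewrite -[X in measurable X]setTI; apply: measurable_fun_ltr => //.
  by apply: measurable_funM => //; apply: measurable_funM => //; exact: measurable_funX.
pose pos : set RR := [set` `]0%R, +oo[].
have mpos : measurable pos by exact: measurable_itv.
pose f (z : RR * RR) : \bar R := (weight z.1 * (expR (- z.2) * \1_pos z.2 * \1_A z))%:E.
have mf : measurable_fun setT f.
  apply/measurable_EFinP; apply: measurable_funM.
    exact: (measurableT_comp measurable_weight m1).
  apply: measurable_funM => //; apply: measurable_funM.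
    by apply: measurableT_comp => //; exact: measurableT_comp.
  have mi : measurable_fun setT (\1_pos : RR -> R) by exact: measurable_indic.
  exact: (measurableT_comp mi (@measurable_snd _ _ RR RR)).
have f0 z : (0 <= f z)%E.
  by rewrite lee_fin !mulr_ge0 ?powR_ge0 ?expR_ge0.
have FT := @fubini_tonelli _ _ RR RR R mu mu f mf f0.
clear f0.
transitivity (\int[mu]_r \int[mu]_v f (r, v))%E.
  apply: eq_integral => r _.
  transitivity (\int[mu]_v (weight r * (expR (- v) *
      \1_([set` `]0%R, (r ^+ 2 * t ^+ 2 / 2)%R[] : set R) v))%:E)%E; last first.
    apply: eq_integral => v _; rewrite /f -[_ * _ * \1_A _]mulrA.
    congr (_ * (_ * _))%:E.
    rewrite !indicE -natrM mulnb; congr (_%:R); congr nat_of_bool; apply/idP/andP.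
      move=> /set_mem; rewrite /= in_itv/= => /andP[v0 vu].
      by split; apply/mem_set; [rewrite /pos/= in_itv/= v0|exact: vu].
    move=> [/set_mem h1 /set_mem h2]; apply/mem_set.
    by move: h1 h2; rewrite /pos/A/= !in_itv/= andbT => -> ->.
  rewrite ge0_integral_lebesgueM.
  - rewrite -integral_EFin_indic integral_expRN; last exact: half_sqr_ge0.
    by rewrite -EFinM mulrC.
  - exact: weight_ge0.
  - apply: measurable_funM; last exact: measurable_indic_itv.
    by apply: measurableT_comp.
  - by move=> v; rewrite mulr_ge0 ?expR_ge0 ?indic_ge0.
rewrite FT {FT mf m1 m2 mA}.
transitivity (\int[mu]_v (t `^ alpha * (2 `^ (- (alpha / 2)) / alpha) *
    (gamma_integrand (alpha / 2) v * \1_(pos : set R) v))%:E)%E; last first.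
  rewrite ge0_integral_lebesgueM.
  - by rewrite -integral_EFin_indic gamma_intE -EFinM.
  - apply: mulr_ge0; first exact: powR_ge0.
    by apply: divr_ge0; [exact: powR_ge0|exact: ltW].
  - apply: measurable_funM; first exact: measurable_gamma_integrand.
    exact: measurable_indic_itv.
  - by move=> v; rewrite !mulr_ge0 ?powR_ge0 ?expR_ge0 ?indic_ge0.
apply: eq_integral => v _.
have [pv|npv] := asboolP (pos v); last first.
  rewrite (indic_out npv) !mulr0.
  by apply: integral0_eq => r _; rewrite /f/= (indic_out npv) mulr0 mul0r mulr0.
have v0 : 0 < v by move: pv; rewrite /pos/= in_itv/= andbT.
have [] := sqrt_div_sqr t0 v0; set a := Num.sqrt (2 * v) / t => apos aE.
transitivity (\int[mu]_r (expR (- v) *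
    (r `^ (- (alpha + 1)) * \1_([set` `]a, +oo[] : set R) r))%:E)%E.
  apply: eq_integral => r _; rewrite /f/= (indic_in pv) mulr1 /weight.
  rewrite mulrCA; congr (_ * _)%:E; rewrite -mulrA; congr (_ * _).
  rewrite !indicE -natrM mulnb; congr (_%:R); congr nat_of_bool.
  have := lt_sqrt_div r t0 v0; rewrite -/a => E.
  apply/andP/idP => [[/set_mem hr /set_mem hA]|/set_mem ha].
    apply/mem_set; move: hr hA; rewrite /A/= !in_itv/= !andbT => hr hA.
    by rewrite -E hr hA.
  move: ha; rewrite /= in_itv/= andbT -E => /andP[hr hA].
  by split; apply/mem_set; [rewrite /= in_itv/= hr|exact: hA].
rewrite ge0_integral_lebesgueM; first last.
- by move=> r; rewrite mulr_ge0 ?powR_ge0 ?indic_ge0.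
- apply: measurable_funM; first exact: measurable_powR.
  exact: measurable_indic_itv.
- exact: expR_ge0.
rewrite -integral_EFin_indic (integral_powRN apos a0) -!EFinM; congr EFin.
rewrite (indic_in pv) mulr1 /gamma_integrand /a.
rewrite (powRN_sqrt_div _ t0 v0); field; exact: lt0r_neq0.
Qed.

(** If the real integral were 0, so would be the extended one by [gamma_intE], but on [1, 2] the
    integrand is bounded below by a positive constant. *)
Lemma Gamma_gt0 : 0 < Gamma (1 - alpha / 2).
Proof.
have g0 : 0 <= Gamma (1 - alpha / 2).
  by apply: Rintegral_ge0 => v _; rewrite mulr_ge0 ?powR_ge0 ?expR_ge0.
rewrite lt_neqAle g0 andbT eq_sym; apply/eqP => G0.
have := gamma_intE; rewrite G0 => I0.
have m D : measurable_fun D (fun v : RR => (gamma_integrand (alpha / 2) v)%:E).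
  by apply/measurable_EFinP/measurable_funTS; exact: measurable_gamma_integrand.
have : (\int[mu]_(v in `[1%R, 2%R]) (expR (- 2) * 2 `^ (- (alpha / 2)))%:E <= gamma_int)%E.
  apply: (@le_trans _ _ (\int[mu]_(v in `[1%R, 2%R]) (gamma_integrand (alpha / 2) v)%:E)%E).
    apply: ge0_le_integral => //.
    - move=> v; rewrite /= in_itv/= => /andP[v1 v2]; rewrite lee_fin mulrC.
      have v0 : 0 < v by exact: lt_le_trans v1.
      apply: ler_pM; rewrite ?powR_ge0 ?expR_ge0//; last by rewrite ler_expR lerN2.
      rewrite !powRN lef_pV2 ?posrE ?powR_gt0//.
      apply: ge0_ler_powR; rewrite ?nnegrE ?(ltW v0)//.
      by apply: ltW; case/andP: h01.
  apply: ge0_subset_integral => //.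
    by move=> v _; rewrite lee_fin mulr_ge0 ?powR_ge0 ?expR_ge0.
  by move=> v /=; rewrite !in_itv/= andbT => /andP[v1 _]; exact: lt_le_trans v1.
rewrite I0 integral_cst//= lebesgue_measure_itv/= lte_fin ltr1n/= -EFinB -EFinM lee_fin.
have e2 : 0 < expR (- 2) * 2 `^ (- (alpha / 2)) :> R by rewrite mulr_gt0 ?expR_gt0 ?powR_gt0.
lra.
Qed.

Lemma c_const_gt0 : 0 < c_const alpha.
Proof. by rewrite /c_const divr_gt0 ?Gamma_gt0// mulr_gt0// powR_gt0. Qed.

(** [c_const] is by design the inverse of the constant in [weight_integral]. At [t = 0] both sides
    vanish, the power because alpha > 0. *)
Lemma weight_integral_c (t : R) : 0 <= t ->
  (\int[mu]_r ((1 - expR (- (r ^+ 2 * t ^+ 2 / 2))) * weight r)%:E =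
   (t `^ alpha / c_const alpha)%:E)%E.
Proof.
rewrite le_eqVlt => /predU1P[<-|t0]; last first.
  rewrite weight_integral//; congr EFin; rewrite /c_const powRN.
  field; rewrite !gt_eqF ?Gamma_gt0 ?powR_gt0//.
rewrite powR0 ?gt_eqF// mul0r; apply: integral0_eq => r _.
by rewrite expr0n mulr0 mul0r oppr0 expR0 subrr mul0r.
Qed.

End weight_identity.

(** * Gaussian and power kernels *)

Section kernel_side.
Context (R : realType) (alpha : R) (H : completeNormedModType R).
Hypothesis halpha : 0 < alpha < 2.
Local Notation mu := (@lebesgue_measure R).
Local Notation RR := (measurableTypeR R).
Local Notation c := (c_const alpha).

Definition kern (r : R) (x y : H) : R := expR (- (r ^+ 2 * `|x - y| ^+ 2 / 2)).
Definition dist_pow (x y : H) : R := `|x - y| `^ alpha.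
(** The square root of |x|^alpha: the moment assumption says exactly that it is square
    integrable. *)
Definition half_pow (x : H) : R := `|x| `^ (alpha / 2).

(** Supplied later by [gaussian_kern_bound]; as a hypothesis it keeps the kernel estimates apart
    from the Gaussian family. *)
Hypothesis kern_bound : forall r (x0 x1 x2 x3 : H) l, 0 < l ->
  `|hatk (kern r) x0 x1 x2 x3| <= l * (1 - kern r x0 x2) + l^-1 * (1 - kern r x1 x3).

Lemma kern_le1 r x y : 0 <= 1 - kern r x y.
Proof.
rewrite subr_ge0 /kern -[leRHS]expR0 ler_expR oppr_le0; exact: half_sqr_ge0.
Qed.

Lemma kernC r x y : kern r x y = kern r y x.
Proof. by rewrite /kern distrC. Qed.

Lemma hatk_kern_bounded r x0 x1 x2 x3 : `|hatk (kern r) x0 x1 x2 x3| <= 4.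
Proof.
have k0 x y : 0 <= kern r x y by exact: expR_ge0.
have := kern_le1 r x0 x1; have := kern_le1 r x1 x2; have := kern_le1 r x2 x3.
have := kern_le1 r x3 x0; have := k0 x0 x1; have := k0 x1 x2; have := k0 x2 x3; have := k0 x3 x0.
by rewrite /hatk ler_norml => *; apply/andP; split; lra.
Qed.

Lemma measurable_kern_r x y : measurable_fun setT (fun r : RR => kern r x y).
Proof.
apply: measurableT_comp => //; apply: measurableT_comp => //.
by apply: measurable_funM => //; apply: measurable_funM.
Qed.

Lemma measurable_hatk_r x0 x1 x2 x3 :
  measurable_fun setT (fun r : RR => hatk (kern r) x0 x1 x2 x3 * weight alpha r).
Proof.
apply: measurable_funM; last exact: measurable_weight.
apply: measurable_funB; last exact: measurable_kern_r.
apply: measurable_funD; last exact: measurable_kern_r.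
by apply: measurable_funB; exact: measurable_kern_r.
Qed.

Lemma integral_kern x y :
  (\int[mu]_r ((1 - kern r x y) * weight alpha r)%:E = (dist_pow x y / c)%:E)%E.
Proof. exact: weight_integral_c. Qed.

Let measurable_kern1 x y : measurable_fun setT (fun r : RR => (1 - kern r x y) * weight alpha r).
Proof.
apply: measurable_funM; last exact: measurable_weight.
by apply: measurable_funB => //; exact: measurable_kern_r.
Qed.

Lemma integrable_kern x y :
  mu.-integrable setT (EFin \o (fun r : RR => (1 - kern r x y) * weight alpha r)).
Proof.
apply/integrableP; split; first exact/measurable_EFinP.
under eq_integral => r _.
  rewrite /= ger0_norm; last by rewrite mulr_ge0 ?kern_le1 ?weight_ge0.
  over.
by rewrite integral_kern ltry.
Qed.

(** |x - y| is at most twice the larger norm, and 2^(alpha/2) <= 2. *)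
Lemma half_powD x y : `|x - y| `^ (alpha / 2) <= 2 * (half_pow x + half_pow y).
Proof.
have a2 : 0 <= alpha / 2 by rewrite divr_ge0// ltW//; case/andP: halpha.
have a21 : alpha / 2 <= 1 by rewrite ler_pdivrMr// mul1r ltW//; case/andP: halpha.
wlog xy : x y / `|y| <= `|x|.
  move=> h; have [?|/ltW ?] := leP `|y| `|x|; first exact: h.
  by rewrite distrC (addrC (half_pow x)); exact: h.
have hy : 0 <= half_pow y by exact: powR_ge0.
apply: (@le_trans _ _ (2 * half_pow x)); last by rewrite ler_wpM2l// lerDl.
apply: (@le_trans _ _ ((2 * `|x|) `^ (alpha / 2))).
  apply: ge0_ler_powR => //; rewrite ?nnegrE ?mulr_ge0//.
  by rewrite (le_trans (ler_normB _ _))// mulr2n mulrDl mul1r lerD2l.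
rewrite powRM// ler_wpM2r ?powR_ge0//.
by rewrite -[leRHS]powRr1// ler_powR// ler1n.
Qed.

Lemma half_pow_sqr (t : R) : t `^ (alpha / 2) ^+ 2 = t `^ alpha.
Proof.
by rewrite -powR_mulrn ?powR_ge0// -powRrM divfK.
Qed.

Lemma integral_hatk_bound x0 x1 x2 x3 :
  (\int[mu]_r `|hatk (kern r) x0 x1 x2 x3 * weight alpha r|%:E <=
   (8 / c * ((half_pow x0 + half_pow x2) * (half_pow x1 + half_pow x3)))%:E)%E.
Proof.
have c0 : 0 < c by exact: c_const_gt0.
have h0 x : 0 <= half_pow x by exact: powR_ge0.
have rhs0 : 0 <= 8 / c * ((half_pow x0 + half_pow x2) * (half_pow x1 + half_pow x3)).
  by rewrite !mulr_ge0 ?addr_ge0 ?invr_ge0 ?(ltW c0).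
(* If [x0 = x2] or [x1 = x3], no admissible [l] balances the two terms, but then the hat itself is
   0. *)
have deg : (forall r, hatk (kern r) x0 x1 x2 x3 = 0) ->
    (\int[mu]_r `|hatk (kern r) x0 x1 x2 x3 * weight alpha r|%:E <=
    (8 / c * ((half_pow x0 + half_pow x2) * (half_pow x1 + half_pow x3)))%:E)%E.
  move=> h; rewrite integral0_eq ?lee_fin// => r _.
  by rewrite h mul0r normr0.
have [E02|n02] := eqVneq x0 x2.
  by apply: deg => r; rewrite /hatk -E02 (kernC _ x1 x0) (kernC _ x3 x0); ring.
have [E13|n13] := eqVneq x1 x3.
  by apply: deg => r; rewrite /hatk -E13 (kernC _ x2 x1) (kernC _ x1 x0); ring.
have p02 : 0 < `|x0 - x2| by rewrite normr_gt0 subr_eq0.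
have p13 : 0 < `|x1 - x3| by rewrite normr_gt0 subr_eq0.
pose d02 := `|x0 - x2| `^ (alpha / 2); pose d13 := `|x1 - x3| `^ (alpha / 2).
have d02p : 0 < d02 by exact: powR_gt0.
have d13p : 0 < d13 by exact: powR_gt0.
(* This [l] makes the integrals of the two terms of [kern_bound] equal. *)
pose l := d13 / d02; have l0 : 0 < l by exact: divr_gt0.
have li0 : 0 < l^-1 by rewrite invr_gt0.
apply: (@le_trans _ _ (\int[mu]_r (l * ((1 - kern r x0 x2) * weight alpha r) +
    l^-1 * ((1 - kern r x1 x3) * weight alpha r))%:E)%E).
  apply: ge0_le_integral => //.
  - by apply/measurable_EFinP/measurableT_comp => //; exact: measurable_hatk_r.
  - by apply/measurable_EFinP/measurable_funD; apply: measurable_funM.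
  - move=> r _; rewrite lee_fin normrM (ger0_norm (weight_ge0 _ _)) (mulrA l) (mulrA l^-1) -mulrDl.
    by apply: ler_wpM2r; [exact: weight_ge0|exact: kern_bound].
have k0 x y (r : RR) : 0 <= (1 - kern r x y) * weight alpha r.
  by rewrite mulr_ge0 ?kern_le1 ?weight_ge0.
under eq_integral do rewrite EFinD.
rewrite ge0_integralD//; first last.
- by apply/measurable_EFinP/measurable_funM.
- by move=> r _; rewrite lee_fin mulr_ge0 ?k0 ?(ltW li0).
- by apply/measurable_EFinP/measurable_funM.
- by move=> r _; rewrite lee_fin mulr_ge0 ?k0 ?(ltW l0).
rewrite !ge0_integral_lebesgueM ?(ltW l0) ?(ltW li0)//.
rewrite !integral_kern -!EFinM -EFinD lee_fin.
have E : l * (dist_pow x0 x2 / c) + l^-1 * (dist_pow x1 x3 / c) = 2 / c * (d02 * d13).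
  rewrite /dist_pow -!half_pow_sqr// -/d02 -/d13 /l.
  by field; rewrite !gt_eqF.
(* The 2 counts the two balanced terms, and the 4 comes from [half_powD] applied to both
   distances. *)
rewrite E (_ : 8 / c = 2 / c * 4); last by field; rewrite gt_eqF.
have c2 : 0 <= 2 / c by apply: divr_ge0 => //; exact: ltW.
rewrite -[leRHS]mulrA; apply: ler_wpM2l => //.
rewrite (_ : 4 * _ = (2 * (half_pow x0 + half_pow x2)) * (2 * (half_pow x1 + half_pow x3))); last by ring.
by apply: ler_pM; rewrite ?powR_ge0//; exact: half_powD.
Qed.

Lemma integrable_hatk x0 x1 x2 x3 :
  mu.-integrable setT (EFin \o (fun r : RR => hatk (kern r) x0 x1 x2 x3 * weight alpha r)).
Proof.
apply/integrableP; split; first by apply/measurable_EFinP; exact: measurable_hatk_r.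
exact: le_lt_trans (integral_hatk_bound x0 x1 x2 x3) (ltry _).
Qed.

Lemma Rintegral_hatk x0 x1 x2 x3 :
  \int[mu]_r (hatk (kern r) x0 x1 x2 x3 * weight alpha r) =
  - (hatk dist_pow x0 x1 x2 x3 / c).
Proof.
have E x y : \int[mu]_r ((1 - kern r x y) * weight alpha r) = dist_pow x y / c.
  by rewrite /Rintegral integral_kern.
pose f x y (r : RR) := (1 - kern r x y) * weight alpha r.
have iB x y z t : mu.-integrable setT (EFin \o (fun r => f x y r - f z t r)).
  by have := integrableB measurableT (integrable_kern x y) (integrable_kern z t); apply: eq_integrable.
(* Constants cancel in the hat, so it can be regrouped into terms [1 - kern], which are integrable
   against the weight, unlike [kern] alone. *)
transitivity (\int[mu]_r ((f x1 x2 r - f x0 x1 r) + (f x3 x0 r - f x2 x3 r))).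
  by apply: eq_Rintegral => r _; rewrite /f /hatk; ring.
rewrite RintegralD//; [|exact: iB..].
rewrite !RintegralB//; try exact: integrable_kern.
by rewrite !E /hatk; ring.
Qed.

(** The power kernel inherits the bound of the Gaussian kernels through [Rintegral_hatk], where the
    factor [c] cancels. It makes the hat of |x - y|^alpha square integrable over independent
    copies. *)
Lemma hatk_dist_bound x0 x1 x2 x3 : `|hatk dist_pow x0 x1 x2 x3| <=
  8 * ((half_pow x0 + half_pow x2) * (half_pow x1 + half_pow x3)).
Proof.
have c0 : 0 < c by exact: c_const_gt0.
have -> : hatk dist_pow x0 x1 x2 x3 =
    - (c * \int[mu]_r (hatk (kern r) x0 x1 x2 x3 * weight alpha r)).
  by rewrite Rintegral_hatk; field; rewrite gt_eqF.
rewrite normrN normrM (gtr0_norm c0) mulrC -ler_pdivlMr//.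
rewrite mulrAC -lee_fin; apply: le_trans (integral_hatk_bound x0 x1 x2 x3).
rewrite EFin_normr_Rintegral//; last exact: integrable_hatk.
by apply: le_abse_integral => //; apply/measurable_EFinP; exact: measurable_hatk_r.
Qed.

End kernel_side.

(** * Square integrable functions *)

Section square_integrable.
Context d (T : measurableType d) (R : realType) (P : probability T R).

Definition sqint (f : T -> R) :=
  measurable_fun setT f /\ P.-integrable setT (EFin \o (fun x => f x ^+ 2)).

Lemma sqint_le (f g : T -> R) : measurable_fun setT f ->
  (forall x, `|f x| <= g x) -> sqint g -> sqint f.
Proof.
move=> mf fg [mg ig]; split => //; apply: (le_integrable measurableT _ _ ig).
  by apply/measurable_EFinP; exact: measurable_funX.
move=> x _; rewrite /= lee_fin !normrX ler_sqr ?nnegrE//.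
exact: le_trans (fg x) (ler_norm _).
Qed.

Lemma sqint_cst c : sqint (cst c).
Proof. by split => //; exact: (bmeas_integrable P (bmeas_cst _ (c ^+ 2))). Qed.

Lemma sqintD (f g : T -> R) : sqint f -> sqint g -> sqint (fun x => f x + g x).
Proof.
move=> [mf if2] [mg ig2]; have mfg : measurable_fun setT (fun x => f x + g x).
  exact: measurable_funD.
split => //; have i2 := integrableD measurableT if2 ig2.
have i4 := integrableD measurableT i2 i2.
apply: (le_integrable measurableT _ _ i4).
  by apply/measurable_EFinP; exact: measurable_funX.
move=> x _; rewrite /= lee_fin !ger0_norm ?addr_ge0 ?sqr_ge0//.
by have := sqr_ge0 (f x - g x); rewrite !expr2 => ?; lra.
Qed.

Lemma sqint_integrableM (f g : T -> R) : sqint f -> sqint g ->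
  P.-integrable setT (EFin \o (fun x => f x * g x)).
Proof.
move=> [mf if2] [mg ig2]; apply: (le_integrable measurableT _ _ (integrableD measurableT if2 ig2)).
  by apply/measurable_EFinP; exact: measurable_funM.
move=> x _; rewrite /= lee_fin [leRHS]ger0_norm ?addr_ge0 ?sqr_ge0// normrM.
rewrite -(real_normK (num_real (f x))) -(real_normK (num_real (g x))).
have := sqr_ge0 (`|f x| - `|g x|); have := mulr_ge0 (normr_ge0 (f x)) (normr_ge0 (g x)).
by rewrite !expr2 => ? ?; lra.
Qed.

Lemma sqint_integrable (f : T -> R) : sqint f -> P.-integrable setT (EFin \o f).
Proof.
move=> if2; have := sqint_integrableM if2 (sqint_cst 1).
by apply: eq_integrable => // x _ /=; rewrite mulr1.
Qed.

Lemma sqintZ c (f : T -> R) : sqint f -> sqint (fun x => c * f x).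
Proof.
move=> [mf if2]; split; first exact: measurable_funM.
have := integrableZl measurableT (c ^+ 2) if2.
by apply: eq_integrable => // x _ /=; rewrite exprMn EFinM.
Qed.

End square_integrable.

Lemma sqint_law d d' (T : measurableType d) (S : measurableType d') (R : realType)
    (P : probability T R) (f : T -> S) (mf : measurable_fun setT f) (g : S -> R) :
  measurable_fun setT g -> sqint (law P mf) g <-> sqint P (g \o f).
Proof.
move=> mg; have mg2 : measurable_fun setT (fun x => g x ^+ 2) by exact: measurable_funX.
split=> -[_ i2]; split => //; first exact: measurableT_comp.
  exact/(law_integrable P mf mg2).
exact/(law_integrable P mf mg2).
Qed.

Section square_integrable_prod.
Context d1 d2 (T1 : measurableType d1) (T2 : measurableType d2) (R : realType).
Variables (P1 : probability T1 R) (P2 : probability T2 R).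

Lemma sqint_prodM (f : T1 -> R) (g : T2 -> R) : sqint P1 f -> sqint P2 g ->
  sqint (prodP P1 P2) (fun z => f z.1 * g z.2).
Proof.
move=> [mf if2] [mg ig2]; split; first by apply: measurable_funM; exact: measurableT_comp.
have := integrable_prodM if2 ig2.
by apply: eq_integrable => // z _ /=; rewrite exprMn.
Qed.

Lemma sqint_fst (f : T1 -> R) : sqint P1 f -> sqint (prodP P1 P2) (fun z => f z.1).
Proof.
move=> fi; have := sqint_prodM fi (sqint_cst P2 1).
by rewrite (_ : (fun z : T1 * T2 => _) = (fun z => f z.1))//; apply/funext => z; rewrite mulr1.
Qed.

Lemma sqint_snd (g : T2 -> R) : sqint P2 g -> sqint (prodP P1 P2) (fun z => g z.2).
Proof.
move=> gi; have := sqint_prodM (sqint_cst P1 1) gi.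
by rewrite (_ : (fun z : T1 * T2 => _) = (fun z => g z.2))//; apply/funext => z; rewrite mul1r.
Qed.

End square_integrable_prod.

(** * Exchanging the weight integrals with the expectation *)

Section parametric_fubini.
Context d (Q : measurableType d) (R : realType) (M : probability Q R).
Local Notation mu := (@lebesgue_measure R).
Local Notation RR := (measurableTypeR R).

Section parametric_integral.
Variables (h : RR * Q -> R) (b : Q -> R).
Hypothesis mh : measurable_fun setT h.
Hypothesis hb : forall q, (\int[mu]_r `|h (r, q)|%:E <= (b q)%:E)%E.
Hypothesis ib : M.-integrable setT (EFin \o b).

Lemma param_integrable : (mu \x M)%E.-integrable setT (EFin \o h).
Proof.
apply/integrable21ltyP; first exact/measurable_EFinP.
have mb : measurable_fun setT b by apply/measurable_EFinP; exact: measurable_int ib.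
move/integrableP : ib => [_]; apply: le_lt_trans.
apply: ge0_le_integral => //.
- by move=> q _; exact: integral_ge0.
- apply: (@measurable_fun_fubini_tonelli_G _ _ _ _ _ mu (fun z => `|(h z)%:E|%E)) => //.
  by do 2 apply: measurableT_comp => //.
- by apply: measurableT_comp => //; exact/measurable_EFinP.
- by move=> q _; apply: (le_trans (hb q)); rewrite /= lee_fin ler_norm.
Qed.

Lemma param_slice q : mu.-integrable setT (EFin \o (fun r => h (r, q))).
Proof.
apply/integrableP; split; last exact: le_lt_trans (hb q) (ltry _).
by apply/measurable_EFinP; exact: measurable_fun_pair1.
Qed.

Lemma param_measurable : measurable_fun setT (fun q => \int[mu]_r h (r, q)).
Proof.
have := param_integrable; rewrite integrable_swap// => i.
exact: (measurable_Rintegral1 i).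
Qed.

Lemma param_fubini :
  (\int[mu]_r (\int[M]_q h (r, q))%:E = (\int[M]_q \int[mu]_r h (r, q))%:E)%E.
Proof.
have i := param_integrable.
rewrite integral12_Rintegral// -(RFubini mh i) Rintegral12// /Rintegral fineK//.
exact: integrable_fin_num i.
Qed.

Lemma param_bound q : `|\int[mu]_r h (r, q)| <= b q.
Proof.
rewrite -lee_fin; apply: le_trans (hb q).
rewrite EFin_normr_Rintegral//; last exact: param_slice.
apply: le_abse_integral => //.
by apply/measurable_EFinP; exact: measurable_fun_pair1.
Qed.

End parametric_integral.

Variables (g1 g2 : RR * Q -> R) (b1 b2 : Q -> R) (C : R -> R).
Hypotheses (mg1 : measurable_fun setT g1) (mg2 : measurable_fun setT g2).
Hypothesis hb1 : forall q, (\int[mu]_r `|g1 (r, q)|%:E <= (b1 q)%:E)%E.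
Hypothesis hb2 : forall q, (\int[mu]_r `|g2 (r, q)|%:E <= (b2 q)%:E)%E.
Hypothesis hC : forall r q, `|g1 (r, q)| <= C r.
Hypothesis ib2 : M.-integrable setT (EFin \o b2).
Hypothesis ib12 : M.-integrable setT (EFin \o (fun q => b1 q * b2 q)).

(** Two successive exchanges. For fixed [r], [g1] is at most [C r], so [C r * b2] dominates the
    integral in [s]; once that is done, [b1 * b2] dominates the integral in [r]. *)
Lemma double_param_fubini :
  (\int[mu]_r \int[mu]_s (\int[M]_q (g1 (r, q) * g2 (s, q)))%:E =
  (\int[M]_q ((\int[mu]_r g1 (r, q)) * (\int[mu]_s g2 (s, q))))%:E)%E.
Proof.
pose G2 q := \int[mu]_s g2 (s, q).
have mG2 : measurable_fun setT G2 by exact: (param_measurable mg2 hb2 ib2).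
have G2b q : `|G2 q| <= b2 q by exact: (param_bound mg2 hb2).
have b1_ge0 q : 0 <= b1 q by rewrite -lee_fin; apply: le_trans (hb1 q); exact: integral_ge0.
have inner r : (\int[mu]_s (\int[M]_q (g1 (r, q) * g2 (s, q)))%:E =
    (\int[M]_q (g1 (r, q) * G2 q))%:E)%E.
  have mg1r : measurable_fun setT (fun q => g1 (r, q)) by exact: measurable_fun_pair2.
  rewrite (@param_fubini (fun z => g1 (r, z.2) * g2 z) (fun q => C r * b2 q)); first last.
  - by have := integrableZl measurableT (C r) ib2; apply: eq_integrable.
  - move=> q /=; under eq_integral do rewrite normrM EFinM.
    rewrite ge0_integralZl//; last first.
      by do 2 apply: measurableT_comp => //; exact: measurable_fun_pair1.
    by rewrite EFinM; apply: lee_pmul; rewrite ?lee_fin//; apply: integral_ge0 => ? _; rewrite lee_fin.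
  - by apply: measurable_funM => //; exact: (measurableT_comp mg1r).
  congr EFin; apply: eq_Rintegral => q _.
  by rewrite /= RintegralZl//; exact: (param_slice mg2 hb2).
under eq_integral do rewrite inner.
rewrite (@param_fubini (fun z => g1 z * G2 z.2) (fun q => b1 q * b2 q)) //.
- congr EFin; apply: eq_Rintegral => q _.
  by rewrite /= RintegralZr//; exact: (param_slice mg1 hb1).
- by apply: measurable_funM => //; exact: (measurableT_comp mG2).
- move=> q /=; under eq_integral do rewrite normrM EFinM.
  rewrite ge0_integralZr//; last first.
    by do 2 apply: measurableT_comp => //; exact: measurable_fun_pair1.
  by rewrite EFinM; apply: lee_pmul; rewrite ?lee_fin//; apply: integral_ge0 => ? _; rewrite lee_fin.
Qed.

End parametric_fubini.

(** The constant is absorbed into [g1] instead of being pulled out of the nested extended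
    integrals. *)
Lemma double_param_fubiniZ d (Q : measurableType d) (R : realType) (M : probability Q R)
    (k : R) (g1 g2 : measurableTypeR R * Q -> R) (b1 b2 : Q -> R) (C C' : R -> R) :
  measurable_fun setT g1 -> measurable_fun setT g2 ->
  (forall q, (\int[@lebesgue_measure R]_r `|g1 (r, q)|%:E <= (b1 q)%:E)%E) ->
  (forall q, (\int[@lebesgue_measure R]_r `|g2 (r, q)|%:E <= (b2 q)%:E)%E) ->
  (forall r q, `|g1 (r, q)| <= C r) -> (forall r q, `|g2 (r, q)| <= C' r) ->
  M.-integrable setT (EFin \o b2) ->
  M.-integrable setT (EFin \o (fun q => b1 q * b2 q)) ->
  (\int[@lebesgue_measure R]_r \int[@lebesgue_measure R]_s
     (k * \int[M]_q (g1 (r, q) * g2 (s, q)))%:E =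
  (\int[M]_q (k * ((\int[@lebesgue_measure R]_r g1 (r, q)) *
     (\int[@lebesgue_measure R]_s g2 (s, q)))))%:E)%E.
Proof.
move=> mg1 mg2 hb1 hb2 hC hC' ib2 ib12.
pose kg1 z := k * g1 z.
have mkg1 : measurable_fun setT kg1 by exact: measurable_funM.
have b1_ge0 q : 0 <= b1 q by rewrite -lee_fin; apply: le_trans (hb1 q); exact: integral_ge0.
have hkb1 q : (\int[@lebesgue_measure R]_r `|kg1 (r, q)|%:E <= (`|k| * b1 q)%:E)%E.
  under eq_integral do rewrite /kg1 normrM EFinM.
  rewrite ge0_integralZl//; last first.
    by do 2 apply: measurableT_comp => //; exact: measurable_fun_pair1.
  by rewrite EFinM lee_wpmul2l// lee_fin.
have hkC r q : `|kg1 (r, q)| <= `|k| * C r by rewrite normrM ler_wpM2l.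
have ikb : M.-integrable setT (EFin \o (fun q => `|k| * b1 q * b2 q)).
  have := integrableZl measurableT `|k| ib12.
  by apply: eq_integrable => // q _ /=; rewrite -mulrA EFinM.
transitivity (\int[@lebesgue_measure R]_r \int[@lebesgue_measure R]_s
    (\int[M]_q (kg1 (r, q) * g2 (s, q)))%:E)%E; last first.
  rewrite (double_param_fubini mkg1 mg2 hkb1 hb2 hkC ib2 ikb); congr EFin.
  apply: eq_Rintegral => q _; rewrite /= /kg1 mulrA RintegralZl//.
  exact: (param_slice mg1 hb1).
apply: eq_integral => r _; apply: eq_integral => s _; congr EFin.
rewrite -RintegralZl//; first by apply: eq_Rintegral => q _; rewrite /= /kg1 mulrA.
apply: bmeas_integrable; apply: bmeasM; split; [|by exists (C r)| |by exists (C' s)];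
  exact: measurable_fun_pair2.
Qed.

Section quadruples.
Context (R : realType) (E1 E2 : Type).
Local Notation Q := (((E1 * E2) * (E1 * E2)) * ((E1 * E2) * (E1 * E2)))%type.

(** The points of [((z0, z2), (z1, z3))] are grouped as in the bound
    [(h z0 + h z2) * (h z1 + h z3)] on [hatk]. *)
Definition quad1 (k : E1 -> E1 -> R) (q : Q) := hatk k q.1.1.1 q.2.1.1 q.1.2.1 q.2.2.1.
Definition quad2 (k : E2 -> E2 -> R) (q : Q) := hatk k q.1.1.2 q.2.1.2 q.1.2.2 q.2.2.2.

End quadruples.

Section kernel_measurable.
Context (R : realType) (alpha : R) (H : completeNormedModType R).
Local Notation RR := (measurableTypeR R).
Hypothesis mdist : measurable_fun setT (fun z : borel H * borel H => `|(z.1 : H) - z.2|).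

Lemma measurable_dist_pow :
  measurable_fun setT (fun z : borel H * borel H => dist_pow alpha (z.1 : H) z.2).
Proof. exact: (measurableT_comp (measurable_powR alpha) mdist). Qed.

Context d (Q : measurableType d).
Variables p0 p1 p2 p3 : Q -> borel H.
Hypotheses (m0 : measurable_fun setT p0) (m1 : measurable_fun setT p1)
  (m2 : measurable_fun setT p2) (m3 : measurable_fun setT p3).

Lemma measurable_hatk_kern : measurable_fun setT (fun z : RR * Q =>
  hatk (@kern R H z.1) (p0 z.2) (p1 z.2) (p2 z.2) (p3 z.2)).
Proof.
have mk (p p' : Q -> borel H) : measurable_fun setT p -> measurable_fun setT p' ->
    measurable_fun setT (fun z : RR * Q => @kern R H z.1 (p z.2) (p' z.2)).
  move=> mp mp'; have mf : measurable_fun setT (fun z : RR * Q => `|(p z.2 : H) - p' z.2|).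
    have mq : measurable_fun setT (fun q => `|(p q : H) - p' q|).
      exact: (measurableT_comp mdist (measurable_fun_pair mp mp')).
    exact: (measurableT_comp mq measurable_snd).
  have mz : measurable_fun setT (fun z : RR * Q => (z.1 : R)) by exact: measurable_fst.
  apply: measurableT_comp => //; apply: measurableT_comp => //.
  apply: measurable_funM => //; apply: measurable_funM; exact: measurable_funX.
apply: measurable_funB; last exact: mk.
apply: measurable_funD; last exact: mk.
by apply: measurable_funB; exact: mk.
Qed.

End kernel_measurable.

Section kernel_dcov.
Context (R : realType) (alpha : R) (H H' : completeNormedModType R).
Hypothesis halpha : 0 < alpha < 2.
Local Notation lmu := (@lebesgue_measure R).
Local Notation RR := (measurableTypeR R).
Local Notation S := (borel H * borel H')%type.
Local Notation Q := ((S * S) * (S * S))%type.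
Local Notation c := (c_const alpha).
Hypothesis mdist : measurable_fun setT (fun z : borel H * borel H => `|(z.1 : H) - z.2|).
Hypothesis mdist' : measurable_fun setT (fun z : borel H' * borel H' => `|(z.1 : H') - z.2|).
Hypothesis kern_bound : forall r (x0 x1 x2 x3 : H) l, 0 < l ->
  `|hatk (kern r) x0 x1 x2 x3| <= l * (1 - kern r x0 x2) + l^-1 * (1 - kern r x1 x3).
Hypothesis kern_bound' : forall r (x0 x1 x2 x3 : H') l, 0 < l ->
  `|hatk (kern r) x0 x1 x2 x3| <= l * (1 - kern r x0 x2) + l^-1 * (1 - kern r x1 x3).
Variable mu : probability S R.
Hypothesis sq1 : sqint mu (fun z => half_pow alpha (z.1 : H)).
Hypothesis sq2 : sqint mu (fun z => half_pow alpha (z.2 : H')).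
Local Notation nu := (prodP mu mu).
Local Notation M := (prodP nu nu).

Let f1 (z : S * S) := half_pow alpha (z.1.1 : H) + half_pow alpha (z.2.1 : H).
Let f2 (z : S * S) := half_pow alpha (z.1.2 : H') + half_pow alpha (z.2.2 : H').

Let sqf1 : sqint nu f1.
Proof. exact: (sqintD (sqint_fst mu sq1) (sqint_snd mu sq1)). Qed.

Let sqf2 : sqint nu f2.
Proof. exact: (sqintD (sqint_fst mu sq2) (sqint_snd mu sq2)). Qed.

Let m_sel : [/\ measurable_fun setT (fun q : Q => q.1.1), measurable_fun setT (fun q : Q => q.1.2),
  measurable_fun setT (fun q : Q => q.2.1) & measurable_fun setT (fun q : Q => q.2.2)].
Proof.
by split; [exact: (measurableT_comp measurable_fst measurable_fst)|
  exact: (measurableT_comp measurable_snd measurable_fst)|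
  exact: (measurableT_comp measurable_fst measurable_snd)|
  exact: (measurableT_comp measurable_snd measurable_snd)].
Qed.

Lemma sqint_quad1 : sqint M (quad1 (@dist_pow R alpha H)).
Proof.
have [m0 m2 m1 m3] := m_sel.
apply: (sqint_le (g := fun q => 8 * (f1 q.1 * f1 q.2))).
- exact: (measurable_hatk (measurable_dist_pow alpha mdist)
    (measurableT_comp measurable_fst m0) (measurableT_comp measurable_fst m1)
    (measurableT_comp measurable_fst m2) (measurableT_comp measurable_fst m3)).
- by move=> q; exact: hatk_dist_bound.
- by apply: sqintZ; exact: sqint_prodM.
Qed.

Lemma sqint_quad2 : sqint M (quad2 (@dist_pow R alpha H')).
Proof.
have [m0 m2 m1 m3] := m_sel.
apply: (sqint_le (g := fun q => 8 * (f2 q.1 * f2 q.2))).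
- exact: (measurable_hatk (measurable_dist_pow alpha mdist')
    (measurableT_comp measurable_snd m0) (measurableT_comp measurable_snd m1)
    (measurableT_comp measurable_snd m2) (measurableT_comp measurable_snd m3)).
- by move=> q; exact: hatk_dist_bound.
- by apply: sqintZ; exact: sqint_prodM.
Qed.

(** Each of the two hat integrals contributes a factor - 1 / c: the signs cancel, and [c ^+ 2]
    compensates for the rest. *)
Lemma kernel_dcov (k : R) :
  ((c ^+ 2)%:E * \int[lmu]_r \int[lmu]_s
    (k * (\int[M]_q (quad1 (kern r) q * quad2 (kern s) q)) *
     (weight alpha r * weight alpha s))%:E =
  (k * \int[M]_q (quad1 (@dist_pow R alpha H) q * quad2 (@dist_pow R alpha H') q))%:E)%E.
Proof.
have [m0 m2 m1 m3] := m_sel.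
have c0 : 0 < c by exact: c_const_gt0.
pose g1 (z : RR * Q) := quad1 (kern z.1) z.2 * weight alpha z.1.
pose g2 (z : RR * Q) := quad2 (kern z.1) z.2 * weight alpha z.1.
pose b1 (q : Q) := 8 / c * (f1 q.1 * f1 q.2).
pose b2 (q : Q) := 8 / c * (f2 q.1 * f2 q.2).
have sb1 : sqint M b1 by apply: sqintZ; exact: sqint_prodM.
have sb2 : sqint M b2 by apply: sqintZ; exact: sqint_prodM.
have mq1 : measurable_fun setT (fun z : RR * Q => quad1 (kern z.1) z.2).
  exact: (measurable_hatk_kern mdist (measurableT_comp measurable_fst m0)
    (measurableT_comp measurable_fst m1) (measurableT_comp measurable_fst m2)
    (measurableT_comp measurable_fst m3)).
have mq2 : measurable_fun setT (fun z : RR * Q => quad2 (kern z.1) z.2).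
  exact: (measurable_hatk_kern mdist' (measurableT_comp measurable_snd m0)
    (measurableT_comp measurable_snd m1) (measurableT_comp measurable_snd m2)
    (measurableT_comp measurable_snd m3)).
have mw : measurable_fun setT (fun z : RR * Q => weight alpha z.1).
  exact: (measurableT_comp (measurable_weight _) measurable_fst).
have mg1 : measurable_fun setT g1 by exact: measurable_funM.
have mg2 : measurable_fun setT g2 by exact: measurable_funM.
have hb1 q : (\int[lmu]_r `|g1 (r, q)|%:E <= (b1 q)%:E)%E by exact: integral_hatk_bound.
have hb2 q : (\int[lmu]_r `|g2 (r, q)|%:E <= (b2 q)%:E)%E by exact: integral_hatk_bound.
have hC1 r q : `|g1 (r, q)| <= 4 * weight alpha r.
  rewrite normrM (ger0_norm (weight_ge0 _ _)); apply: ler_wpM2r; first exact: weight_ge0.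
  exact: hatk_kern_bounded.
have hC2 r q : `|g2 (r, q)| <= 4 * weight alpha r.
  rewrite normrM (ger0_norm (weight_ge0 _ _)); apply: ler_wpM2r; first exact: weight_ge0.
  exact: hatk_kern_bounded.
transitivity ((c ^+ 2)%:E * (\int[lmu]_r \int[lmu]_s
    (k * \int[M]_q (g1 (r, q) * g2 (s, q)))%:E))%E.
  congr (_ * _)%E; apply: eq_integral => r _; apply: eq_integral => s _; congr EFin.
  rewrite -mulrA -RintegralZr//; last first.
    apply: bmeas_integrable; apply: bmeasM; split; [|exists 4 => q; exact: hatk_kern_bounded| |
      exists 4 => q; exact: hatk_kern_bounded].
      exact: (measurable_fun_pair2 r mq1).
    exact: (measurable_fun_pair2 s mq2).
  by congr (_ * _); apply: eq_Rintegral => q _; rewrite /g1/g2/=; ring.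
rewrite (double_param_fubiniZ k mg1 mg2 hb1 hb2 hC1 hC2 (sqint_integrable sb2)
  (sqint_integrableM sb1 sb2)) -EFinM; congr EFin.
have i12 := sqint_integrableM sqint_quad1 sqint_quad2.
transitivity (c ^+ 2 * \int[M]_q (k * (c ^+ 2)^-1 *
    (quad1 (@dist_pow R alpha H) q * quad2 (@dist_pow R alpha H') q))).
  congr (_ * _); apply: eq_Rintegral => q _.
  rewrite /g1 /g2 /= !Rintegral_hatk// /quad1 /quad2.
  by field; rewrite gt_eqF.
by rewrite RintegralZl// mulrA (mulrC k) mulVKf// expf_neq0// gt_eqF.
Qed.

End kernel_dcov.

(** * Evaluation of the Gaussian functional *)

Lemma cond_exp_trig d (T : measurableType d) (R : realType) (P : probability T R)
    (G : set (set T)) (Gm : G `<=` measurable) d' (S : measurableType d') (Z : T -> S)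
    (mZ : measurable_fun setT Z) (f : T * S -> R) (tr : R -> R) :
  indep P <<s G>> (g_sigma_algebra_preimage Z) ->
  measurable_fun setT (f : g_sigma_algebraType G * S -> R) ->
  bmeas tr ->
  measurable_fun setT (cond_exp P <<s G>> (fun w => tr (f (w, Z w)))) /\
  {ae P, forall w, cond_exp P <<s G>> (fun w => tr (f (w, Z w))) w =
    \int[law P mZ]_z tr (f (w, z))}.
Proof.
move=> GZ mf btr.
apply: (cond_expP Gm).
apply: (@is_cond_exp_freezing _ _ _ _ _ Gm _ _ _ mZ GZ (fun z => tr (f z))).
  by case: btr => mtr _; exact: (measurableT_comp mtr mf).
apply: bmeas_integrable; apply: (bmeas_comp btr).
exact: (measurableT_comp mf (measurable_fun_pair (measurable_sigma_id Gm) mZ)).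
Qed.

Lemma normc_sqr (R : realType) (z : R[i]) :
  Normc.normc z ^+ 2 = complex.Re z ^+ 2 + complex.Im z ^+ 2.
Proof. by case: z => a b /=; rewrite sqr_sqrtr// addr_ge0 ?sqr_ge0. Qed.

Section gaussian_side.
Context (R : realType) (alpha : R) (H H' : completeNormedModType R).
Hypothesis halpha : 0 < alpha < 2.
Variables (ip : {dot H for @idfun R}) (ip' : {dot H' for @idfun R}).
Hypotheses (hip : induces_norm ip) (hip' : induces_norm ip').
Variables (dim dim' : option nat) (e : nat -> H) (e' : nat -> H').
Hypotheses (he : orthonormal_basis ip dim e) (he' : orthonormal_basis ip' dim' e').
Context d (T : measurableType d) (P : probability T R).
Variables (X : T -> borel H) (Y : T -> borel H') (xi eta : nat -> T -> R).
Hypotheses (mX : measurable_fun setT X) (mY : measurable_fun setT Y).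
Hypotheses (mxi : forall i, measurable_fun setT (xi i))
  (meta : forall i, measurable_fun setT (eta i)).
Hypothesis hgauss : gaussian_family P dim dim' xi eta X Y.

Local Notation S := (borel H * borel H')%type.
Let Z w : S := (X w, Y w).
Hypothesis mZ : measurable_fun setT (fun w => (X w, Y w)).

Let D := [set k : option (nat + nat) | match k with
          | Some (inl i) => in_dim dim i
          | Some (inr j) => in_dim dim' j
          | None => true
          end].
Let F (k : option (nat + nat)) := match k with
          | Some (inl i) => g_sigma_algebra_preimage (xi i)
          | Some (inr j) => g_sigma_algebra_preimage (eta j)
          | None => sigma_pair X Y
          end.

Let Fm i : D i -> F i `<=` measurable.
Proof.
case: i => [[i|j]|] _; [exact: preimage_system_measurable..|].
by apply: sigma_sub_measurable => A [] h; [exact: (preimage_system_measurable mX)|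
  exact: (preimage_system_measurable mY)].
Qed.

Let FT i : D i -> F i setT.
Proof. by case: i => [[i|j]|] _; [exact: preimage_systemT..|exact: sigmaT]. Qed.

Let FI i : D i -> setI_closed (F i).
Proof. by case: i => [[i|j]|] _; [exact: preimage_systemI..|exact: sigmaI]. Qed.

(** Every independence used for the Gaussian functional is an instance of this one, for suitable
    disjoint blocks of indices. *)
Let indepD (D1 D2 : set (option (nat + nat))) (G1 G2 : set (set T)) :
  D1 `<=` D -> D2 `<=` D -> (forall i, D1 i -> ~ D2 i) ->
  G1 `<=` <<s \bigcup_(k in D1) F k >> -> G2 `<=` <<s \bigcup_(k in D2) F k >> ->
  indep P G1 G2.
Proof.
move=> d1 d2 d12 g1 g2; apply: indepS (g1) (g2) _.
by apply: (mutually_independent_indep (D := D)) => //; case: hgauss.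
Qed.

Let X0 := \bigcup_(i in [set k | in_dim dim k]) g_sigma_algebra_preimage (xi i).
Let Y0 := \bigcup_(i in [set k | in_dim dim' k]) g_sigma_algebra_preimage (eta i).
Let Dx := [set k : option (nat + nat) | if k is Some (inl i) then in_dim dim i else false].
Let Dy := [set k : option (nat + nat) | if k is Some (inr i) then in_dim dim' i else false].
Let Dz := [set None : option (nat + nat)].

Let DxD : Dx `<=` D. Proof. by move=> [[i|j]|]. Qed.
Let DyD : Dy `<=` D. Proof. by move=> [[i|j]|]. Qed.
Let DzD : Dz `<=` D. Proof. by move=> _ ->. Qed.

Let X0F (D1 : set (option (nat + nat))) : Dx `<=` D1 -> <<s X0 >> `<=` <<s \bigcup_(k in D1) F k >>.
Proof.
move=> DD; apply: sub_sigma_algebra2 => A [i di hA].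
by exists (Some (inl i)) => //; exact: DD.
Qed.

Let Y0F (D1 : set (option (nat + nat))) : Dy `<=` D1 -> <<s Y0 >> `<=` <<s \bigcup_(k in D1) F k >>.
Proof.
move=> DD; apply: sub_sigma_algebra2 => A [i di hA].
by exists (Some (inr i)) => //; exact: DD.
Qed.

Let ZF : g_sigma_algebra_preimage Z `<=` <<s \bigcup_(k in Dz) F k >>.
Proof.
apply: (subset_trans (@preimage_pair_sub _ _ _ _ _ _ X Y)) => A hA.
by apply: sub_sigma_algebra; exists None.
Qed.

Let indXY : indep P <<s X0 >> <<s Y0 >>.
Proof. by apply: (indepD (D1 := Dx) (D2 := Dy)); [..|exact: X0F|exact: Y0F] => // -[[]|]. Qed.

Let indXYZ : indep P <<s <<s X0 >> `|` <<s Y0 >> >> (g_sigma_algebra_preimage Z).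
Proof.
apply: (indepD (D1 := Dx `|` Dy) (D2 := Dz)) => //.
- by move=> k [/DxD|/DyD].
- by move=> k [] h kz; rewrite kz in h.
- apply: smallest_sub; first exact: smallest_sigma_algebra.
  by move=> A [|]; [apply: X0F => k; left|apply: Y0F => k; right].
Qed.

Let subX : <<s X0 >> `<=` <<s <<s X0 >> `|` <<s Y0 >> >>.
Proof. by move=> A hA; apply: sub_sigma_algebra; left. Qed.

Let subY : <<s Y0 >> `<=` <<s <<s X0 >> `|` <<s Y0 >> >>.
Proof. by move=> A hA; apply: sub_sigma_algebra; right. Qed.

Let indXZ : indep P <<s X0 >> (g_sigma_algebra_preimage Z).
Proof. exact: (indepS subX _ indXYZ). Qed.

Let indYZ : indep P <<s Y0 >> (g_sigma_algebra_preimage Z).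
Proof. exact: (indepS subY _ indXYZ). Qed.

Let indxi n : in_dim dim n -> indep P
  <<s \bigcup_(i in [set k | (k < n)%N && in_dim dim k]) g_sigma_algebra_preimage (xi i) >>
  (g_sigma_algebra_preimage (xi n)).
Proof.
move=> dn; apply: (indepD (D1 := [set Some (inl k) | k in [set k | (k < n)%N && in_dim dim k]])
  (D2 := [set Some (inl n)])).
- by move=> _ [k /andP[_ dk] <-].
- by move=> _ ->.
- by move=> _ [k /andP[kn _] <-] [kk]; rewrite kk ltnn in kn.
- by apply: sub_sigma_algebra2 => A [k hk hA]; exists (Some (inl k)) => //; exists k.
- by move=> A hA; apply: sub_sigma_algebra; exists (Some (inl n)).
Qed.

Let indeta n : in_dim dim' n -> indep P
  <<s \bigcup_(i in [set k | (k < n)%N && in_dim dim' k]) g_sigma_algebra_preimage (eta i) >>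
  (g_sigma_algebra_preimage (eta n)).
Proof.
move=> dn; apply: (indepD (D1 := [set Some (inr k) | k in [set k | (k < n)%N && in_dim dim' k]])
  (D2 := [set Some (inr n)])).
- by move=> _ [k /andP[_ dk] <-].
- by move=> _ ->.
- by move=> _ [k /andP[kn _] <-] [kk]; rewrite kk ltnn in kn.
- by apply: sub_sigma_algebra2 => A [k hk hA]; exists (Some (inr k)) => //; exists k.
- by move=> A hA; apply: sub_sigma_algebra; exists (Some (inr n)).
Qed.

Let a r (z : T * borel H) := r * gauss_dot ip dim e xi z.2 z.1.
Let b s (z : T * borel H') := s * gauss_dot ip' dim' e' eta z.2 z.1.

Let aE r (x x' : borel H) : \int[P]_w cos (a r (w, x) - a r (w, x')) = kern r (x : H) x' /\
  \int[P]_w sin (a r (w, x) - a r (w, x')) = 0.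
Proof. by case: hgauss => nxi _ _; exact: gauss_dotB_charfun. Qed.

Let bE s (y y' : borel H') : \int[P]_w cos (b s (w, y) - b s (w, y')) = kern s (y : H') y' /\
  \int[P]_w sin (b s (w, y) - b s (w, y')) = 0.
Proof. by case: hgauss => _ neta _; exact: gauss_dotB_charfun. Qed.

Let ma r : measurable_fun setT (a r).
Proof. by apply: measurable_funM => //; exact: measurable_gauss_dot. Qed.

Let mb s : measurable_fun setT (b s).
Proof. by apply: measurable_funM => //; exact: measurable_gauss_dot. Qed.

(** The functional [a r] represents [kern r] as a mean of cosines of differences, which is what
    [hatk_bound] starts from. *)
Lemma gaussian_kern_bound (r : R) (x0 x1 x2 x3 : H) l : 0 < l ->
  `|hatk (kern r) x0 x1 x2 x3| <= l * (1 - kern r x0 x2) + l^-1 * (1 - kern r x1 x3).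
Proof. exact: (hatk_bound (ma r) (fun x x' => proj1 (aE r x x'))). Qed.

Lemma gaussian_kern_bound' (r : R) (x0 x1 x2 x3 : H') l : 0 < l ->
  `|hatk (kern r) x0 x1 x2 x3| <= l * (1 - kern r x0 x2) + l^-1 * (1 - kern r x1 x3).
Proof. exact: (hatk_bound (mb r) (fun x x' => proj1 (bE r x x'))). Qed.

Let X0m : X0 `<=` measurable.
Proof. by move=> A [i _]; exact: preimage_system_measurable. Qed.
Let Y0m : Y0 `<=` measurable.
Proof. by move=> A [i _]; exact: preimage_system_measurable. Qed.
Let XY0m : <<s X0 >> `|` <<s Y0 >> `<=` measurable.
Proof. by move=> A []; exact: sigma_sub_measurable. Qed.

(** Freezing demands joint measurability for the conditioning sigma-algebra; [G] is general because
    the functional occurs both under the one of [xi] alone and under the joint one. *)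
Let ma_G r (G : set (set T)) : <<s X0 >> `<=` <<s G >> ->
  measurable_fun setT (a r : g_sigma_algebraType G * borel H -> R).
Proof.
move=> XG; apply: measurable_funM => //.
apply: (@measurable_gauss_dot _ _ _ hip _ _ he _ (g_sigma_algebraType G)) => i di.
apply/preimage_sub_sigma; apply: subset_trans XG => A hA.
by apply: sub_sigma_algebra; exists i.
Qed.

Let mb_G s (G : set (set T)) : <<s Y0 >> `<=` <<s G >> ->
  measurable_fun setT (b s : g_sigma_algebraType G * borel H' -> R).
Proof.
move=> XG; apply: measurable_funM => //.
apply: (@measurable_gauss_dot _ _ _ hip' _ _ he' _ (g_sigma_algebraType G)) => i di.
apply/preimage_sub_sigma; apply: subset_trans XG => A hA.
by apply: sub_sigma_algebra; exists i.
Qed.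

Let mu := law P mZ.
Local Notation cfd := (cf_diff P ip ip' dim e xi dim' e' eta X Y).

Let f1 r (z : T * S) := a r (z.1, z.2.1).
Let f2 s (z : T * S) := b s (z.1, z.2.2).

Let m_f1 r (G : set (set T)) : <<s X0 >> `<=` <<s G >> ->
  measurable_fun setT (f1 r : g_sigma_algebraType G * S -> R).
Proof.
move=> XG; apply: (measurableT_comp (ma_G r XG)); apply: measurable_fun_pair => //.
exact: (measurableT_comp measurable_fst measurable_snd).
Qed.

Let m_f2 s (G : set (set T)) : <<s Y0 >> `<=` <<s G >> ->
  measurable_fun setT (f2 s : g_sigma_algebraType G * S -> R).
Proof.
move=> XG; apply: (measurableT_comp (mb_G s XG)); apply: measurable_fun_pair => //.
exact: (measurableT_comp measurable_snd measurable_snd).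
Qed.


Let m_f12 r s : measurable_fun setT
  ((fun z => f1 r z + f2 s z) : g_sigma_algebraType (<<s X0 >> `|` <<s Y0 >>) * S -> R).
Proof. by apply: measurable_funD; [exact: m_f1|exact: m_f2]. Qed.

(** Six real conditional expectations are identified with integrals over the law of (X, Y) by
    freezing. Measurability is recorded separately, since the chosen versions equal the explicit
    covariance only almost everywhere. *)
Lemma cf_diff_sqr r s :
  measurable_fun setT (fun w => Normc.normc (cfd r s w) ^+ 2) /\
  {ae P, forall w, Normc.normc (cfd r s w) ^+ 2 =
    cov_re mu (a r) (b s) w ^+ 2 + cov_im mu (a r) (b s) w ^+ 2}.
Proof.
have [mc E1] := cond_exp_trig XY0m mZ indXYZ (m_f12 r s) (bmeas_cosine R).
have [ms E2] := cond_exp_trig XY0m mZ indXYZ (m_f12 r s) (bmeas_sine R).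
have [mcx E3] := cond_exp_trig X0m mZ indXZ (m_f1 r (fun _ => id)) (bmeas_cosine R).
have [msx E4] := cond_exp_trig X0m mZ indXZ (m_f1 r (fun _ => id)) (bmeas_sine R).
have [mcy E5] := cond_exp_trig Y0m mZ indYZ (m_f2 s (fun _ => id)) (bmeas_cosine R).
have [msy E6] := cond_exp_trig Y0m mZ indYZ (m_f2 s (fun _ => id)) (bmeas_sine R).
split.
  under eq_fun do rewrite normc_sqr.
  apply: measurable_funD; apply: measurable_funX; apply: measurable_funB => //.
    by apply: measurable_funB; exact: measurable_funM.
  by apply: measurable_funD; exact: measurable_funM.
apply: (filterS _ (filterI (filterI E1 E2) (filterI (filterI E3 E4) (filterI E5 E6)))).
move=> w [[e1 e2] [[e3 e4] [e5 e6]]].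
rewrite normc_sqr; congr (_ ^+ 2 + _ ^+ 2).
  (* The real part of the complex difference, obtained by unfolding complex multiplication; the
     imaginary part follows in the same way. *)
  by transitivity (cond_exp P <<s <<s X0 >> `|` <<s Y0 >> >>
      (fun w => cos (f1 r (w, Z w) + f2 s (w, Z w))) w -
    (cond_exp P <<s X0 >> (fun w => cos (f1 r (w, Z w))) w *
     cond_exp P <<s Y0 >> (fun w => cos (f2 s (w, Z w))) w -
     cond_exp P <<s X0 >> (fun w => sin (f1 r (w, Z w))) w *
     cond_exp P <<s Y0 >> (fun w => sin (f2 s (w, Z w))) w));
    [|rewrite e1 e3 e4 e5 e6].
by transitivity (cond_exp P <<s <<s X0 >> `|` <<s Y0 >> >>
      (fun w => sin (f1 r (w, Z w) + f2 s (w, Z w))) w -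
    (cond_exp P <<s X0 >> (fun w => cos (f1 r (w, Z w))) w *
     cond_exp P <<s Y0 >> (fun w => sin (f2 s (w, Z w))) w +
     cond_exp P <<s X0 >> (fun w => sin (f1 r (w, Z w))) w *
     cond_exp P <<s Y0 >> (fun w => cos (f2 s (w, Z w))) w));
    [|rewrite e2 e3 e4 e5 e6].
Qed.

Let bmeas_cov r s : bmeas (cov_re mu (a r) (b s)) /\ bmeas (cov_im mu (a r) (b s)).
Proof.
have mf1 : measurable_fun setT (f1 r : T * S -> R).
  apply: (measurableT_comp (ma r)); apply: measurable_fun_pair => //.
  exact: (measurableT_comp measurable_fst measurable_snd).
have mf2 : measurable_fun setT (f2 s : T * S -> R).
  apply: (measurableT_comp (mb s)); apply: measurable_fun_pair => //.
  exact: (measurableT_comp measurable_snd measurable_snd).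
have mf12 := measurable_funD mf1 mf2.
have b1 := bmeas_Rintegral mu (bmeas_cos mf1).
have b2 := bmeas_Rintegral mu (bmeas_sin mf1).
have b3 := bmeas_Rintegral mu (bmeas_cos mf2).
have b4 := bmeas_Rintegral mu (bmeas_sin mf2).
have b5 := bmeas_Rintegral mu (bmeas_cos mf12).
have b6 := bmeas_Rintegral mu (bmeas_sin mf12).
by split; apply: bmeasB => //; [apply: bmeasB|apply: bmeasD]; exact: bmeasM.
Qed.

Lemma expectation_cf_diff r s :
  ('E_P[fun w => (Normc.normc (cfd r s w) ^+ 2)%R] =
   (4^-1 * \int[prodP (prodP mu mu) (prodP mu mu)]_q
     (quad1 (kern r) q * quad2 (kern s) q))%:E)%E.
Proof.
have [mn En] := cf_diff_sqr r s.
have [bre bim] := bmeas_cov r s.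
have bsq : bmeas (fun w => cov_re mu (a r) (b s) w ^+ 2 + cov_im mu (a r) (b s) w ^+ 2).
  by apply: bmeasD; exact: bmeasM.
have mG1 x : measurable_fun setT ((fun w => a r (w, x)) : g_sigma_algebraType X0 -> R).
  exact: (measurable_fun_pair1 x (ma_G r (G := X0) (fun _ => id))).
have mG2 y : measurable_fun setT ((fun w => b s (w, y)) : g_sigma_algebraType Y0 -> R).
  exact: (measurable_fun_pair1 y (mb_G s (G := Y0) (fun _ => id))).
rewrite unlock (ae_eq_integral (EFin \o
  (fun w => cov_re mu (a r) (b s) w ^+ 2 + cov_im mu (a r) (b s) w ^+ 2))) //; first last.
- by apply: filterS En => w + _ => ->.
- by apply/measurable_EFinP; case: bsq.
- exact/measurable_EFinP.
have /= := Rintegral_cov_sqr mu (ma r) (mb s) indXY mG1 mG2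
  (fun x x' => proj1 (aE r x x')) (fun x x' => proj1 (bE s x x'))
  (fun x x' => proj2 (aE r x x')).
rewrite /Rintegral mulrC => <-.
by rewrite fineK//; apply: integrable_fin_num => //; exact: bmeas_integrable.
Qed.

End gaussian_side.

Lemma sqint_half_pow (R : realType) (alpha : R) (H : completeNormedModType R)
    d (T : measurableType d) (P : probability T R) (X : T -> borel H) :
  measurable_fun setT (fun w => `|(X w : H)|) ->
  ('E_P[fun w => (`|(X w : H)| `^ alpha)%R] < +oo)%E ->
  sqint P (fun w => half_pow alpha (X w : H)).
Proof.
move=> mX; rewrite unlock => hX.
have mp (p : R) : measurable_fun setT (fun w => `|(X w : H)| `^ p).
  exact: (measurableT_comp (measurable_powR p) mX).
have m2 : measurable_fun setT (fun w => half_pow alpha (X w : H) ^+ 2).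
  exact: measurable_funX (mp _).
split; first exact: mp.
apply/integrableP; split; first exact/measurable_EFinP.
apply: le_lt_trans hX; apply: ge0_le_integral => //.
- by apply: measurableT_comp => //; exact/measurable_EFinP.
- exact/measurable_EFinP.
- by move=> w _; rewrite /= ger0_norm ?sqr_ge0// half_pow_sqr.
Qed.

Lemma integral_weight2 (R : realType) (alpha : R) (K : R -> R -> R) :
  (\int[@lebesgue_measure R]_(r in `]0%R, +oo[)
     \int[@lebesgue_measure R]_(s in `]0%R, +oo[)
       ((K r s)%:E * ((r `^ (alpha + 1) * s `^ (alpha + 1))^-1)%R%:E) =
   \int[@lebesgue_measure R]_r \int[@lebesgue_measure R]_s
     (K r s * (weight alpha r * weight alpha s))%:E)%E.
Proof.
pose pos : set R := [set` `]0%R, +oo[].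
have w0 (r : R) : ~ pos r -> weight alpha r = 0.
  by move=> hr; rewrite /weight (indic_out hr) mulr0.
rewrite integral_mkcond; apply: eq_integral => r _; rewrite patchE.
have [pr|npr] := pselect (pos r); last first.
  by rewrite (memNset npr) integral0_eq// => s _; rewrite (w0 r npr) mul0r mulr0.
rewrite (mem_set pr) integral_mkcond; apply: eq_integral => s _; rewrite patchE.
have [ps|nps] := pselect (pos s); last first.
  by rewrite (memNset nps) (w0 s nps) !mulr0.
rewrite (mem_set ps).
have r0 : 0 < r by move: pr; rewrite /pos/= in_itv/= andbT.
have s0 : 0 < s by move: ps; rewrite /pos/= in_itv/= andbT.
by rewrite -EFinM !weightE// invfM.
Qed.

Section dcovH_value.
Context (R : realType) (alpha : R) (H H' : completeNormedModType R).
Hypothesis halpha : 0 < alpha < 2.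
Variables (ip : {dot H for @idfun R}) (ip' : {dot H' for @idfun R}).
Hypotheses (hip : induces_norm ip) (hip' : induces_norm ip').
Variables (dim dim' : option nat) (e : nat -> H) (e' : nat -> H').
Hypotheses (he : orthonormal_basis ip dim e) (he' : orthonormal_basis ip' dim' e').
Context d (T : measurableType d) (P : probability T R).
Variables (X : {RV P >-> borel H}) (Y : {RV P >-> borel H'}).
Variables (xi eta : nat -> {RV P >-> R}).
Hypothesis hgauss : gaussian_family P dim dim' xi eta X Y.
Variable mZ : measurable_fun setT (fun w => (X w, Y w)).
Local Notation mu := (law P mZ).
Local Notation M := (prodP (prodP mu mu) (prodP mu mu)).
Hypothesis sq1 : sqint mu (fun z => half_pow alpha (z.1 : H)).
Hypothesis sq2 : sqint mu (fun z => half_pow alpha (z.2 : H')).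

Lemma dcovH_quad : dcovH P ip ip' alpha dim e xi dim' e' eta X Y =
  (4^-1 * \int[M]_q (quad1 (@dist_pow R alpha H) q * quad2 (@dist_pow R alpha H') q))%:E.
Proof.
have mX : measurable_fun setT X by [].
have mY : measurable_fun setT Y by [].
have mxi i : measurable_fun setT (xi i) by [].
have meta i : measurable_fun setT (eta i) by [].
rewrite -(kernel_dcov halpha (measurable_dist hip he) (measurable_dist hip' he')
  (gaussian_kern_bound hip he mX mY mxi meta hgauss)
  (gaussian_kern_bound' hip' he' mX mY mxi meta hgauss) sq1 sq2) /dcovH.
rewrite -integral_weight2; congr (_ * _)%E.
apply: eq_integral => r _; apply: eq_integral => s _.
by rewrite (expectation_cf_diff hip hip' he he' mX mY mxi meta hgauss mZ).
Qed.

End dcovH_value.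

(** * Independent copies *)

Section equal_laws.
Context d d' (T : measurableType d) (S : measurableType d') (R : realType).
Variables (P : probability T R) (m : probability S R) (f : T -> S).
Hypothesis mf : measurable_fun setT f.
Hypothesis fm : forall A, measurable A -> P (f @^-1` A) = m A.

Lemma eq_law_integral (g : S -> \bar R) : (\int[law P mf]_x g x = \int[m]_x g x)%E.
Proof. by apply: eq_measure_integral => A mA _; exact: fm. Qed.

Lemma eq_law_integrable (g : S -> R) : measurable_fun setT g ->
  P.-integrable setT (EFin \o (g \o f)) <-> m.-integrable setT (EFin \o g).
Proof.
move=> mg; rewrite (law_integrable P mf mg).
by split=> /integrableP[meg ig]; apply/integrableP; split => //; move: ig;
  rewrite eq_law_integral.
Qed.

Lemma eq_law_Rintegral (g : S -> R) : measurable_fun setT g ->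
  m.-integrable setT (EFin \o g) -> \int[P]_x g (f x) = \int[m]_x g x.
Proof.
move=> mg ig; rewrite -(Rintegral_law mf)//; last exact/eq_law_integrable.
by rewrite /Rintegral eq_law_integral.
Qed.

Lemma eq_law_sqint (g : S -> R) : sqint m g -> sqint P (g \o f).
Proof.
move=> [mg ig]; split; first exact: measurableT_comp.
exact/(eq_law_integrable (measurable_funX 2 mg)).
Qed.

End equal_laws.

Lemma indep_eq_law d d1 d2 (T : measurableType d) (S1 : measurableType d1)
    (S2 : measurableType d2) (R : realType) (P : probability T R)
    (m1 : probability S1 R) (m2 : probability S2 R) (U : T -> S1) (V : T -> S2) :
  measurable_fun setT U -> measurable_fun setT V ->
  indep P (g_sigma_algebra_preimage U) (g_sigma_algebra_preimage V) ->
  (forall A, measurable A -> P (U @^-1` A) = m1 A) ->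
  (forall A, measurable A -> P (V @^-1` A) = m2 A) ->
  forall A, measurable A -> P ((fun w => (U w, V w)) @^-1` A) = prodP m1 m2 A.
Proof.
move=> mU mV UV U1 V2 A mA.
have mUV : measurable_fun setT (fun w => (U w, V w)) by exact: measurable_fun_pair.
rewrite -[LHS]/(law P mUV A); apply/esym.
rewrite -[LHS]/((m1 \x m2)%E A) (@product_measure_unique _ _ _ _ _ _ _ (law P mUV))//.
move=> B C mB mC; transitivity (P (U @^-1` B) * P (V @^-1` C))%E; last first.
  by congr (_ * _)%E; [exact: U1|exact: V2].
rewrite -UV; [|exact: preimage_systemP..].
by congr (P _); apply/seteqP; split.
Qed.

(** The variance, as the integral of (f - c)^2 with c the mean, is nonnegative. *)
Lemma sqr_Rintegral_le d (T : measurableType d) (R : realType) (P : probability T R)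
    (f : T -> R) : sqint P f -> (\int[P]_x f x) ^+ 2 <= \int[P]_x (f x ^+ 2).
Proof.
move=> sf; have [mf if2] := sf; have i1 := sqint_integrable sf.
set c := \int[P]_x f x.
have ic : P.-integrable setT (EFin \o cst (c ^+ 2)) by case: (sqint_cst P c).
have iZ : P.-integrable setT (EFin \o (fun x => 2 * c * f x)).
  by have := integrableZl measurableT (2 * c) i1; apply: eq_integrable.
have iB : P.-integrable setT (EFin \o (fun x => f x ^+ 2 - 2 * c * f x)).
  by have := integrableB measurableT if2 iZ; apply: eq_integrable.
have : 0 <= \int[P]_x ((f x ^+ 2 - 2 * c * f x) + c ^+ 2).
  apply: Rintegral_ge0 => x _.
  by rewrite (_ : _ + _ = (f x - c) ^+ 2) ?sqr_ge0//; ring.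
rewrite RintegralD// RintegralB// RintegralZl// Rintegral_cst//= probability_setT/= -/c.
by rewrite mulr1 !expr2 => ?; lra.
Qed.

Lemma sqint_Rintegral1 d1 d2 (T1 : measurableType d1) (T2 : measurableType d2)
    (R : realType) (P1 : probability T1 R) (P2 : probability T2 R) (f : T1 * T2 -> R) :
  sqint (prodP P1 P2) f -> (forall x, sqint P2 (fun y => f (x, y))) ->
  sqint P1 (fun x => \int[P2]_y f (x, y)).
Proof.
move=> sf sx; have mI := measurable_Rintegral1 (sqint_integrable sf).
split => //; case: sf => mf if2; apply: (le_integrable measurableT _ _ (integrable_Rintegral1 if2)).
  by apply/measurable_EFinP; exact: measurable_funX.
move=> x _; rewrite /= lee_fin ger0_norm ?sqr_ge0//.
exact: le_trans (sqr_Rintegral_le (sx x)) (ler_norm _).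
Qed.

Section kernel_hat.
Context d (S : measurableType d) (R : realType) (mu : probability S R).
Local Notation nu := (prodP mu mu).
Variables (K : S -> S -> R) (C : R) (beta : S -> R).
Hypothesis mK : measurable_fun setT (fun z : S * S => K z.1 z.2).
Hypothesis sb : sqint mu beta.
Hypothesis KC : forall x y, K x y = K y x.
Hypothesis Kb : forall x0 x1 x2 x3,
  `|hatk K x0 x1 x2 x3| <= C * ((beta x0 + beta x2) * (beta x1 + beta x3)).

(** The points are paired as ((z0, z1), (z2, z3)), unlike in [quad1], because the conditioning is on
    the first two copies. *)
Definition pair_hat (u v : S * S) := hatk K u.1 u.2 v.1 v.2.
(** Formally the doubly centred kernel K x y - E K (x, Z) - E K (Z, y) + E K (Z, Z'). *)
Definition proj_hat (u : S * S) := \int[nu]_v pair_hat u v.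

Lemma sqint_pair_hat : sqint (prodP nu nu) (fun q => pair_hat q.1 q.2).
Proof.
have s1 := sqint_fst mu sb; have s2 := sqint_snd mu sb; have s12 := sqint_prodM sb sb.
(* Expanding the product makes each term a product of functions of independent pairs, as the
   grouping of the bound is not that of [pair_hat]. *)
apply: (sqint_le (g := fun q => C * ((beta q.1.1 * beta q.1.2 + beta q.1.1 * beta q.2.2) +
    (beta q.1.2 * beta q.2.1 + beta q.2.1 * beta q.2.2)))).
- by apply: (measurable_hatk mK); [exact: (measurableT_comp measurable_fst measurable_fst)|
  exact: (measurableT_comp measurable_snd measurable_fst)|
  exact: (measurableT_comp measurable_fst measurable_snd)|
  exact: (measurableT_comp measurable_snd measurable_snd)].
- move=> q; apply: (le_trans (Kb _ _ _ _)); rewrite le_eqVlt; apply/orP; left.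
  by apply/eqP; ring.
- apply: sqintZ; apply: sqintD; apply: sqintD.
  + exact: (sqint_fst nu s12).
  + exact: (sqint_prodM s1 s2).
  + exact: (sqint_prodM s2 s1).
  + exact: (sqint_snd nu s12).
Qed.

Lemma sqint_pair_hat2 u : sqint nu (pair_hat u).
Proof.
apply: (sqint_le (g := fun v => C * ((beta u.1 + beta v.1) * (beta u.2 + beta v.2)))).
- by apply: (measurable_hatk mK); [exact: measurable_cst|exact: measurable_cst|
    exact: measurable_fst|exact: measurable_snd].
- by move=> v; exact: Kb.
- apply: sqintZ; apply: (sqint_prodM (f := fun x => beta u.1 + beta x)
    (g := fun y => beta u.2 + beta y)).
    exact: (sqintD (sqint_cst mu (beta u.1)) sb).
  exact: (sqintD (sqint_cst mu (beta u.2)) sb).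
Qed.

Lemma sqint_proj_hat : sqint nu proj_hat.
Proof. exact: (sqint_Rintegral1 sqint_pair_hat sqint_pair_hat2). Qed.

(** The identity already holds for [pair_hat] at each [v], by symmetry of [K], so it only takes the
    integrability of [pair_hat] and not that of the separate terms of the hat. *)
Lemma hatk_proj_hat z0 z1 z2 z3 : hatk K z0 z1 z2 z3 =
  proj_hat (z0, z1) - proj_hat (z2, z1) + proj_hat (z2, z3) - proj_hat (z0, z3).
Proof.
have i u := sqint_integrable (sqint_pair_hat2 u).
have iB u u' : nu.-integrable setT (EFin \o (fun v => pair_hat u v - pair_hat u' v)).
  by have := integrableB measurableT (i u) (i u'); apply: eq_integrable.
have EB u u' : \int[nu]_v (pair_hat u v - pair_hat u' v) = proj_hat u - proj_hat u'.
  by rewrite RintegralB.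
transitivity (\int[nu]_v ((pair_hat (z0, z1) v - pair_hat (z2, z1) v) +
    (pair_hat (z2, z3) v - pair_hat (z0, z3) v))).
  transitivity (\int[nu]_v (cst (hatk K z0 z1 z2 z3) v)).
    by rewrite Rintegral_cst//= probability_setT/= mulr1.
  apply: eq_Rintegral => v _.
  by rewrite /pair_hat /hatk /= (KC z2 z1) (KC z0 z3) (KC v.2 z0) (KC v.2 z2); ring.
rewrite RintegralD//; [|exact: iB..].
by rewrite !EB addrA.
Qed.

End kernel_hat.

Section independent_sample.
Context d (T : measurableType d) (R : realType) (P : probability T R).
Context d' (S : measurableType d') (mu : probability S R).
Local Notation nu := (prodP mu mu).
Local Notation M := (prodP nu nu).
Variables (Z : nat -> T -> S) (F : nat -> set (set T)).
Hypothesis mZ : forall i, measurable_fun setT (Z i).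
Hypothesis hF : mutually_independent P setT F.
Hypothesis Fm : forall i, F i `<=` measurable.
Hypothesis FT : forall i, F i setT.
Hypothesis FI : forall i, setI_closed (F i).
Hypothesis ZF : forall i, g_sigma_algebra_preimage (Z i) `<=` F i.
Hypothesis Zmu : forall i A, measurable A -> P (Z i @^-1` A) = mu A.

Let pairZ a b w := (Z a w, Z b w).
Let mpairZ a b : measurable_fun setT (pairZ a b).
Proof. exact: measurable_fun_pair. Qed.

Let sample_indep (D1 D2 : set nat) (G1 G2 : set (set T)) :
  (forall i, D1 i -> ~ D2 i) ->
  G1 `<=` <<s \bigcup_(k in D1) F k >> -> G2 `<=` <<s \bigcup_(k in D2) F k >> ->
  indep P G1 G2.
Proof.
move=> d12 g1 g2; apply: indepS (g1) (g2) _.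
exact: (mutually_independent_indep hF (fun i _ => Fm (i := i)) (fun i _ => FT i)
  (fun i _ => FI (i := i))).
Qed.

Let preZ a (D : set nat) : D a -> g_sigma_algebra_preimage (Z a) `<=` <<s \bigcup_(k in D) F k >>.
Proof. by move=> Da A hA; apply: sub_sigma_algebra; exists a => //; exact: ZF. Qed.

Let prepairZ a b : g_sigma_algebra_preimage (pairZ a b) `<=` <<s \bigcup_(k in [set a; b]) F k >>.
Proof.
apply: (subset_trans (@preimage_pair_sub _ _ _ _ _ _ (Z a) (Z b))).
apply: smallest_sub; first exact: smallest_sigma_algebra.
by move=> A [|]; apply: preZ; [left|right].
Qed.

Lemma pair_law a b : a != b -> forall A, measurable A -> P (pairZ a b @^-1` A) = nu A.
Proof.
move=> ab; apply: indep_eq_law => //; [|exact: Zmu|exact: Zmu].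
apply: (sample_indep (D1 := [set a]) (D2 := [set b])); [|exact: preZ|exact: preZ].
by move=> _ -> /= /eqP; rewrite (negbTE ab).
Qed.

Let indep_pairs a b c e : uniq [:: a; b; c; e] ->
  indep P (g_sigma_algebra_preimage (pairZ a b)) (g_sigma_algebra_preimage (pairZ c e)).
Proof.
move=> u; apply: (sample_indep (D1 := [set a; b]) (D2 := [set c; e])); [|exact: prepairZ..].
by move=> i [] -> [] h; move: u; rewrite h /= !inE eqxx ?orbT ?andbF.
Qed.

(** The law is the same for any four distinct indices in any order: this is the exchangeability of
    the copies. *)
Lemma quad_law a b c e : uniq [:: a; b; c; e] -> forall A, measurable A ->
  P ((fun w => (pairZ a b w, pairZ c e w)) @^-1` A) = M A.
Proof.
move=> u; have [ab ce] : a != b /\ c != e.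
  by move: u; rewrite /= !inE !negb_or -!andbA => /and5P[-> _ _ _ /and3P[_ -> _]].
by apply: indep_eq_law => //; [exact: indep_pairs|exact: pair_law|exact: pair_law].
Qed.

Section kernels.
Variables (K : S -> S -> R) (C : R) (beta : S -> R).
Hypothesis mK : measurable_fun setT (fun z : S * S => K z.1 z.2).
Hypothesis sb : sqint mu beta.
Hypothesis KC : forall x y, K x y = K y x.
Hypothesis Kb : forall x0 x1 x2 x3,
  `|hatk K x0 x1 x2 x3| <= C * ((beta x0 + beta x2) * (beta x1 + beta x3)).

Let hatZ w := hatk K (Z 0%N w) (Z 1%N w) (Z 2%N w) (Z 3%N w).

Lemma hat_projE w : hatZ w = proj_hat mu K (pairZ 0 1 w) - proj_hat mu K (pairZ 2 1 w) +
  proj_hat mu K (pairZ 2 3 w) - proj_hat mu K (pairZ 0 3 w).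
Proof. exact: (hatk_proj_hat mK sb KC Kb). Qed.

Lemma sqint_proj_hatZ a b : a != b -> sqint P (fun w => proj_hat mu K (pairZ a b w)).
Proof.
move=> ab; apply: (eq_law_sqint (mpairZ a b) (pair_law ab)).
exact: (sqint_proj_hat mK sb Kb).
Qed.

Lemma sqint_hatZ : sqint P hatZ.
Proof.
have u : uniq [:: 0%N; 1%N; 2%N; 3%N] by [].
have m4 : measurable_fun setT (fun w => (pairZ 0 1 w, pairZ 2 3 w)).
  by apply: measurable_fun_pair; exact: mpairZ.
exact: (eq_law_sqint m4 (quad_law u) (sqint_pair_hat mK sb Kb)).
Qed.

(** Copies 2 and 3 are integrated out at frozen copies 0 and 1. [G] is kept general because one hat
    is conditioned on X_0, X_1 and the other on Y_0, Y_1, never on the pairs. *)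
Lemma cond_exp_hat (G : set (set T)) :
  G `<=` F 0%N `|` F 1%N ->
  measurable_fun setT ((fun z => pair_hat K (pairZ 0 1 z.1) z.2) :
    g_sigma_algebraType G * (S * S) -> R) ->
  measurable_fun setT (cond_exp P <<s G>> hatZ) /\
  {ae P, forall w, cond_exp P <<s G>> hatZ w = proj_hat mu K (pairZ 0 1 w)}.
Proof.
move=> GF mpi.
have Gm : G `<=` measurable by move=> A /GF []; exact: Fm.
have ind : indep P <<s G>> (g_sigma_algebra_preimage (pairZ 2 3)).
  apply: (sample_indep (D1 := [set 0%N; 1%N]) (D2 := [set 2%N; 3%N])).
  - by move=> i [] -> [].
  - by apply: sub_sigma_algebra2 => A /GF [hA|hA]; [exists 0%N => //; left|exists 1%N => //; right].
  - exact: prepairZ.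
have [mc Ec] := cond_expP Gm (is_cond_exp_freezing Gm (mpairZ 2 3) ind mpi
  (sqint_integrable sqint_hatZ)).
split => //; apply: filterS Ec => w ->.
rewrite /proj_hat /Rintegral (eq_law_integral (mpairZ 2 3) (m := nu))//.
exact: pair_law.
Qed.

End kernels.

Section two_kernels.
Variables (K1 K2 : S -> S -> R) (C1 C2 : R) (beta1 beta2 : S -> R).
Hypothesis mK1 : measurable_fun setT (fun z : S * S => K1 z.1 z.2).
Hypothesis mK2 : measurable_fun setT (fun z : S * S => K2 z.1 z.2).
Hypotheses (sb1 : sqint mu beta1) (sb2 : sqint mu beta2).
Hypothesis K1C : forall x y, K1 x y = K1 y x.
Hypothesis K2C : forall x y, K2 x y = K2 y x.
Hypothesis K1b : forall x0 x1 x2 x3,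
  `|hatk K1 x0 x1 x2 x3| <= C1 * ((beta1 x0 + beta1 x2) * (beta1 x1 + beta1 x3)).
Hypothesis K2b : forall x0 x1 x2 x3,
  `|hatk K2 x0 x1 x2 x3| <= C2 * ((beta2 x0 + beta2 x2) * (beta2 x1 + beta2 x3)).

Let J := \int[nu]_u (proj_hat mu K1 u * proj_hat mu K2 u).

Let J_pair : \int[P]_w (proj_hat mu K1 (pairZ 0 1 w) * proj_hat mu K2 (pairZ 0 1 w)) = J.
Proof.
have s1 := sqint_proj_hat mK1 sb1 K1b; have s2 := sqint_proj_hat mK2 sb2 K2b.
rewrite (eq_law_Rintegral (mpairZ 0 1) (pair_law (isT : 0%N != 1%N))
  (g := fun u => proj_hat mu K1 u * proj_hat mu K2 u))//.
  by case: s1 => ? _; case: s2 => ? _; exact: measurable_funM.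
exact: sqint_integrableM.
Qed.

(** Integrating over copies [c] and [e] first turns the second hat into its projection on copies [a]
    and [b]. *)
Let J_quad a b c e : uniq [:: a; b; c; e] ->
  \int[P]_w (proj_hat mu K1 (pairZ a b w) * hatk K2 (Z a w) (Z b w) (Z c w) (Z e w)) = J.
Proof.
move=> u.
have s1 := sqint_fst nu (sqint_proj_hat mK1 sb1 K1b).
have s2 := sqint_pair_hat mK2 sb2 K2b.
have i12 := sqint_integrableM s1 s2.
have m4 : measurable_fun setT (fun w => (pairZ a b w, pairZ c e w)).
  by apply: measurable_fun_pair; exact: mpairZ.
rewrite -[LHS]/(\int[P]_w (fun q : (S * S) * (S * S) => proj_hat mu K1 q.1 * pair_hat K2 q.1 q.2)
  (pairZ a b w, pairZ c e w)).
rewrite (eq_law_Rintegral m4 (quad_law u))//; last first.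
  by case: s1 => ? _; case: s2 => ? _; exact: measurable_funM.
rewrite -Rintegral12//; apply: eq_Rintegral => v _ /=.
by rewrite RintegralZl//; exact: (sqint_integrable (sqint_pair_hat2 mK2 sb2 K2b v)).
Qed.

Lemma Rintegral_hatM :
  \int[P]_w (hatk K1 (Z 0%N w) (Z 1%N w) (Z 2%N w) (Z 3%N w) *
    hatk K2 (Z 0%N w) (Z 1%N w) (Z 2%N w) (Z 3%N w)) =
  4 * \int[P]_w (proj_hat mu K1 (pairZ 0 1 w) * proj_hat mu K2 (pairZ 0 1 w)).
Proof.
pose h w := hatk K2 (Z 0%N w) (Z 1%N w) (Z 2%N w) (Z 3%N w).
pose p a b w := proj_hat mu K1 (pairZ a b w).
have sh : sqint P h by exact: (sqint_hatZ mK2 sb2 K2b).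
have i a b : a != b -> P.-integrable setT (EFin \o (fun w => p a b w * h w)).
  by move=> ab; apply: sqint_integrableM => //; exact: (sqint_proj_hatZ mK1 sb1 K1b).
have iN a b : a != b -> P.-integrable setT (EFin \o (fun w => - (p a b w * h w))).
  by move=> ab; have := integrableN (i a b ab); apply: eq_integrable.
(* Exchanging copies 0 and 2, or copies 1 and 3, changes the sign of [h]. *)
have E01 : \int[P]_w (p 0%N 1%N w * h w) = J by exact: (J_quad (isT : uniq [:: 0%N; 1%N; 2%N; 3%N])).
have E21 : \int[P]_w (- (p 2%N 1%N w * h w)) = J.
  rewrite -(J_quad (isT : uniq [:: 2%N; 1%N; 0%N; 3%N])); apply: eq_Rintegral => w _.
  rewrite -mulrN; congr (_ * _); rewrite /h /hatk (K2C (Z 2%N w) (Z 1%N w))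
    (K2C (Z 1%N w) (Z 0%N w)) (K2C (Z 0%N w) (Z 3%N w)) (K2C (Z 3%N w) (Z 2%N w)); ring.
have E23 : \int[P]_w (p 2%N 3%N w * h w) = J.
  rewrite -(J_quad (isT : uniq [:: 2%N; 3%N; 0%N; 1%N])); apply: eq_Rintegral => w _.
  by congr (_ * _); rewrite /h /hatk; ring.
have E03 : \int[P]_w (- (p 0%N 3%N w * h w)) = J.
  rewrite -(J_quad (isT : uniq [:: 0%N; 3%N; 2%N; 1%N])); apply: eq_Rintegral => w _.
  rewrite -mulrN; congr (_ * _); rewrite /h /hatk (K2C (Z 0%N w) (Z 3%N w))
    (K2C (Z 3%N w) (Z 2%N w)) (K2C (Z 2%N w) (Z 1%N w)) (K2C (Z 1%N w) (Z 0%N w)); ring.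
rewrite J_pair.
transitivity (\int[P]_w ((p 0%N 1%N w * h w + - (p 2%N 1%N w * h w)) +
    (p 2%N 3%N w * h w + - (p 0%N 3%N w * h w)))).
  by apply: eq_Rintegral => w _; rewrite (hat_projE mK1 sb1 K1C K1b) /p /h; ring.
have iD a b c e : a != b -> c != e -> P.-integrable setT (EFin \o
    (fun w => p a b w * h w + - (p c e w * h w))).
  by move=> ab ce; have := integrableD measurableT (i a b ab) (iN c e ce); apply: eq_integrable.
rewrite RintegralD//; [|exact: iD|exact: iD].
rewrite !RintegralD//; [|exact: i|exact: iN|exact: i|exact: iN].
by rewrite E01 E21 E23 E03; ring.
Qed.

End two_kernels.

End independent_sample.

Section copies_value.
Context (R : realType) (alpha : R) (H H' : completeNormedModType R).
Hypothesis halpha : 0 < alpha < 2.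
Local Notation S := (borel H * borel H')%type.
Hypothesis mdist : measurable_fun setT (fun z : borel H * borel H => `|(z.1 : H) - z.2|).
Hypothesis mdist' : measurable_fun setT (fun z : borel H' * borel H' => `|(z.1 : H') - z.2|).
Hypothesis kern_bound : forall r (x0 x1 x2 x3 : H) l, 0 < l ->
  `|hatk (kern r) x0 x1 x2 x3| <= l * (1 - kern r x0 x2) + l^-1 * (1 - kern r x1 x3).
Hypothesis kern_bound' : forall r (x0 x1 x2 x3 : H') l, 0 < l ->
  `|hatk (kern r) x0 x1 x2 x3| <= l * (1 - kern r x0 x2) + l^-1 * (1 - kern r x1 x3).
Variable mu : probability S R.
Hypothesis sq1 : sqint mu (fun z => half_pow alpha (z.1 : H)).
Hypothesis sq2 : sqint mu (fun z => half_pow alpha (z.2 : H')).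
Local Notation nu := (prodP mu mu).
Context d (T : measurableType d) (P : probability T R).
Variables (Xs : nat -> {RV P >-> borel H}) (Ys : nat -> {RV P >-> borel H'}).
Hypothesis hind : mutually_independent P setT (fun i => sigma_pair (Xs i) (Ys i)).
Hypothesis hlaw : forall i A, measurable A -> P ((fun w => (Xs i w, Ys i w)) @^-1` A) = mu A.

Let Z i w : S := (Xs i w, Ys i w).
Let mXs i : measurable_fun setT (Xs i). Proof. by []. Qed.
Let mYs i : measurable_fun setT (Ys i). Proof. by []. Qed.
Let mZ i : measurable_fun setT (Z i). Proof. exact: measurable_fun_pair. Qed.
Let F i := sigma_pair (Xs i) (Ys i).

Let XF i : g_sigma_algebra_preimage (Xs i) `<=` F i.
Proof. by move=> A hA; apply: sub_sigma_algebra; left. Qed.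
Let YF i : g_sigma_algebra_preimage (Ys i) `<=` F i.
Proof. by move=> A hA; apply: sub_sigma_algebra; right. Qed.

Let Fm i : F i `<=` measurable.
Proof.
by apply: sigma_sub_measurable => A [] h; [exact: (preimage_system_measurable (mXs i))|
  exact: (preimage_system_measurable (mYs i))].
Qed.
Let FT i : F i setT. Proof. exact: sigmaT. Qed.
Let FI i : setI_closed (F i). Proof. exact: sigmaI. Qed.
Let ZF i : g_sigma_algebra_preimage (Z i) `<=` F i.
Proof. exact: preimage_pair_sub. Qed.

(** Both kernels live on the space of pairs, each reading one component, so that a single sample of
    pairs carries the dependence between X and Y. *)
Let K1 (z z' : S) := dist_pow alpha (z.1 : H) z'.1.
Let K2 (z z' : S) := dist_pow alpha (z.2 : H') z'.2.

Let mK1 : measurable_fun setT (fun z : S * S => K1 z.1 z.2).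
Proof.
exact: (measurableT_comp (measurable_dist_pow alpha mdist) (measurable_fun_pair
  (measurableT_comp measurable_fst (@measurable_fst _ _ S S))
  (measurableT_comp measurable_fst (@measurable_snd _ _ S S)))).
Qed.

Let mK2 : measurable_fun setT (fun z : S * S => K2 z.1 z.2).
Proof.
exact: (measurableT_comp (measurable_dist_pow alpha mdist') (measurable_fun_pair
  (measurableT_comp measurable_snd (@measurable_fst _ _ S S))
  (measurableT_comp measurable_snd (@measurable_snd _ _ S S)))).
Qed.

Let K1C x y : K1 x y = K1 y x. Proof. by rewrite /K1 /dist_pow distrC. Qed.
Let K2C x y : K2 x y = K2 y x. Proof. by rewrite /K2 /dist_pow distrC. Qed.

Let K1b (x0 x1 x2 x3 : S) : `|hatk K1 x0 x1 x2 x3| <=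
  8 * ((half_pow alpha (x0.1 : H) + half_pow alpha (x2.1 : H)) *
    (half_pow alpha (x1.1 : H) + half_pow alpha (x3.1 : H))).
Proof. exact: (hatk_dist_bound halpha kern_bound). Qed.

Let K2b (x0 x1 x2 x3 : S) : `|hatk K2 x0 x1 x2 x3| <=
  8 * ((half_pow alpha (x0.2 : H') + half_pow alpha (x2.2 : H')) *
    (half_pow alpha (x1.2 : H') + half_pow alpha (x3.2 : H'))).
Proof. exact: (hatk_dist_bound halpha kern_bound'). Qed.

Let sqhX : sqint P (hat alpha Xs).
Proof. exact: (sqint_hatZ mZ hind Fm FT FI ZF hlaw mK1 sq1 K1b). Qed.
Let sqhY : sqint P (hat alpha Ys).
Proof. exact: (sqint_hatZ mZ hind Fm FT FI ZF hlaw mK2 sq2 K2b). Qed.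

Let H1 := proj_hat mu K1.
Let H2 := proj_hat mu K2.

Let tildeX : measurable_fun setT (tilde P alpha Xs) /\
  {ae P, forall w, tilde P alpha Xs w = H1 (Z 0 w, Z 1 w)}.
Proof.
apply: (cond_exp_hat mZ hind Fm FT FI ZF hlaw mK1 sq1 K1b).
  by move=> A [] hA; [left|right]; exact: XF.
have mG (i : nat) : (i = 0 \/ i = 1)%N -> measurable_fun setT (Xs i :
    g_sigma_algebraType (g_sigma_algebra_preimage (Xs 0%N) `|` g_sigma_algebra_preimage (Xs 1%N)) -> borel H).
  by move=> [] ->; apply/preimage_sub_sigma => A hA; apply: sub_sigma_algebra; [left|right].
apply: (measurable_hatk (measurable_dist_pow alpha mdist)).
- exact: (measurableT_comp (mG 0%N (or_introl erefl)) measurable_fst).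
- exact: (measurableT_comp (mG 1%N (or_intror erefl)) measurable_fst).
- exact: (measurableT_comp measurable_fst (measurableT_comp measurable_fst measurable_snd)).
- exact: (measurableT_comp measurable_fst (measurableT_comp measurable_snd measurable_snd)).
Qed.

Let tildeY : measurable_fun setT (tilde P alpha Ys) /\
  {ae P, forall w, tilde P alpha Ys w = H2 (Z 0 w, Z 1 w)}.
Proof.
apply: (cond_exp_hat mZ hind Fm FT FI ZF hlaw mK2 sq2 K2b).
  by move=> A [] hA; [left|right]; exact: YF.
have mG (i : nat) : (i = 0 \/ i = 1)%N -> measurable_fun setT (Ys i :
    g_sigma_algebraType (g_sigma_algebra_preimage (Ys 0%N) `|` g_sigma_algebra_preimage (Ys 1%N)) -> borel H').
  by move=> [] ->; apply/preimage_sub_sigma => A hA; apply: sub_sigma_algebra; [left|right].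
apply: (measurable_hatk (measurable_dist_pow alpha mdist')).
- exact: (measurableT_comp (mG 0%N (or_introl erefl)) measurable_fst).
- exact: (measurableT_comp (mG 1%N (or_intror erefl)) measurable_fst).
- exact: (measurableT_comp measurable_snd (measurableT_comp measurable_fst measurable_snd)).
- exact: (measurableT_comp measurable_snd (measurableT_comp measurable_snd measurable_snd)).
Qed.

Lemma dcov_hat_quad : dcov_hat P alpha Xs Ys =
  (4^-1 * \int[prodP nu nu]_q
    (quad1 (@dist_pow R alpha H) q * quad2 (@dist_pow R alpha H') q))%:E.
Proof.
rewrite /dcov_hat unlock -(@fineK _ (\int[P]_w _)%E); last first.
  by apply: integrable_fin_num => //; exact: sqint_integrableM.
rewrite -EFinM div1r; congr (_ * _)%:E.
have s1 := sqint_quad1 halpha mdist kern_bound sq1.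
have s2 := sqint_quad2 halpha mdist' kern_bound' sq2.
(* The order 0, 2, 1, 3 matches the grouping of [quad1] and [quad2]. *)
have u : uniq [:: 0%N; 2%N; 1%N; 3%N] by [].
have m4 : measurable_fun setT (fun w => ((Z 0 w, Z 2 w), (Z 1 w, Z 3 w))).
  by do 2 (apply: measurable_fun_pair => //); exact: measurable_fun_pair.
rewrite -(eq_law_Rintegral m4 (quad_law mZ hind Fm FT FI ZF hlaw u)
  (g := fun q => quad1 (@dist_pow R alpha H) q * quad2 (@dist_pow R alpha H') q))//.
  by case: s1 => ? _; case: s2 => ? _; exact: measurable_funM.
exact: sqint_integrableM.
Qed.

Lemma dcov_hat_tilde : dcov_hat P alpha Xs Ys = dcov_tilde P alpha Xs Ys.
Proof.
have [mtX EX] := tildeX; have [mtY EY] := tildeY.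
have s1 := sqint_proj_hatZ mZ hind Fm FT FI ZF hlaw mK1 sq1 K1b (isT : 0%N != 1%N).
have s2 := sqint_proj_hatZ mZ hind Fm FT FI ZF hlaw mK2 sq2 K2b (isT : 0%N != 1%N).
have i12 := sqint_integrableM s1 s2.
rewrite /dcov_hat /dcov_tilde unlock.
rewrite [RHS](ae_eq_integral (EFin \o (fun w => H1 (Z 0 w, Z 1 w) * H2 (Z 0 w, Z 1 w)))) //; first last.
- by apply: filterS2 EX EY => w + + _ => /= -> ->.
- exact: measurable_int i12.
- by apply/measurable_EFinP; exact: measurable_funM.
rewrite -(@fineK _ (\int[P]_w _)%E); last first.
  by apply: integrable_fin_num => //; exact: sqint_integrableM.
rewrite -[RHS]fineK; last exact: integrable_fin_num i12.
rewrite -EFinM div1r; congr EFin.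
have := Rintegral_hatM mZ hind Fm FT FI ZF hlaw mK1 mK2 sq1 sq2 K1C K2C K1b K2b.
by rewrite /Rintegral => /= ->; rewrite mulKf.
Qed.

End copies_value.

Theorem theorem6p4 (R : realType) (alpha : R)
  (halpha : 0 < alpha < 2)
  (H H' : completeNormedModType R)
  (ip : {dot H for @idfun R}) (ip' : {dot H' for @idfun R})
  (hip : induces_norm ip) (hip' : induces_norm ip')
  (hsep : separable H) (hsep' : separable H')
  (dim dim' : option nat) (e : nat -> H) (e' : nat -> H')
  (he : orthonormal_basis ip dim e) (he' : orthonormal_basis ip' dim' e')
  (d : measure_display) (T : measurableType d) (P : probability T R)
  (X : {RV P >-> borel H}) (Y : {RV P >-> borel H'})
  (xi eta : nat -> {RV P >-> R})
  (hgauss : gaussian_family P dim dim' xi eta X Y)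
  (d' : measure_display) (T' : measurableType d') (P' : probability T' R)
  (Xs : nat -> {RV P' >-> borel H}) (Ys : nat -> {RV P' >-> borel H'})
  (hcopies : independent_copies P P' X Y Xs Ys)
  (hX : ('E_P[fun w => (`|(X w : H)| `^ alpha)%R] < +oo)%E)
  (hY : ('E_P[fun w => (`|(Y w : H')| `^ alpha)%R] < +oo)%E) :
  [/\ dcovH P ip ip' alpha dim e xi dim' e' eta X Y = dcov_hat P' alpha Xs Ys,
      dcov_hat P' alpha Xs Ys = dcov_tilde P' alpha Xs Ys &
      dcovH P ip ip' alpha dim e xi dim' e' eta X Y \is a fin_num].
Proof.
have mZ : measurable_fun setT (fun w => (X w, Y w)) by exact: measurable_fun_pair.
have mX : measurable_fun setT X by [].
have mY : measurable_fun setT Y by [].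
have mxi i : measurable_fun setT (xi i) by [].
have meta i : measurable_fun setT (eta i) by [].
have mn := measurable_norm hip he; have mn' := measurable_norm hip' he'.
have mp (K : completeNormedModType R) : measurable_fun setT (fun x : borel K => `|x : K|) ->
    measurable_fun setT (fun x : borel K => half_pow alpha (x : K)).
  by move=> m; exact: (measurableT_comp (measurable_powR (alpha / 2)) m).
have sq1 : sqint (law P mZ) (fun z => half_pow alpha (z.1 : H)).
  apply/(sqint_law P mZ (measurableT_comp (mp _ mn) measurable_fst)).
  exact: (sqint_half_pow (measurableT_comp mn mX) hX).
have sq2 : sqint (law P mZ) (fun z => half_pow alpha (z.2 : H')).
  apply/(sqint_law P mZ (measurableT_comp (mp _ mn') measurable_snd)).
  exact: (sqint_half_pow (measurableT_comp mn' mY) hY).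
have md := measurable_dist hip he; have md' := measurable_dist hip' he'.
have kb := gaussian_kern_bound hip he mX mY mxi meta hgauss.
have kb' := gaussian_kern_bound' hip' he' mX mY mxi meta hgauss.
have [hind hlaw] := hcopies.
have E := dcovH_quad halpha hip hip' he he' hgauss sq1 sq2.
(* The Gaussian form and the form with copies live on different probability spaces; they meet in the
   same integral over four points drawn from the law of (X, Y). *)
split.
- rewrite E; apply/esym.
  exact: (dcov_hat_quad halpha md md' kb kb' sq1 sq2 hind hlaw).
- exact: (dcov_hat_tilde halpha md md' kb kb' sq1 sq2 hind hlaw).
- by rewrite E.
Qed.
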